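(* Suppose that $b_1,\ b_2,\ b_3,\ b_4,\ b_1-b_2,\ b_3-b_4\notin\mathbb Z$. Then the nine functions $$F_{jk}(x)=x_1^{1-b_{1j}}x_2^{1-b_{2k}}\,F\left(\begin{matrix}a+(2-b_{1j}-b_{2k})(e_1+e_2+e_3)\\ B_1+(1-b_{1j})(e_j+e_1+e_2)\\ B_2+(1-b_{2k})(e_k+e_1+e_2)\end{matrix};x\right)\qquad(1\le j,k\le 3)$$ form a fundamental system of solutions to $\mathcal F\left(\begin{matrix}a\\ B\end{matrix}\right)$ on $U$. (Explicitly, the first lower parameter row is $(2-b_1,\,b_2-b_1+1,\,1)$ for $j=1$, $(b_1-b_2+1,\,2-b_2,\,1)$ for $j=2$, $(b_1,b_2,1)$ for $j=3$; the second lower parameter row is $(2-b_3,\,b_4-b_3+1,\,1)$ for $k=1$, $(b_3-b_4+1,\,2-b_4,\,1)$ for $k=2$, $(b_3,b_4,1)$ for $k=3$.)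
   Context: For $\alpha\in\mathbb C$ and $n\in\mathbb N=\{0,1,2,\dots\}$ put $(\alpha,n)=\alpha(\alpha+1)\cdots(\alpha+n-1)$. Parameters: $a=(a_1,a_2,a_3)\in\mathbb C^3$, $B=\begin{pmatrix}B_1\\ B_2\end{pmatrix}=\begin{pmatrix}b_{11}&b_{12}&b_{13}\\ b_{21}&b_{22}&b_{23}\end{pmatrix}=\begin{pmatrix}b_1&b_2&1\\ b_3&b_4&1\end{pmatrix}$, and $e_j$ is the $j$-th unit row vector of length $3$. When $b_1,\dots,b_4\notin\{0,-1,-2,\dots\}$, the hypergeometric series is $$F\left(\begin{matrix}a\\ B\end{matrix};x\right)=\sum_{n_1,n_2=0}^\infty\frac{(a_1,n_1+n_2)(a_2,n_1+n_2)(a_3,n_1+n_2)}{(b_1,n_1)(b_2,n_1)(1,n_1)(b_3,n_2)(b_4,n_2)(1,n_2)}x_1^{n_1}x_2^{n_2},$$ absolutely convergent on $\mathbb D=\{x\in\mathbb C^2\mid\sqrt[3]{|x_1|}+\sqrt[3]{|x_2|}<1\}$. With $\theta_i=x_i\partial/\partial x_i$, the system $\mathcal F\left(\begin{matrix}a\\ B\end{matrix}\right)$ consists of the two equations $\prod_{j=1}^3(b_{ij}-1+\theta_i)f=x_i\prod_{j=1}^3(a_j+\theta_1+\theta_2)f$ $(i=1,2)$. Let $R(x)=(1-x_1-x_2)^3-27x_1x_2$ and $X=\{x\in\mathbb C^2\mid x_1x_2R(x)\ne0\}$. $U$ is a small (simply connected) neighborhood in $\mathbb D\cap X$ of a base point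 $\dot x=(\varepsilon_1,\varepsilon_2)\in\mathbb D\cap X\cap\mathbb R^2$ with $0<\varepsilon_2<\varepsilon_1$; branches of the power functions are fixed on $U$. A fundamental system of solutions on $U$ is a basis of the vector space of holomorphic solutions on $U$. *)

(* Defs.v *)
From Stdlib Require Import Reals ZArith.
From Coquelicot Require Import Coquelicot.

Open Scope C_scope.

(** Row vectors of length 3 and matrices with rows of length 3 are functions on
    [nat], with entries indexed from 1 as in the mathematics; entries at any
    other index are never used. *)

Definition row3 (c1 c2 c3 : C) : nat -> C := fun j =>
  match j with
  | 1%nat => c1
  | 2%nat => c2
  | 3%nat => c3
  | _ => 0
  end.

Definition rows (r1 r2 : nat -> C) : nat -> nat -> C := fun i =>
  match i with
  | 1%nat => r1
  | _ => r2
  end.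

Definition unit_row (j : nat) : nat -> C :=
  fun l => if Nat.eqb l j then 1 else 0.

Definition is_integer (z : C) : Prop := exists n : Z, z = RtoC (IZR n).

(** Coordinates are numbered 1 and 2. *)
Definition coord (i : nat) (x : C * C) : C :=
  match i with
  | 1%nat => fst x
  | _ => snd x
  end.

Fixpoint poch (alpha : C) (n : nat) : C :=
  match n with
  | O => 1
  | S m => poch alpha m * (alpha + INR m)
  end.

Definition Fterm (a : nat -> C) (B : nat -> nat -> C) (x : C * C) (n1 n2 : nat) : C :=
  (poch (a 1%nat) (n1 + n2) * poch (a 2%nat) (n1 + n2) * poch (a 3%nat) (n1 + n2))
  / (poch (B 1%nat 1%nat) n1 * poch (B 1%nat 2%nat) n1 * poch (B 1%nat 3%nat) n1
     * (poch (B 2%nat 1%nat) n2 * poch (B 2%nat 2%nat) n2 * poch (B 2%nat 3%nat) n2))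
  * (fst x ^ n1 * snd x ^ n2).

(** Meaningful when both real series converge, as Coquelicot's [Series]. *)
Definition CSeries (u : nat -> C) : C :=
  (Series (fun n => fst (u n)), Series (fun n => snd (u n))).

(** The double series converges absolutely on [dom_D], so its sum is the
    iterated one. *)
Definition hypF (a : nat -> C) (B : nat -> nat -> C) (x : C * C) : C :=
  CSeries (fun n1 => CSeries (fun n2 => Fterm a B x n1 n2)).

(** [Rpower 0 y] is 1 in the standard library, hence the case distinction. *)
Definition cbrt (r : R) : R :=
  if Rlt_dec 0 r then Rpower r (/ 3) else 0%R.

Definition dom_D (x : C * C) : Prop :=
  (cbrt (Cmod (fst x)) + cbrt (Cmod (snd x)) < 1)%R.

Definition disc_R (x : C * C) : C :=
  (1 - fst x - snd x) ^ 3 - 27 * fst x * snd x.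

Definition dom_X (x : C * C) : Prop :=
  fst x * snd x * disc_R x <> 0.

(** [C_derive] is total; it is the complex derivative wherever that exists, in
    particular for the functions satisfying [holomorphic_on] below. *)
Definition pderiv (i : nat) (f : C * C -> C) (x : C * C) : C :=
  match i with
  | 1%nat => C_derive (fun z => f (z, snd x)) (fst x)
  | _ => C_derive (fun z => f (fst x, z)) (snd x)
  end.

Definition theta (i : nat) (f : C * C -> C) : C * C -> C :=
  fun x => coord i x * pderiv i f x.

Definition shift_theta (c : C) (i : nat) (f : C * C -> C) : C * C -> C :=
  fun x => c * f x + theta i f x.

Definition shift_theta12 (c : C) (f : C * C -> C) : C * C -> C :=
  fun x => c * f x + theta 1 f x + theta 2 f x.

Definition system_eq (a : nat -> C) (B : nat -> nat -> C) (i : nat)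
    (f : C * C -> C) (x : C * C) : Prop :=
  shift_theta (B i 1%nat - 1) i
    (shift_theta (B i 2%nat - 1) i
      (shift_theta (B i 3%nat - 1) i f)) x
  = coord i x *
    shift_theta12 (a 1%nat) (shift_theta12 (a 2%nat) (shift_theta12 (a 3%nat) f)) x.

(** Complex (Frechet) differentiability at every point of [U]. *)
Definition holomorphic_on (U : C * C -> Prop) (f : C * C -> C) : Prop :=
  forall x, U x ->
    @ex_filterdiff C_AbsRing
      (prod_NormedModule C_AbsRing C_NormedModule C_NormedModule) C_NormedModule
      f (locally x).

Definition is_solution (a : nat -> C) (B : nat -> nat -> C) (U : C * C -> Prop)
    (f : C * C -> C) : Prop :=
  holomorphic_on U f /\
  forall x, U x -> system_eq a B 1 f x /\ system_eq a B 2 f x.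

(** Elements of the solution space are functions on [U]: total functions are
    compared on [U] only. *)
Definition lin_comb (c : nat -> nat -> C) (G : nat -> nat -> C * C -> C)
    (x : C * C) : C :=
  sum_n_m (fun j => sum_n_m (fun k => c j k * G j k x) 1 3) 1 3.

Definition fundamental_system (a : nat -> C) (B : nat -> nat -> C)
    (U : C * C -> Prop) (G : nat -> nat -> C * C -> C) : Prop :=
  (forall j k, (1 <= j <= 3)%nat -> (1 <= k <= 3)%nat -> is_solution a B U (G j k)) /\
  (forall c : nat -> nat -> C,
     (forall x, U x -> lin_comb c G x = 0) ->
     forall j k, (1 <= j <= 3)%nat -> (1 <= k <= 3)%nat -> c j k = 0) /\
  (forall f, is_solution a B U f ->
     exists c : nat -> nat -> C, forall x, U x -> f x = lin_comb c G x).

(** Paths and homotopies parametrized by [0,1] and [0,1]^2 are taken as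
    restrictions of continuous maps on R and R^2; clamping the parameters shows
    that this is no restriction. *)
Definition path_connected (U : C * C -> Prop) : Prop :=
  forall x y, U x -> U y ->
    exists g : R -> C * C,
      (forall t, continuous g t) /\ g 0%R = x /\ g 1%R = y /\
      (forall t, (0 <= t <= 1)%R -> U (g t)).

Definition null_homotopic_in (U : C * C -> Prop) (g : R -> C * C) : Prop :=
  exists H : R * R -> C * C,
    (forall p, continuous H p) /\
    (forall t s, (0 <= t <= 1)%R -> (0 <= s <= 1)%R -> U (H (t, s))) /\
    (forall t, (0 <= t <= 1)%R -> H (t, 0%R) = g t /\ H (t, 1%R) = g 0%R) /\
    (forall s, (0 <= s <= 1)%R -> H (0%R, s) = g 0%R /\ H (1%R, s) = g 0%R).

Definition simply_connected (U : C * C -> Prop) : Prop :=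
  path_connected U /\
  forall g : R -> C * C,
    (forall t, continuous g t) ->
    (forall t, (0 <= t <= 1)%R -> U (g t)) ->
    g 0%R = g 1%R ->
    null_homotopic_in U g.

Definition Cexp (z : C) : C :=
  ((exp (fst z) * cos (snd z))%R, (exp (fst z) * sin (snd z))%R).

(** [p] is a branch on [U] of the power function x_i^s, i.e. exp (s log x_i)
    for a continuous branch of log x_i on [U]. *)
Definition power_branch (U : C * C -> Prop) (i : nat) (s : C) (p : C * C -> C) : Prop :=
  exists l : C * C -> C,
    (forall x, U x -> continuous l x) /\
    (forall x, U x -> Cexp (l x) = coord i x) /\
    (forall x, U x -> p x = Cexp (s * l x)).

Definition shifted_a (a : nat -> C) (B : nat -> nat -> C) (j k : nat) : nat -> C :=
  fun l => a l + (2 - B 1%nat j - B 2%nat k)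
                 * (unit_row 1 l + unit_row 2 l + unit_row 3 l).

Definition shifted_row (B : nat -> nat -> C) (i j : nat) : nat -> C :=
  fun l => B i l + (1 - B i j) * (unit_row j l + unit_row 1 l + unit_row 2 l).

(** [p1 j] and [p2 k] stand for the chosen branches of x_1^(1 - b_1j) and
    x_2^(1 - b_2k). *)
Definition Fjk (a : nat -> C) (B : nat -> nat -> C)
    (p1 p2 : nat -> C * C -> C) (j k : nat) (x : C * C) : C :=
  p1 j x * p2 k x
  * hypF (shifted_a a B j k) (rows (shifted_row B 1 j) (shifted_row B 2 k)) x.

(* Main.v *)
(* Upper bound. Read at lowest order, the two equations express the Euler derivatives
   theta_1^p theta_2^q f with p >= 3 or q >= 3 at a point x of D through those of the
   same order, with coefficients x_i times binomial coefficients. In the weighted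
   maximum norm with weights s^p t^q, where s^3 = |x_1| and t^3 = |x_2|, this is a
   contraction with factor (s + t)^3 < 1. So a solution whose nine derivatives with
   p, q <= 2 vanish at x vanishes there to infinite order, hence on all of U, and ten
   solutions are always linearly dependent.

   Solutions. In the coordinates w_i = log x_i the function F_jk is a double series of
   exponentials, which theta_i = d/dw_i multiplies termwise by the exponents; the
   equations become the recurrences of the Pochhammer symbols.

   Independence. In logarithmic coordinates the F_jk extend to the convex tube
   exp (Re w_1 / 3) + exp (Re w_2 / 3) < 1. A relation persists there, and under the
   translations w_i -> w_i + 2 pi i the functions are multiplied by exp (2 pi i (1 - b_ij)),
   which are distinct; a Vandermonde argument isolates each term, and no F_jk is zero.

   Solutions are only assumed complex differentiable; that their derivatives are again
   holomorphic follows from Goursat's theorem. *)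

Require Import Defs.
From Stdlib Require Import Reals ZArith Lra Lia Psatz ClassicalEpsilon FunctionalExtensionality.
From Coquelicot Require Import Coquelicot.

Open Scope C_scope.

(* Keeps the argument in [C_scope] inside formulas about real numbers. *)
Local Notation Cmod z := (Complex.Cmod z%C).

(** A solution comes with one complex derivative at each point and no continuity of it, while the
    system needs three derivatives and the upper bound all of them. Functions of two variables are
    therefore controlled through their restrictions to complex lines, where Cauchy's estimate in one
    variable applies, and a derivative is studied as a uniform limit of difference quotients.
    Solutions are never expanded in power series: that vanishing to infinite order forces zero
    follows by playing the growth n^n of Cauchy's bounds against the n! gained by integrating n
    times. Constants are not sharp, because real and imaginary parts are estimated separately.

    The set U is small and carries no monodromy. A relation is lifted to the logarithmic tube
    because the tube is invariant under the translations by 2 pi i and convex, so that the identity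
    theorem along segments replaces analytic continuation along loops. The powers in different F_jk
    may use different logarithms; after lifting this only multiplies the coefficients of the
    relation by nonzero constants. *)

(** * Elementary inequalities for the modulus *)

Lemma Cmod_le_components (z : C) : (Cmod z <= Rabs (fst z) + Rabs (snd z))%R.
Proof.
  destruct z as [x y]. simpl.
  assert (E : (x, y) = RtoC x + Ci * RtoC y).
  { apply injective_projections; simpl; ring. }
  rewrite E.
  eapply Rle_trans; [apply Cmod_triangle|].
  rewrite Cmod_mult, Cmod_Ci, !Cmod_R. simpl. lra.
Qed.

Lemma Rabs_fst_le (z : C) : (Rabs (fst z) <= Cmod z)%R.
Proof. eapply Rle_trans; [|apply Rmax_Cmod]. apply Rmax_l. Qed.

Lemma Rabs_snd_le (z : C) : (Rabs (snd z) <= Cmod z)%R.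
Proof. eapply Rle_trans; [|apply Rmax_Cmod]. apply Rmax_r. Qed.

Lemma Cmod_minus_sym (x y : C) : Cmod (x - y) = Cmod (y - x).
Proof. rewrite <- Cmod_opp. f_equal. ring. Qed.

Lemma Cmod_triangle_minus (x y : C) : (Cmod (x - y) <= Cmod x + Cmod y)%R.
Proof. unfold Cminus. rewrite <- (Cmod_opp y). apply Cmod_triangle. Qed.

Lemma Cmod_reverse (x y : C) : (Cmod x - Cmod y <= Cmod (x + y))%R.
Proof.
  replace x with ((x + y) - y) at 1 by ring.
  pose proof (Cmod_triangle_minus (x + y) y). lra.
Qed.

Lemma Cmod_zero_of_small (z : C) :
  (forall eps, (0 < eps)%R -> (Cmod z <= eps)%R) -> z = 0.
Proof.
  intros H. apply Cmod_eq_0. apply Rle_antisym; [|apply Cmod_ge_0].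
  apply le_epsilon. intros e he. rewrite Rplus_0_l. auto.
Qed.

(** * Bisection of rectangles *)

Section Bisection.

Variable P : R -> R -> R -> R -> Prop.

Let quad : Type := ((R * R) * (R * R))%type.
Let Pq (q : quad) : Prop := P (fst (fst q)) (snd (fst q)) (fst (snd q)) (snd (snd q)).

(** Moves to a quarter on which [P] fails. The last quarter is taken untested: if [P] fails on the
    whole and holds on the other three, the splitting hypothesis makes it fail there. *)
Local Definition bisect_step (q : quad) : quad :=
  let '((a, b), (c, d)) := q in
  let m := ((a + b) / 2)%R in
  let n := ((c + d) / 2)%R in
  if excluded_middle_informative (P a m c n) then
    if excluded_middle_informative (P m b c n) then
      if excluded_middle_informative (P a m n d) then ((m, b), (n, d))
      else ((a, m), (n, d))
    else ((m, b), (c, n))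
  else ((a, m), (c, n)).

Lemma nested_limit (a b : nat -> R) :
  (forall n, a n <= a (S n))%R -> (forall n, b (S n) <= b n)%R ->
  (forall n, a n <= b n)%R -> exists x, forall n, (a n <= x <= b n)%R.
Proof.
  intros ha hb hab.
  assert (ha' : forall n k, (a n <= a (n + k)%nat)%R).
  { intros n k; induction k; [rewrite Nat.add_0_r; lra|].
    rewrite Nat.add_succ_r. specialize (ha (n + k)%nat). lra. }
  assert (hb' : forall n k, (b (n + k)%nat <= b n)%R).
  { intros n k; induction k; [rewrite Nat.add_0_r; lra|].
    rewrite Nat.add_succ_r. specialize (hb (n + k)%nat). lra. }
  assert (hle : forall n m, (a n <= b m)%R).
  { intros n m. specialize (ha' n m). specialize (hb' m n).
    specialize (hab (n + m)%nat). rewrite (Nat.add_comm m n) in hb'. lra. }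
  destruct (completeness (fun x => exists n, x = a n)) as [x [h1 h2]].
  - exists (b 0%nat). intros y [n ->]. apply hle.
  - exists (a 0%nat), 0%nat. reflexivity.
  - exists x. intros n. split.
    + apply h1. exists n; reflexivity.
    + apply h2. intros y [m ->]. apply hle.
Qed.

(** Otherwise nested rectangles on which [P] fails shrink to a point, against the local hypothesis
    there. It serves Goursat's theorem and, with a degenerate second side, the propagation of zeros
    along a path. *)
Lemma bisection (a0 b0 c0 d0 : R) :
  (a0 <= b0)%R -> (c0 <= d0)%R ->
  (forall a b c d, (a0 <= a)%R -> (a <= b)%R -> (b <= b0)%R ->
     (c0 <= c)%R -> (c <= d)%R -> (d <= d0)%R ->
     P a ((a + b) / 2) c ((c + d) / 2) -> P ((a + b) / 2) b c ((c + d) / 2) ->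
     P a ((a + b) / 2) ((c + d) / 2) d -> P ((a + b) / 2) b ((c + d) / 2) d ->
     P a b c d) ->
  (forall x y, (a0 <= x <= b0)%R -> (c0 <= y <= d0)%R ->
     exists delta, (0 < delta)%R /\
       forall a b c d, (a0 <= a <= x)%R -> (x <= b <= b0)%R ->
         (c0 <= c <= y)%R -> (y <= d <= d0)%R ->
         (b - a < delta)%R -> (d - c < delta)%R -> P a b c d) ->
  P a0 b0 c0 d0.
Proof.
  intros hab hcd hsplit hloc. apply NNPP. intros hn.
  set (s := fun n => Nat.iter n bisect_step ((a0, b0), (c0, d0))).
  set (A := fun n => fst (fst (s n))). set (B := fun n => snd (fst (s n))).
  set (Cc := fun n => fst (snd (s n))). set (D := fun n => snd (snd (s n))).
  assert (inv : forall n,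
    (a0 <= A n /\ A n <= B n /\ B n <= b0 /\ c0 <= Cc n /\ Cc n <= D n /\ D n <= d0)%R /\
    ~ Pq (s n)).
  { induction n as [|n IH].
    - unfold A, B, Cc, D, s, Pq; simpl. split; [lra|exact hn].
    - unfold A, B, Cc, D in *. change (s (S n)) with (bisect_step (s n)).
      destruct (s n) as [[a b] [c d]]. unfold Pq in *; simpl in *.
      destruct IH as [IH1 IH2].
      destruct (excluded_middle_informative _) as [e1|e1]; [|simpl; split; [lra|exact e1]].
      destruct (excluded_middle_informative _) as [e2|e2]; [|simpl; split; [lra|exact e2]].
      destruct (excluded_middle_informative _) as [e3|e3]; [|simpl; split; [lra|exact e3]].
      simpl; split; [lra|]. intros e4. apply IH2. apply hsplit; try lra; assumption. }
  assert (mono : forall n,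
    (A n <= A (S n) /\ B (S n) <= B n /\ Cc n <= Cc (S n) /\ D (S n) <= D n /\
     B (S n) - A (S n) = (B n - A n) / 2 /\ D (S n) - Cc (S n) = (D n - Cc n) / 2)%R).
  { intros n. destruct (inv n) as [h _]. revert h. unfold A, B, Cc, D.
    change (s (S n)) with (bisect_step (s n)).
    destruct (s n) as [[a b] [c d]]; simpl; intros h.
    destruct (excluded_middle_informative _); [|simpl; lra].
    destruct (excluded_middle_informative _); [|simpl; lra].
    destruct (excluded_middle_informative _); simpl; lra. }
  destruct (nested_limit A B) as [x hx]; try (intros n; apply mono); [intros n; apply inv|].
  destruct (nested_limit Cc D) as [y hy]; try (intros n; apply mono); [intros n; apply inv|].
  assert (hwid : forall n, (B n - A n = (b0 - a0) * (/2)^n /\ D n - Cc n = (d0 - c0) * (/2)^n)%R).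
  { induction n as [|n [IH1 IH2]]; [unfold A, B, Cc, D; simpl; lra|].
    destruct (mono n) as (_ & _ & _ & _ & -> & ->). rewrite IH1, IH2. simpl. lra. }
  destruct (hloc x y) as (delta & hd & hP).
  { destruct (inv 0%nat); destruct (hx 0%nat). lra. }
  { destruct (inv 0%nat); destruct (hy 0%nat). lra. }
  destruct (pow_lt_1_zero (/2) ltac:(rewrite Rabs_pos_eq; lra)
    (delta / (1 + (b0 - a0) + (d0 - c0)))%R) as [n hn'].
  { apply Rdiv_lt_0_compat; lra. }
  specialize (hn' n (le_n _)).
  assert (hp : (0 < (/2)^n)%R) by (apply pow_lt; lra).
  rewrite Rabs_pos_eq in hn' by lra.
  apply Rlt_div_r in hn'; [|lra].
  destruct (inv n) as [h1 h2]. apply h2. specialize (hx n). specialize (hy n).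
  destruct (hwid n) as [w1 w2].
  apply hP; fold (A n); fold (B n); fold (Cc n); fold (D n); nra.
Qed.

End Bisection.

(** * Complex derivatives in one variable *)

(** Written in terms of the increment, without division, so that the estimates can use it directly;
    [cderiv_iff] links it to the derivative of the library. *)
Definition is_cderiv (g : C -> C) (z A : C) : Prop :=
  forall eps, (0 < eps)%R -> exists delta, (0 < delta)%R /\
    forall h, (Cmod h < delta)%R -> (Cmod (g (z + h) - g z - A * h) <= eps * Cmod h)%R.

Definition ctn (g : C -> C) (z : C) : Prop :=
  forall eps, (0 < eps)%R -> exists delta, (0 < delta)%R /\
    forall w, (Cmod (w - z) < delta)%R -> (Cmod (g w - g z) < eps)%R.

Definition ccont (f : R -> C) (t : R) : Prop :=
  forall eps, (0 < eps)%R -> exists delta, (0 < delta)%R /\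
    forall s, (Rabs (s - t) < delta)%R -> (Cmod (f s - f t) < eps)%R.

Lemma cderiv_lip (g : C -> C) (z A : C) : is_cderiv g z A ->
  exists delta, (0 < delta)%R /\ forall h, (Cmod h < delta)%R ->
    (Cmod (g (z + h)%C - g z) <= (Cmod A + 1) * Cmod h)%R.
Proof.
  intros H. destruct (H 1%R ltac:(lra)) as (d & hd & Hd). exists d; split; [exact hd|].
  intros h hh. specialize (Hd h hh).
  replace (g (z + h) - g z) with ((g (z + h) - g z - A * h) + A * h) by ring.
  eapply Rle_trans; [apply Cmod_triangle|]. rewrite Cmod_mult. lra.
Qed.

Lemma cderiv_ctn (g : C -> C) (z A : C) : is_cderiv g z A -> ctn g z.
Proof.
  intros H eps he. destruct (cderiv_lip g z A H) as (d & hd & Hd).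
  pose proof (Cmod_ge_0 A).
  exists (Rmin d (eps / (Cmod A + 1))). split.
  { apply Rmin_pos; [exact hd|]. apply Rdiv_lt_0_compat; lra. }
  intros w hw. specialize (Hd (w - z)).
  replace (z + (w - z)) with w in Hd by ring.
  eapply Rle_lt_trans; [apply Hd; eapply Rlt_le_trans; [exact hw|apply Rmin_l]|].
  assert (hw2 : (Cmod (w - z) < eps / (Cmod A + 1))%R)
    by (eapply Rlt_le_trans; [exact hw|apply Rmin_r]).
  apply Rlt_div_r in hw2; lra.
Qed.

Lemma Cplus_minus_r (z w : C) : z + (w - z) = w.
Proof. ring. Qed.

Lemma cderiv_iff (g : C -> C) (z A : C) :
  is_cderiv g z A <-> is_derive (K := C_AbsRing) (V := AbsRing_NormedModule C_AbsRing) g z A.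
Proof.
  split.
  - intros H. split; [apply is_linear_scal_l|].
    intros x hx. apply (is_filter_lim_locally_unique (V := AbsRing_NormedModule C_AbsRing)) in hx. subst x.
    intros eps. destruct (H eps (cond_pos eps)) as (d & hd & Hd).
    exists (mkposreal d hd). intros w hw.
    change (Cmod (w - z) < d)%R in hw. specialize (Hd (w - z) hw).
    rewrite Cplus_minus_r, (Cmult_comm A) in Hd. exact Hd.
  - intros [_ H] eps he. destruct (H z (fun P h => h) (mkposreal eps he)) as [d Hd].
    exists d. split; [apply cond_pos|]. intros h hh. specialize (Hd (z + h)).
    assert (E : z + h - z = h) by ring.
    change (Cmod (z + h - z) < d -> Cmod (g (z + h) - g z - (z + h - z) * A) <= eps * Cmod (z + h - z))%R in Hd.
    rewrite E, (Cmult_comm h) in Hd. apply Hd, hh.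
Qed.

Lemma cderiv_C_derive (g : C -> C) (z A : C) : is_cderiv g z A -> C_derive g z = A.
Proof.
  intros H. apply is_C_derive_unique. apply cderiv_iff in H. destruct H as [_ H].
  split; [apply is_linear_scal_l|exact H].
Qed.

Lemma cderiv_const (c z : C) : is_cderiv (fun _ => c) z 0.
Proof. apply cderiv_iff. exact (is_derive_const (K := C_AbsRing) (V := AbsRing_NormedModule C_AbsRing) c z). Qed.

Lemma cderiv_id (z : C) : is_cderiv (fun w => w) z 1.
Proof. apply cderiv_iff. exact (is_derive_id (K := C_AbsRing) z). Qed.

Lemma cderiv_eq (g : C -> C) (z A B : C) : is_cderiv g z A -> A = B -> is_cderiv g z B.
Proof. intros H <-. exact H. Qed.

Lemma cderiv_ext_loc (f g : C -> C) (z A : C) :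
  (exists r, (0 < r)%R /\ forall w, (Cmod (w - z) < r)%R -> f w = g w) ->
  is_cderiv f z A -> is_cderiv g z A.
Proof.
  intros (r & hr & E) H eps he. destruct (H eps he) as (d & hd & Hd).
  exists (Rmin d r). split; [apply Rmin_pos; assumption|]. intros h hh.
  rewrite <- !E.
  - apply Hd. eapply Rlt_le_trans; [exact hh|apply Rmin_l].
  - replace (z - z) with (RtoC 0) by ring. rewrite Cmod_0. exact hr.
  - replace (z + h - z) with h by ring. eapply Rlt_le_trans; [exact hh|apply Rmin_r].
Qed.

Lemma cderiv_plus (f g : C -> C) (z A B : C) :
  is_cderiv f z A -> is_cderiv g z B -> is_cderiv (fun w => f w + g w) z (A + B).
Proof.
  rewrite !cderiv_iff. exact (is_derive_plus (K := C_AbsRing) (V := AbsRing_NormedModule C_AbsRing) f g z A B).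
Qed.

Lemma cderiv_minus (f g : C -> C) (z A B : C) :
  is_cderiv f z A -> is_cderiv g z B -> is_cderiv (fun w => f w - g w) z (A - B).
Proof.
  rewrite !cderiv_iff. exact (is_derive_minus (K := C_AbsRing) (V := AbsRing_NormedModule C_AbsRing) f g z A B).
Qed.

Lemma cderiv_comp (f g : C -> C) (z A B : C) :
  is_cderiv g z A -> is_cderiv f (g z) B -> is_cderiv (fun w => f (g w)) z (B * A).
Proof.
  rewrite !cderiv_iff, Cmult_comm. intros hg hf.
  exact (is_derive_comp (K := C_AbsRing) (V := AbsRing_NormedModule C_AbsRing) f g z B A hf hg).
Qed.

Lemma cderiv_mult (f g : C -> C) (z A B : C) :
  is_cderiv f z A -> is_cderiv g z B -> is_cderiv (fun w => f w * g w) z (A * g z + f z * B).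
Proof.
  rewrite !cderiv_iff. intros hf hg.
  exact (is_derive_mult (K := C_AbsRing) f g z A B hf hg Cmult_comm).
Qed.

Lemma cderiv_scal (c : C) (f : C -> C) (z A : C) :
  is_cderiv f z A -> is_cderiv (fun w => c * f w) z (c * A).
Proof.
  intros hf. apply cderiv_eq with (0 * f z + c * A); [|ring].
  apply cderiv_mult; [apply cderiv_const|exact hf].
Qed.

(** * Derivatives along real segments *)

(** The mean value theorem fails for complex values, so it is applied to the two real components
    along a segment. *)
Lemma cderiv_line (g : C -> C) (z h A : C) (s : R) :
  is_cderiv g (z + RtoC s * h) A ->
  is_derive (fun t : R => fst (g (z + RtoC t * h))) s (fst (A * h)) /\
  is_derive (fun t : R => snd (g (z + RtoC t * h))) s (snd (A * h)).
Proof.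
  intros H.
  assert (K : forall eps, (0 < eps)%R -> exists d, (0 < d)%R /\ forall t : R, (Rabs (t - s) < d)%R ->
     (Cmod (g (z + RtoC t * h) - g (z + RtoC s * h) - RtoC (t - s) * (A * h)) <= eps * Rabs (t - s))%R).
  { intros eps he. pose proof (Cmod_ge_0 h) as hh.
    destruct (H (eps / (Cmod h + 1))%R ltac:(apply Rdiv_lt_0_compat; lra)) as (d & hd & Hd).
    exists (d / (Cmod h + 1))%R. split; [apply Rdiv_lt_0_compat; lra|].
    intros t ht. specialize (Hd (RtoC (t - s) * h)).
    rewrite Cmod_mult, Cmod_R in Hd.
    apply Rlt_div_r in ht; [|lra]. pose proof (Rabs_pos (t - s)).
    assert (X : (Rabs (t - s) * Cmod h < d)%R) by nra. specialize (Hd X).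
    replace (z + RtoC s * h + RtoC (t - s) * h) with (z + RtoC t * h) in Hd
      by (rewrite RtoC_minus; ring).
    replace (RtoC (t - s) * (A * h)) with (A * (RtoC (t - s) * h)) by ring.
    eapply Rle_trans; [exact Hd|].
    replace (eps / (Cmod h + 1) * (Rabs (t - s) * Cmod h))%R
      with ((Cmod h / (Cmod h + 1)) * (eps * Rabs (t - s)))%R by (field; lra).
    rewrite <- (Rmult_1_l (eps * Rabs (t - s))) at 2. apply Rmult_le_compat_r; [nra|].
    apply Rle_div_l; lra. }
  (* Here [p] is either component: real linear and bounded by the modulus. *)
  assert (L : forall (p : C -> R) , (forall x y, p (x - y) = (p x - p y)%R) ->
     (forall (r : R) x, p (RtoC r * x) = (r * p x)%R) -> (forall x, (Rabs (p x) <= Cmod x)%R) ->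
     is_derive (fun t : R => p (g (z + RtoC t * h))) s (p (A * h))).
  { intros p p1 p2 p3. split; [apply is_linear_scal_l|].
    intros x hx. apply (is_filter_lim_locally_unique (V := AbsRing_NormedModule R_AbsRing)) in hx. subst x.
    intros eps. destruct (K eps (cond_pos eps)) as (d & hd & Hd).
    exists (mkposreal d hd). intros t ht.
    change (Rabs (t - s) < d)%R in ht. specialize (Hd t ht).
    change (Rabs ((p (g (z + RtoC t * h)%C) - p (g (z + RtoC s * h)%C)) - (t - s) * p (A * h)%C) <= eps * Rabs (t - s))%R.
    rewrite <- p1, <- p2, <- p1. eapply Rle_trans; [apply p3|exact Hd]. }
  split; apply L.
  - intros [] []; reflexivity.
  - intros r []; simpl; ring.
  - apply Rabs_fst_le.
  - intros [] []; reflexivity.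
  - intros r []; simpl; ring.
  - apply Rabs_snd_le.
Qed.

(** The power [s ^ k] is kept for repeated use: the divisors [k + 1] accumulate to the factorial in
    [infinite_order_zero]. *)
Lemma increment_bound (r r' : R -> R) (A : R) (k : nat) :
  (forall s, (0 <= s <= 1)%R -> is_derive r s (r' s)) ->
  (forall s, (0 <= s <= 1)%R -> (Rabs (r' s) <= A * s ^ k)%R) ->
  (Rabs (r 1 - r 0) <= A / (INR k + 1))%R.
Proof.
  intros hr hb.
  assert (hk : (0 < INR k + 1)%R) by (pose proof (pos_INR k); lra).
  assert (X : forall sg : R, (Rabs sg = 1 -> sg * (r 1 - r 0) <= A / (INR k + 1))%R).
  { intros sg hsg.
    (* The derivative of this comparison function is nonpositive; the signs 1 and -1 give the two
       halves of the bound. *)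
    destruct (MVT_gen (fun s => sg * r s - A / (INR k + 1) * s ^ (S k))%R 0 1
      (fun s => sg * r' s - A * s ^ k)%R) as (c & hc & E).
    - intros s hs. rewrite Rmin_left, Rmax_right in hs by lra.
      auto_derive.
      + exists (r' s); apply hr; lra.
      + change (Derive (fun x : R => r x) s) with (Derive r s). rewrite (is_derive_unique _ _ _ (hr s ltac:(lra))).
        replace (match k with 0%nat => 1%R | S _ => (INR k + 1)%R end) with (INR k + 1)%R
          by (destruct k; simpl; lra).
        field; lra.
    - intros s hs. rewrite Rmin_left, Rmax_right in hs by lra.
      apply continuity_pt_filterlim. apply (ex_derive_continuous (fun s0 : R => (sg * r s0 - A / (INR k + 1) * s0 ^ S k)%R) s).
      auto_derive. exists (r' s); apply hr; lra.
    - rewrite Rmin_left, Rmax_right in hc by lra. specialize (hb c hc).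
      rewrite pow1, (pow_i (S k)) in E by lia.
      assert (Y : (sg * r' c <= Rabs (r' c))%R).
      { eapply Rle_trans; [apply Rle_abs|]. rewrite Rabs_mult, hsg. lra. }
      lra. }
  apply Rabs_le. split.
  - specialize (X (-1)%R). rewrite Rabs_left in X by lra. lra.
  - specialize (X 1%R). rewrite Rabs_pos_eq in X by lra. lra.
Qed.

(* The factor 2 comes from estimating the real and imaginary parts separately. *)
Lemma segment_bound (g g' : C -> C) (h : C) (A : R) (k : nat) :
  (forall s, (0 <= s <= 1)%R -> is_cderiv g (RtoC s * h) (g' (RtoC s * h))) ->
  (forall s, (0 <= s <= 1)%R -> (Cmod (g' (RtoC s * h)%C) <= A * s ^ k)%R) ->
  (Cmod (g h - g 0) <= 2 * A * Cmod h / (INR k + 1))%R.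
Proof.
  intros hg hb.
  assert (hd : forall s, (0 <= s <= 1)%R ->
    is_derive (fun t : R => fst (g (0 + RtoC t * h))) s (fst (g' (RtoC s * h) * h)) /\
    is_derive (fun t : R => snd (g (0 + RtoC t * h))) s (snd (g' (RtoC s * h) * h))).
  { intros s hs. apply cderiv_line. rewrite Cplus_0_l. apply hg; exact hs. }
  assert (hb' : forall s, (0 <= s <= 1)%R -> (Cmod (g' (RtoC s * h) * h) <= (A * Cmod h) * s ^ k)%R).
  { intros s hs. rewrite Cmod_mult. pose proof (Cmod_ge_0 h). specialize (hb s hs). nra. }
  pose proof (increment_bound _ _ (A * Cmod h) k (fun s hs => proj1 (hd s hs))
    (fun s hs => Rle_trans _ _ _ (Rabs_fst_le _) (hb' s hs))) as X1.
  pose proof (increment_bound _ _ (A * Cmod h) k (fun s hs => proj2 (hd s hs))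
    (fun s hs => Rle_trans _ _ _ (Rabs_snd_le _) (hb' s hs))) as X2.
  cbv beta in X1, X2.
  replace (0 + 1 * h) with h in X1, X2 by ring.
  replace (0 + 0 * h) with (RtoC 0) in X1, X2 by ring.
  eapply Rle_trans; [apply Cmod_le_components|].
  replace (fst (g h - g 0)) with (fst (g h) - fst (g 0))%R by reflexivity.
  replace (snd (g h - g 0)) with (snd (g h) - snd (g 0))%R by reflexivity.
  unfold Rdiv in *. lra.
Qed.

(** * The complex exponential *)

Lemma Cexp_plus (z w : C) : Cexp (z + w) = Cexp z * Cexp w.
Proof.
  destruct z as [x y], w as [u v]. unfold Cexp; simpl.
  rewrite exp_plus, cos_plus, sin_plus.
  apply injective_projections; simpl; ring.
Qed.

Lemma Cexp_0 : Cexp 0 = 1.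
Proof. unfold Cexp; simpl. rewrite exp_0, cos_0, sin_0. apply injective_projections; simpl; ring. Qed.

Lemma Cmod_Cexp (z : C) : Cmod (Cexp z) = exp (fst z).
Proof.
  destruct z as [x y]. unfold Cexp, Complex.Cmod; simpl.
  replace (exp x * cos y * (exp x * cos y * 1) + exp x * sin y * (exp x * sin y * 1))%R
    with (exp x * exp x * (Rsqr (sin y) + Rsqr (cos y)))%R by (unfold Rsqr; ring).
  rewrite sin2_cos2, Rmult_1_r. apply sqrt_square, Rlt_le, exp_pos.
Qed.

Lemma Cexp_neq_0 (z : C) : Cexp z <> 0.
Proof. apply Cmod_gt_0. rewrite Cmod_Cexp. apply exp_pos. Qed.

Lemma Cexp_opp (z : C) : Cexp (- z) = / Cexp z.
Proof.
  assert (H : Cexp z * Cexp (- z) = 1).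
  { rewrite <- Cexp_plus, <- Cexp_0. f_equal. ring. }
  pose proof (Cexp_neq_0 z).
  replace (Cexp (- z)) with (/ Cexp z * (Cexp z * Cexp (- z))) by (field; auto).
  rewrite H. ring.
Qed.

Lemma Cexp_nat (n : nat) (z : C) : Cexp (INR n * z) = Cexp z ^ n.
Proof.
  induction n as [|n IH].
  - simpl. rewrite Cmult_0_l. apply Cexp_0.
  - rewrite S_INR, RtoC_plus. replace ((INR n + 1) * z) with (z + INR n * z) by ring.
    rewrite Cexp_plus, IH. reflexivity.
Qed.

Lemma exp_fst_le (u : C) (s : R) : (0 <= s <= 1)%R -> (exp (s * fst u) <= exp (Cmod u))%R.
Proof.
  intros hs. pose proof (Rabs_fst_le u). pose proof (Rle_abs (fst u)). pose proof (Cmod_ge_0 u).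
  assert (H2 : (s * fst u <= Cmod u)%R) by nra.
  destruct H2 as [H2|H2]; [apply Rlt_le, exp_increasing, H2|rewrite H2; lra].
Qed.

Lemma Cexp_line (u : C) (s : R) :
  is_derive (fun t : R => fst (Cexp (RtoC t * u))) s (fst (u * Cexp (RtoC s * u))) /\
  is_derive (fun t : R => snd (Cexp (RtoC t * u))) s (snd (u * Cexp (RtoC s * u))).
Proof.
  destruct u as [x y]. unfold Cexp; simpl. split; auto_derive; trivial. all: unfold Rminus; ring.
Qed.

Lemma Cexp_minus_1 (u : C) : (Cmod (Cexp u - 1) <= 2 * Cmod u * exp (Cmod u))%R.
Proof.
  assert (hb : forall s, (0 <= s <= 1)%R ->
    (Cmod (u * Cexp (RtoC s * u)) <= Cmod u * exp (Cmod u) * s ^ 0)%R).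
  { intros s hs. rewrite Cmod_mult, Cmod_Cexp. simpl (_ ^ 0)%R. rewrite Rmult_1_r.
    apply Rmult_le_compat_l; [apply Cmod_ge_0|].
    replace (fst (RtoC s * u)) with (s * fst u)%R by (destruct u; simpl; ring).
    apply exp_fst_le; exact hs. }
  pose proof (increment_bound _ _ _ 0 (fun s hs => proj1 (Cexp_line u s))
    (fun s hs => Rle_trans _ _ _ (Rabs_fst_le _) (hb s hs))) as X1.
  pose proof (increment_bound _ _ _ 0 (fun s hs => proj2 (Cexp_line u s))
    (fun s hs => Rle_trans _ _ _ (Rabs_snd_le _) (hb s hs))) as X2.
  cbv beta in X1, X2. rewrite Cmult_0_l, Cmult_1_l, Cexp_0 in X1, X2.
  eapply Rle_trans; [apply Cmod_le_components|].
  replace (fst (Cexp u - 1)) with (fst (Cexp u) - fst (RtoC 1))%R by reflexivity.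
  replace (snd (Cexp u - 1)) with (snd (Cexp u) - snd (RtoC 1))%R by reflexivity.
  replace (INR 0 + 1)%R with 1%R in X1, X2 by (simpl; ring). lra.
Qed.

(** The derivative of [Cexp (t * u) - t * u] in [t] is [u * (Cexp (t * u) - 1)], which
    [Cexp_minus_1] bounds by a multiple of [t]. *)
Lemma Cexp_taylor2 (u : C) : (Cmod (Cexp u - 1 - u) <= 2 * (Cmod u * Cmod u) * exp (Cmod u))%R.
Proof.
  assert (hb : forall s, (0 <= s <= 1)%R ->
    (Cmod (u * (Cexp (RtoC s * u) - 1)) <= 2 * (Cmod u * Cmod u) * exp (Cmod u) * s ^ 1)%R).
  { intros s hs. rewrite Cmod_mult, pow_1.
    apply Rle_trans with (Cmod u * (2 * (s * Cmod u) * exp (Cmod u)))%R; [|right; ring].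
    apply Rmult_le_compat_l; [apply Cmod_ge_0|].
    eapply Rle_trans; [apply Cexp_minus_1|]. rewrite Cmod_mult, Cmod_R, Rabs_pos_eq by lra.
    pose proof (Cmod_ge_0 u).
    apply Rmult_le_compat_l; [nra|].
    assert (H2 : (s * Cmod u <= Cmod u)%R) by nra.
    destruct H2 as [H2|H2]; [apply Rlt_le, exp_increasing, H2|rewrite H2; lra]. }
  assert (hd : forall s : R,
    is_derive (fun t : R => fst (Cexp (RtoC t * u) - RtoC t * u)) s (fst (u * (Cexp (RtoC s * u) - 1))) /\
    is_derive (fun t : R => snd (Cexp (RtoC t * u) - RtoC t * u)) s (snd (u * (Cexp (RtoC s * u) - 1)))).
  { intros s. destruct u as [x y]. unfold Cexp; simpl. split; auto_derive; trivial; unfold Rminus; ring. }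
  pose proof (increment_bound _ _ _ 1 (fun s hs => proj1 (hd s))
    (fun s hs => Rle_trans _ _ _ (Rabs_fst_le _) (hb s hs))) as X1.
  pose proof (increment_bound _ _ _ 1 (fun s hs => proj2 (hd s))
    (fun s hs => Rle_trans _ _ _ (Rabs_snd_le _) (hb s hs))) as X2.
  cbv beta in X1, X2. rewrite Cmult_0_l, Cmult_1_l, Cexp_0 in X1, X2.
  eapply Rle_trans; [apply Cmod_le_components|].
  replace (Cexp u - 1 - u) with (Cexp u - u - (1 - 0)) by ring.
  replace (fst (Cexp u - u - (1 - 0))) with (fst (Cexp u - u)%C - fst (1 - 0)%C)%R by reflexivity.
  replace (snd (Cexp u - u - (1 - 0))) with (snd (Cexp u - u)%C - snd (1 - 0)%C)%R by reflexivity.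
  replace (INR 1 + 1)%R with 2%R in X1, X2 by (simpl; ring). lra.
Qed.

Lemma cderiv_Cexp (z : C) : is_cderiv Cexp z (Cexp z).
Proof.
  intros eps he. pose proof (exp_pos (fst z)) as hz. pose proof (exp_pos 1) as h1.
  exists (Rmin 1 (eps / (2 * exp (fst z) * exp 1))). split.
  { apply Rmin_pos; [lra|]. apply Rdiv_lt_0_compat; [lra|]. apply Rmult_lt_0_compat; lra. }
  intros h hh. pose proof (Rlt_le_trans _ _ _ hh (Rmin_l _ _)) as hh1.
  pose proof (Rlt_le_trans _ _ _ hh (Rmin_r _ _)) as hh2.
  apply Rlt_div_r in hh2; [|apply Rmult_lt_0_compat; lra].
  replace (Cexp (z + h) - Cexp z - Cexp z * h) with (Cexp z * (Cexp h - 1 - h))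
    by (rewrite Cexp_plus; ring).
  rewrite Cmod_mult, Cmod_Cexp. pose proof (Cexp_taylor2 h) as X.
  pose proof (Cmod_ge_0 h) as h0.
  assert (Y : (exp (Cmod h) <= exp 1)%R) by (apply Rlt_le, exp_increasing, hh1).
  apply Rle_trans with (exp (fst z) * (2 * (Cmod h * Cmod h) * exp 1))%R.
  { apply Rmult_le_compat_l; [lra|]. eapply Rle_trans; [exact X|].
    apply Rmult_le_compat_l; [nra|exact Y]. }
  replace (exp (fst z) * (2 * (Cmod h * Cmod h) * exp 1))%R
    with ((Cmod h * (2 * exp (fst z) * exp 1)) * Cmod h)%R by ring.
  apply Rmult_le_compat_r; lra.
Qed.

(** * Integrals of complex-valued functions of a real variable *)

Definition CI (f : R -> C) (a b : R) : C :=
  (RInt (fun t => fst (f t)) a b, RInt (fun t => snd (f t)) a b).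

Definition ccont_on (f : R -> C) (a b : R) : Prop :=
  forall t, (a <= t <= b)%R -> ccont f t.

Lemma ccont_comp (g : C -> C) (f : R -> C) (t : R) :
  ccont f t -> ctn g (f t) -> ccont (fun s => g (f s)) t.
Proof.
  intros hf hg eps he. destruct (hg eps he) as (d & hd & Hd).
  destruct (hf d hd) as (d' & hd' & Hd'). exists d'; split; [exact hd'|].
  intros s hs. apply Hd, Hd', hs.
Qed.

Lemma ccont_minus (f g : R -> C) (t : R) :
  ccont f t -> ccont g t -> ccont (fun s => f s - g s) t.
Proof.
  intros hf hg eps he.
  destruct (hf (eps / 2)%R ltac:(lra)) as (d1 & hd1 & H1).
  destruct (hg (eps / 2)%R ltac:(lra)) as (d2 & hd2 & H2).
  exists (Rmin d1 d2). split; [apply Rmin_pos; assumption|]. intros s hs.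
  specialize (H1 s (Rlt_le_trans _ _ _ hs (Rmin_l _ _))).
  specialize (H2 s (Rlt_le_trans _ _ _ hs (Rmin_r _ _))).
  replace (f s - g s - (f t - g t)) with ((f s - f t) - (g s - g t)) by ring.
  eapply Rle_lt_trans; [apply Cmod_triangle_minus|]. lra.
Qed.

Lemma ccont_const (c : C) (t : R) : ccont (fun _ => c) t.
Proof.
  intros eps he. exists 1%R; split; [lra|]. intros s _.
  replace (c - c) with (RtoC 0) by ring. rewrite Cmod_0. exact he.
Qed.

Lemma ccont_horizontal (c t : R) : ccont (fun u => (u, c)) t.
Proof.
  intros eps he. exists eps; split; [exact he|]. intros s hs.
  replace ((s, c) - (t, c)) with (RtoC (s - t)); [rewrite Cmod_R; exact hs|].
  apply injective_projections; simpl; ring.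
Qed.

Lemma ccont_vertical (a t : R) : ccont (fun v => (a, v)) t.
Proof.
  intros eps he. exists eps; split; [exact he|]. intros s hs.
  replace ((a, s) - (a, t)) with (Ci * RtoC (s - t)).
  { rewrite Cmod_mult, Cmod_Ci, Cmod_R, Rmult_1_l; exact hs. }
  apply injective_projections; simpl; ring.
Qed.

Lemma ccont_components (f : R -> C) (t : R) : ccont f t ->
  continuous (fun s => fst (f s)) t /\ continuous (fun s => snd (f s)) t.
Proof.
  intros hf. split; apply filterlim_locally; intros eps;
    destruct (hf eps (cond_pos eps)) as (d & hd & Hd); exists (mkposreal d hd);
    intros s hs; specialize (Hd s hs).
  - change (Rabs (fst (f s - f t)%C) < eps)%R. eapply Rle_lt_trans; [apply Rabs_fst_le|exact Hd].
  - change (Rabs (snd (f s - f t)%C) < eps)%R. eapply Rle_lt_trans; [apply Rabs_snd_le|exact Hd].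
Qed.

Lemma ccont_on_ex_RInt (f : R -> C) (a b : R) : (a <= b)%R -> ccont_on f a b ->
  ex_RInt (fun t => fst (f t)) a b /\ ex_RInt (fun t => snd (f t)) a b.
Proof.
  intros hab hf. split; apply (ex_RInt_continuous (V := R_CompleteNormedModule)); intros t ht;
    rewrite Rmin_left, Rmax_right in ht by exact hab; apply (ccont_components f t (hf t ht)).
Qed.

Lemma CI_Chasles (f : R -> C) (a b c : R) : (a <= b)%R -> (b <= c)%R -> ccont_on f a c ->
  CI f a c = CI f a b + CI f b c.
Proof.
  intros hab hbc hf.
  destruct (ccont_on_ex_RInt f a b hab) as [h1 h2]; [intros t ht; apply hf; lra|].
  destruct (ccont_on_ex_RInt f b c hbc) as [h3 h4]; [intros t ht; apply hf; lra|].
  unfold CI. apply injective_projections; simpl; symmetry.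
  - apply (RInt_Chasles (V := R_CompleteNormedModule)); assumption.
  - apply (RInt_Chasles (V := R_CompleteNormedModule)); assumption.
Qed.

Lemma CI_ext (f g : R -> C) (a b : R) : (a <= b)%R ->
  (forall t, (a <= t <= b)%R -> f t = g t) -> CI f a b = CI g a b.
Proof.
  intros hab H. unfold CI. apply injective_projections; simpl; apply RInt_ext; intros t ht;
    rewrite Rmin_left, Rmax_right in ht by exact hab; rewrite H by lra; reflexivity.
Qed.

Lemma CI_minus (f g : R -> C) (a b : R) : (a <= b)%R -> ccont_on f a b -> ccont_on g a b ->
  CI (fun t => f t - g t) a b = CI f a b - CI g a b.
Proof.
  intros hab hf hg.
  destruct (ccont_on_ex_RInt f a b hab hf) as [h1 h2].
  destruct (ccont_on_ex_RInt g a b hab hg) as [h3 h4].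
  unfold CI. apply injective_projections; simpl.
  - exact (RInt_minus (V := R_CompleteNormedModule) _ _ a b h1 h3).
  - exact (RInt_minus (V := R_CompleteNormedModule) _ _ a b h2 h4).
Qed.

Lemma CI_const (c : C) (a b : R) : CI (fun _ => c) a b = RtoC (b - a) * c.
Proof.
  unfold CI. rewrite !RInt_const. destruct c.
  apply injective_projections; simpl; unfold scal; simpl; unfold mult; simpl; ring.
Qed.

Lemma CI_bound (f : R -> C) (a b M : R) : (a <= b)%R -> ccont_on f a b ->
  (forall t, (a <= t <= b)%R -> (Cmod (f t) <= M)%R) -> (Cmod (CI f a b) <= 2 * (b - a) * M)%R.
Proof.
  intros hab hf hM. destruct (ccont_on_ex_RInt f a b hab hf) as [h1 h2].
  eapply Rle_trans; [apply Cmod_le_components|]. unfold CI; simpl.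
  pose proof (abs_RInt_le_const _ a b M hab h1
    (fun t ht => Rle_trans _ _ _ (Rabs_fst_le _) (hM t ht))).
  pose proof (abs_RInt_le_const _ a b M hab h2
    (fun t ht => Rle_trans _ _ _ (Rabs_snd_le _) (hM t ht))). lra.
Qed.

(** * Goursat's theorem for rectangles *)

(* The contour integral of [g] over the boundary of [a,b] x [c,d], with opposite
   sides combined, so that integrands cancel for affine [g]. *)
Definition rect_int (g : C -> C) (a b c d : R) : C :=
  CI (fun u => g (u, c) - g (u, d)) a b + Ci * CI (fun v => g (b, v) - g (a, v)) c d.

Section Goursat.

Variables (g g' : C -> C) (a0 b0 c0 d0 : R).
Hypothesis hg : forall x y, (a0 <= x <= b0)%R -> (c0 <= y <= d0)%R -> is_cderiv g (x, y) (g' (x, y)).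

Lemma ccont_hor (a b c : R) : (a0 <= a)%R -> (b <= b0)%R -> (c0 <= c <= d0)%R ->
  ccont_on (fun u => g (u, c)) a b.
Proof.
  intros ha hb hc t ht. apply ccont_comp with (f := fun u => (u, c)).
  - apply ccont_horizontal.
  - eapply cderiv_ctn, hg; lra.
Qed.

Lemma ccont_ver (a c d : R) : (a0 <= a <= b0)%R -> (c0 <= c)%R -> (d <= d0)%R ->
  ccont_on (fun v => g (a, v)) c d.
Proof.
  intros ha hc hd t ht. apply ccont_comp with (f := fun v => (a, v)).
  - apply ccont_vertical.
  - eapply cderiv_ctn, hg; lra.
Qed.

Lemma ccont_on_minus (f1 f2 : R -> C) (a b : R) :
  ccont_on f1 a b -> ccont_on f2 a b -> ccont_on (fun t => f1 t - f2 t) a b.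
Proof. intros h1 h2 t ht. apply ccont_minus; auto. Qed.

Lemma rect_int_split_h (a m b c d : R) :
  (a0 <= a)%R -> (a <= m)%R -> (m <= b)%R -> (b <= b0)%R -> (c0 <= c)%R -> (c <= d)%R -> (d <= d0)%R ->
  rect_int g a b c d = rect_int g a m c d + rect_int g m b c d.
Proof.
  intros. unfold rect_int.
  rewrite (CI_Chasles _ a m b); try assumption.
  2: { apply ccont_on_minus; apply ccont_hor; lra. }
  rewrite !(CI_minus (fun v => g (_, v))) by (try apply ccont_ver; lra). ring.
Qed.

Lemma rect_int_split_v (a b c n d : R) :
  (a0 <= a)%R -> (a <= b)%R -> (b <= b0)%R -> (c0 <= c)%R -> (c <= n)%R -> (n <= d)%R -> (d <= d0)%R ->
  rect_int g a b c d = rect_int g a b c n + rect_int g a b n d.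
Proof.
  intros. unfold rect_int.
  rewrite (CI_Chasles _ c n d); try assumption.
  2: { apply ccont_on_minus; apply ccont_ver; lra. }
  rewrite !(CI_minus (fun u => g (u, _))) by (try apply ccont_hor; lra). ring.
Qed.

Lemma Cmod_pair_le (x y : R) : (Cmod (x, y) <= Rabs x + Rabs y)%R.
Proof. apply (Cmod_le_components (x, y)). Qed.

Lemma rect_int_local (x y a b c d eps delta : R) (A : C) :
  (a0 <= a <= x)%R -> (x <= b <= b0)%R -> (c0 <= c <= y)%R -> (y <= d <= d0)%R ->
  (0 < eps)%R -> (b - a + (d - c) < delta)%R ->
  (forall h, (Cmod h < delta)%R -> (Cmod (g ((x, y) + h) - g (x, y) - A * h) <= eps * Cmod h)%R) ->
  (Cmod (rect_int g a b c d) <= 4 * eps * ((b - a + (d - c)) * (b - a + (d - c))))%R.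
Proof.
  intros ha hb hc hd he hs H. set (sg := (b - a + (d - c))%R) in *.
  assert (E : forall u v, (a <= u <= b)%R -> (c <= v <= d)%R ->
    (Cmod (g (u, v) - g (x, y) - A * ((u, v) - (x, y))) <= eps * sg)%R).
  { intros u v hu hv.
    assert (hh : (Cmod ((u, v) - (x, y)) <= sg)%R).
    { replace ((u, v) - (x, y)) with ((u - x)%R, (v - y)%R) by reflexivity.
      eapply Rle_trans; [apply Cmod_pair_le|]. unfold sg.
      apply Rplus_le_compat; apply Rabs_le; lra. }
    specialize (H ((u, v) - (x, y)) ltac:(lra)).
    replace ((x, y) + ((u, v) - (x, y))) with ((u, v) : C) in H
      by (apply injective_projections; simpl; ring).
    eapply Rle_trans; [exact H|]. apply Rmult_le_compat_l; lra. }
  (* These are the differences between opposite sides for the affine function of slope [A]. Their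
     contributions [(b - a) * k1] and [Ci * (d - c) * k2] cancel, so only the remainder of order
     [eps] is integrated. *)
  set (k1 := A * (Ci * RtoC (c - d))). set (k2 := A * RtoC (b - a)).
  assert (Hf : (Cmod (CI (fun u => g (u, c) - g (u, d) - k1) a b) <= 2 * (b - a) * (2 * eps * sg))%R).
  { apply CI_bound; [lra| |].
    - apply ccont_on_minus; [apply ccont_on_minus; apply ccont_hor; lra|].
      intros t _; apply ccont_const.
    - intros t ht.
      replace (g (t, c) - g (t, d) - k1) with
        ((g (t, c) - g (x, y) - A * ((t, c) - (x, y))) - (g (t, d) - g (x, y) - A * ((t, d) - (x, y)))).
      2: { unfold k1. replace (Ci * RtoC (c - d)) with ((t, c) - (t, d)); [ring|].
           apply injective_projections; simpl; ring. }
      eapply Rle_trans; [apply Cmod_triangle_minus|].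
      pose proof (E t c ht ltac:(lra)). pose proof (E t d ht ltac:(lra)). lra. }
  assert (Hg : (Cmod (CI (fun v => g (b, v) - g (a, v) - k2) c d) <= 2 * (d - c) * (2 * eps * sg))%R).
  { apply CI_bound; [lra| |].
    - apply ccont_on_minus; [apply ccont_on_minus; apply ccont_ver; lra|].
      intros t _; apply ccont_const.
    - intros t ht.
      replace (g (b, t) - g (a, t) - k2) with
        ((g (b, t) - g (x, y) - A * ((b, t) - (x, y))) - (g (a, t) - g (x, y) - A * ((a, t) - (x, y)))).
      2: { unfold k2. replace (RtoC (b - a)) with ((b, t) - (a, t)); [ring|].
           apply injective_projections; simpl; ring. }
      eapply Rle_trans; [apply Cmod_triangle_minus|].
      pose proof (E b t ltac:(lra) ht). pose proof (E a t ltac:(lra) ht). lra. }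
  rewrite CI_minus in Hf; [|lra| |intros t _; apply ccont_const].
  2: { apply ccont_on_minus; apply ccont_hor; lra. }
  rewrite CI_minus in Hg; [|lra| |intros t _; apply ccont_const].
  2: { apply ccont_on_minus; apply ccont_ver; lra. }
  rewrite CI_const in Hf, Hg. unfold rect_int.
  replace (CI (fun u => g (u, c) - g (u, d)) a b + Ci * CI (fun v => g (b, v) - g (a, v)) c d)
    with ((CI (fun u => g (u, c) - g (u, d)) a b - RtoC (b - a) * k1)
      + Ci * (CI (fun v => g (b, v) - g (a, v)) c d - RtoC (d - c) * k2)).
  2: { unfold k1, k2. rewrite !RtoC_minus. ring. }
  eapply Rle_trans; [apply Cmod_triangle|]. rewrite Cmod_mult, Cmod_Ci, Rmult_1_l.
  eapply Rle_trans; [apply Rplus_le_compat; [exact Hf|exact Hg]|].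
  right. unfold sg; ring.
Qed.

(** The bound is quadratic in the half perimeter, so the bounds for the four quarters add up exactly
    to the bound for the whole. Bisection thus carries it from small rectangles, where
    differentiability gives it, to the given one. *)
Lemma goursat : (a0 <= b0)%R -> (c0 <= d0)%R -> rect_int g a0 b0 c0 d0 = 0.
Proof.
  intros hab hcd.
  set (sg := ((b0 - a0 + (d0 - c0)) * (b0 - a0 + (d0 - c0)))%R).
  assert (H : forall eps, (0 < eps)%R -> (Cmod (rect_int g a0 b0 c0 d0) <= 4 * eps * sg)%R).
  { intros eps he.
    apply (bisection (fun a b c d =>
      (Cmod (rect_int g a b c d) <= 4 * eps * ((b - a + (d - c)) * (b - a + (d - c))))%R)).
    - exact hab.
    - exact hcd.
    - intros a b c d ha h1 hb hc h2 hd q1 q2 q3 q4.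
      rewrite (rect_int_split_h a ((a + b) / 2) b c d) by lra.
      rewrite (rect_int_split_v a ((a + b) / 2) c ((c + d) / 2) d) by lra.
      rewrite (rect_int_split_v ((a + b) / 2) b c ((c + d) / 2) d) by lra.
      eapply Rle_trans; [apply Cmod_triangle|].
      eapply Rle_trans; [apply Rplus_le_compat; apply Cmod_triangle|].
      eapply Rle_trans; [apply Rplus_le_compat; apply Rplus_le_compat; [exact q1|exact q3|exact q2|exact q4]|].
      right. field.
    - intros x y hx hy. destruct (hg x y hx hy eps he) as (d & hd & Hd).
      (* Both sides below [d / 2] put the whole rectangle within distance [d] of the point. *)
      exists (d / 2)%R. split; [lra|]. intros. apply (rect_int_local x y _ _ _ _ eps d (g' (x, y))); try lra.
      exact Hd. }
  assert (hsg : (0 <= sg)%R) by (unfold sg; nra).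
  apply Cmod_zero_of_small. intros e he.
  specialize (H (e / (4 * (sg + 1)))%R ltac:(apply Rdiv_lt_0_compat; lra)).
  eapply Rle_trans; [exact H|].
  replace (4 * (e / (4 * (sg + 1))) * sg)%R with (sg / (sg + 1) * e)%R by (field; lra).
  rewrite <- (Rmult_1_l e) at 2. apply Rmult_le_compat_r; [lra|]. apply Rle_div_l; lra.
Qed.

End Goursat.

(** * Cauchy's estimate for the derivative *)

(* Goursat's theorem in logarithmic coordinates [z = z0 + exp zeta]: the integral of
   [(phi z - phi z0) / (z - z0)] over circles around [z0] does not depend on the
   radius, and it tends to [2 pi phi' z0] as the radius tends to 0. *)
Lemma cauchy_estimate (phi phi' : C -> C) (z0 : C) (R0 M : R) :
  (0 < R0)%R ->
  (forall z, (Cmod (z - z0) < R0)%R -> is_cderiv phi z (phi' z)) ->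
  (forall z, (Cmod (z - z0) < R0)%R -> (Cmod (phi z) <= M)%R) ->
  (Cmod (phi' z0) <= 8 * M / R0)%R.
Proof.
  intros hR hphi hM.
  set (g := fun w => (phi (z0 + Cexp w) - phi z0) * Cexp (- w)).
  set (g' := fun w => phi' (z0 + Cexp w) * Cexp w * Cexp (- w)
                      + (phi (z0 + Cexp w) - phi z0) * (- Cexp (- w))).
  assert (hin : forall w, (fst w < ln R0)%R -> (Cmod (z0 + Cexp w - z0) < R0)%R).
  { intros w hw. replace (z0 + Cexp w - z0) with (Cexp w) by ring. rewrite Cmod_Cexp.
    rewrite <- (exp_ln R0) by exact hR. apply exp_increasing, hw. }
  assert (hg : forall w, (fst w < ln R0)%R -> is_cderiv g w (g' w)).
  { intros w hw. unfold g, g'.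
    apply (cderiv_mult (fun w => phi (z0 + Cexp w) - phi z0) (fun w => Cexp (- w))).
    - apply cderiv_eq with (phi' (z0 + Cexp w) * Cexp w - 0); [|ring].
      apply cderiv_minus; [|apply cderiv_const].
      apply (cderiv_comp phi (fun w => z0 + Cexp w)).
      + apply cderiv_eq with (0 + Cexp w); [|ring]. apply cderiv_plus; [apply cderiv_const|apply cderiv_Cexp].
      + apply hphi, hin, hw.
    - apply cderiv_eq with (Cexp (- w) * (- (1))); [|ring]. apply (cderiv_comp Cexp (fun w => - w)).
      + apply cderiv_ext_loc with (fun w => (- (1)) * w).
        { exists 1%R; split; [lra|]; intros; ring. }
        apply cderiv_eq with (- (1) * 1); [|ring]. apply cderiv_scal, cderiv_id.
      + apply cderiv_Cexp. }
  set (I := fun u => CI (fun v => g (u, v)) 0 (2 * PI)).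
  pose proof PI_RGT_0 as hpi.
  assert (hper : forall u, Cexp (u, (2 * PI)%R) = Cexp (u, 0%R)).
  { intros u. unfold Cexp; simpl. rewrite cos_2PI, sin_2PI, cos_0, sin_0. reflexivity. }
  assert (hgper : forall u, g (u, 0%R) - g (u, (2 * PI)%R) = 0).
  { intros u. unfold g. rewrite !Cexp_opp, hper. ring. }
  assert (hcc : forall u, (u < ln R0)%R -> ccont_on (fun v => g (u, v)) 0 (2 * PI)).
  { intros u hu t ht. apply ccont_comp with (f := fun v => (u, v)); [apply ccont_vertical|].
    eapply cderiv_ctn, hg; exact hu. }
  (* By periodicity the horizontal sides cancel in Goursat's theorem, which leaves the equality of
     the two vertical integrals. *)
  assert (hI : forall u v, (u <= v)%R -> (v < ln R0)%R -> I u = I v).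
  { intros u v huv hv.
    assert (X : rect_int g u v 0 (2 * PI) = 0).
    { apply goursat with g'; try lra. intros x y hx hy. apply hg; simpl; lra. }
    unfold rect_int in X.
    rewrite (CI_ext _ (fun _ => RtoC 0) u v) in X; [|exact huv|intros; apply hgper].
    rewrite CI_const, CI_minus in X; try lra; try (apply hcc; lra). fold (I u) (I v) in X.
    assert (Y : Ci * (I v - I u) = 0) by (rewrite <- X; ring).
    assert (Z : I v - I u = 0).
    { replace (I v - I u) with (- Ci * (Ci * (I v - I u))).
      - rewrite Y; ring.
      - replace (- Ci * (Ci * (I v - I u))) with (- (Ci * Ci) * (I v - I u)) by ring.
        replace (Ci * Ci) with (- (1)); [ring|]. apply injective_projections; simpl; ring. }
    rewrite <- (Cplus_0_r (I u)), <- Z. ring. }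
  (* The circle of radius [R0 / 2]. The constant 8 has one factor 2 from this radius, one from
     [Cmod (phi z - phi z0) <= 2 * M] and one from [CI_bound]. *)
  set (u0 := (ln (R0 / 2))%R).
  assert (hu0 : (u0 < ln R0)%R) by (apply ln_increasing; lra).
  assert (hM0 : (0 <= M)%R).
  { eapply Rle_trans; [apply Cmod_ge_0|]. apply (hM z0).
    replace (z0 - z0) with (RtoC 0) by ring. rewrite Cmod_0. exact hR. }
  assert (B1 : (Cmod (I u0) <= 2 * (2 * PI) * (4 * M / R0))%R).
  { replace (2 * (2 * PI))%R with (2 * (2 * PI - 0))%R by ring. apply CI_bound; [lra|apply hcc, hu0|].
    intros t ht. unfold g. rewrite Cmod_mult, Cexp_opp, Cmod_inv, Cmod_Cexp by apply Cexp_neq_0.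
    simpl fst. unfold u0. rewrite exp_ln by lra.
    replace (4 * M / R0)%R with ((2 * M) * / (R0 / 2))%R by (field; lra).
    apply Rmult_le_compat_r; [apply Rlt_le, Rinv_0_lt_compat; lra|].
    eapply Rle_trans; [apply Cmod_triangle_minus|].
    pose proof (hM (z0 + Cexp (u0, t)) (hin (u0, t) hu0)). pose proof (hM z0) as Hz.
    replace (z0 - z0) with (RtoC 0) in Hz by ring. rewrite Cmod_0 in Hz. specialize (Hz hR).
    fold u0. lra. }
  assert (B2 : forall eps, (0 < eps)%R ->
     (Cmod (I u0 - RtoC (2 * PI) * phi' z0) <= 2 * (2 * PI) * eps)%R).
  { intros eps he.
    assert (Hz : is_cderiv phi z0 (phi' z0)).
    { apply hphi. replace (z0 - z0) with (RtoC 0) by ring. rewrite Cmod_0. exact hR. }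
    destruct (Hz eps he) as (d & hd & Hd).
    (* A circle of radius at most [d / 2], so that the difference quotient on it is within [eps] of
       [phi' z0]. *)
    set (u := Rmin u0 (ln (d / 2))). assert (hu : (u < ln R0)%R).
    { eapply Rle_lt_trans; [apply Rmin_l|exact hu0]. }
    rewrite <- (hI u u0) by (try apply Rmin_l; exact hu0).
    replace (RtoC (2 * PI) * phi' z0) with (CI (fun _ => phi' z0) 0 (2 * PI))
      by (rewrite CI_const, Rminus_0_r; reflexivity).
    unfold I. rewrite <- CI_minus; [|lra|apply hcc, hu|intros t _; apply ccont_const].
    replace (2 * (2 * PI))%R with (2 * (2 * PI - 0))%R by ring. apply CI_bound; [lra| |].
    { intros t ht. apply ccont_minus; [apply hcc; assumption|apply ccont_const]. }
    intros t ht. unfold g. specialize (Hd (Cexp (u, t))). rewrite Cmod_Cexp in Hd. simpl fst in Hd.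
    pose proof (Cexp_neq_0 (u, t)) as hne. pose proof (exp_pos u) as hep.
    replace ((phi (z0 + Cexp (u, t)) - phi z0) * Cexp (- (u, t)) - phi' z0)
      with ((phi (z0 + Cexp (u, t)) - phi z0 - phi' z0 * Cexp (u, t)) * / Cexp (u, t))
      by (rewrite Cexp_opp; field; exact hne).
    rewrite Cmod_mult, Cmod_inv, Cmod_Cexp by exact hne. simpl fst.
    apply (Rmult_le_reg_r (exp u)); [exact hep|]. rewrite Rmult_assoc, Rinv_l, Rmult_1_r by lra.
    apply Hd. apply Rle_lt_trans with (exp (ln (d / 2))).
    - destruct (Rmin_r u0 (ln (d / 2))) as [X|X]; fold u in X.
      + apply Rlt_le, exp_increasing, X.
      + rewrite X; lra.
    - rewrite exp_ln; lra. }
  assert (B3 : (2 * PI * Cmod (phi' z0) <= 2 * (2 * PI) * (4 * M / R0))%R).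
  { apply le_epsilon. intros e he.
    specialize (B2 (e / (2 * (2 * PI)))%R ltac:(apply Rdiv_lt_0_compat; lra)).
    replace (2 * (2 * PI) * (e / (2 * (2 * PI))))%R with e in B2 by (field; lra).
    replace (2 * PI * Cmod (phi' z0))%R with (Cmod (I u0 - (I u0 - RtoC (2 * PI) * phi' z0))).
    - eapply Rle_trans; [apply Cmod_triangle_minus|]. lra.
    - replace (I u0 - (I u0 - RtoC (2 * PI) * phi' z0)) with (RtoC (2 * PI) * phi' z0) by ring.
      rewrite Cmod_mult, Cmod_R, Rabs_pos_eq by lra. reflexivity. }
  replace (2 * (2 * PI) * (4 * M / R0))%R with (2 * PI * (8 * M / R0))%R in B3 by (field; lra).
  apply Rmult_le_reg_l in B3; lra.
Qed.

Lemma cderiv_translate (g : C -> C) (c z A : C) :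
  is_cderiv g (c + z) A -> is_cderiv (fun w => g (c + w)) z A.
Proof.
  intros H. apply cderiv_eq with (A * (0 + 1)); [|ring].
  apply (cderiv_comp g (fun w => c + w)); [|exact H].
  apply cderiv_plus; [apply cderiv_const|apply cderiv_id].
Qed.

Lemma disc_convex (z0 w h : C) (r : R) (s : R) : (0 <= s <= 1)%R ->
  (Cmod (w - z0) < r)%R -> (Cmod (w + h - z0) < r)%R -> (Cmod (w + RtoC s * h - z0) < r)%R.
Proof.
  intros hs h1 h2.
  replace (w + RtoC s * h - z0) with (RtoC (1 - s) * (w - z0) + RtoC s * (w + h - z0))
    by (rewrite RtoC_minus; ring).
  eapply Rle_lt_trans; [apply Cmod_triangle|].
  rewrite !Cmod_mult, !Cmod_R, !Rabs_pos_eq by lra.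
  destruct (Req_dec s 0) as [->|hs0]; [lra|]. nra.
Qed.

(** Each point of the segment has a disc of radius [r / 2] to spare, so Cauchy's estimate bounds the
    derivative by [16 * M / r]; [segment_bound] doubles this. *)
Lemma holomorphic_lipschitz (phi phi' : C -> C) (z0 w h : C) (r M : R) :
  (0 < r)%R ->
  (forall z, (Cmod (z - z0) < r)%R -> is_cderiv phi z (phi' z)) ->
  (forall z, (Cmod (z - z0) < r)%R -> (Cmod (phi z) <= M)%R) ->
  (Cmod (w - z0) < r / 2)%R -> (Cmod (w + h - z0) < r / 2)%R ->
  (Cmod (phi (w + h) - phi w) <= 32 * M / r * Cmod h)%R.
Proof.
  intros hr hphi hM hw hwh.
  pose proof (segment_bound (fun t => phi (w + t)) (fun t => phi' (w + t)) h (16 * M / r) 0) as X.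
  cbv beta in X. rewrite Cplus_0_r in X.
  replace (32 * M / r * Cmod h)%R with (2 * (16 * M / r) * Cmod h / (INR 0 + 1))%R
    by (simpl; field; lra).
  assert (hin : forall s, (0 <= s <= 1)%R -> (Cmod (w + RtoC s * h - z0) < r / 2)%R)
    by (intros; apply disc_convex; assumption).
  apply X.
  - intros s hs. apply cderiv_translate, hphi. specialize (hin s hs). lra.
  - intros s hs. rewrite pow_O, Rmult_1_r. specialize (hin s hs).
    replace (16 * M / r)%R with (8 * M / (r / 2))%R by (field; lra).
    assert (hsub : forall z, (Cmod (z - (w + RtoC s * h)) < r / 2)%R -> (Cmod (z - z0) < r)%R).
    { intros z hz. replace (z - z0) with ((z - (w + RtoC s * h)) + (w + RtoC s * h - z0)) by ring.
      eapply Rle_lt_trans; [apply Cmod_triangle|]. lra. }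
    apply (cauchy_estimate phi phi'); [lra| |].
    + intros z hz. apply hphi, hsub, hz.
    + intros z hz. apply hM, hsub, hz.
Qed.

(** Cauchy's estimate is applied to the difference of [phi] and its translate by [k]. The Lipschitz
    bound makes this difference of order [k], hence also the difference of derivatives, and one
    integration gives the square. *)
Lemma holomorphic_taylor2 (phi phi' : C -> C) (z0 h : C) (r M : R) :
  (0 < r)%R ->
  (forall z, (Cmod (z - z0) < r)%R -> is_cderiv phi z (phi' z)) ->
  (forall z, (Cmod (z - z0) < r)%R -> (Cmod (phi z) <= M)%R) ->
  (Cmod h < r / 4)%R ->
  (Cmod (phi (z0 + h) - phi z0 - phi' z0 * h) <= 1024 * M * (Cmod h / r) ^ 2)%R.
Proof.
  intros hr hphi hM hh. pose proof (Cmod_ge_0 h) as h0.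
  pose proof (segment_bound (fun t => phi (z0 + t) - phi' z0 * t) (fun t => phi' (z0 + t) - phi' z0)
    h (1024 * M * Cmod h / (r * r)) 1) as X.
  cbv beta in X. rewrite Cplus_0_r in X.
  replace (phi (z0 + h) - phi' z0 * h - (phi z0 - phi' z0 * 0))
    with (phi (z0 + h) - phi z0 - phi' z0 * h) in X by ring.
  replace (1024 * M * (Cmod h / r) ^ 2)%R
    with (2 * (1024 * M * Cmod h / (r * r)) * Cmod h / (INR 1 + 1))%R by (simpl; field; lra).
  assert (hsh : forall s, (0 <= s <= 1)%R -> (Cmod (RtoC s * h) = s * Cmod h)%R).
  { intros s hs. rewrite Cmod_mult, Cmod_R, Rabs_pos_eq by lra. reflexivity. }
  apply X.
  - intros s hs.
    assert (hz : (Cmod (z0 + RtoC s * h - z0) < r)%R).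
    { replace (z0 + RtoC s * h - z0) with (RtoC s * h) by ring. rewrite hsh by exact hs. nra. }
    apply cderiv_minus; [apply cderiv_translate, hphi, hz|].
    apply cderiv_eq with (phi' z0 * 1); [|ring]. apply cderiv_scal, cderiv_id.
  - intros s hs. specialize (hsh s hs). rewrite pow_1.
    set (k := RtoC s * h) in *.
    assert (hk : (Cmod k < r / 4)%R) by nra.
    replace (1024 * M * Cmod h / (r * r) * s)%R
      with (8 * (32 * M / r * Cmod k) / (r / 4))%R by (rewrite hsh; field; lra).
    assert (hsub : forall z, (Cmod (z - z0) < r / 4)%R -> (Cmod (z + k - z0) < r / 2)%R).
    { intros z hz. replace (z + k - z0) with ((z - z0) + k) by ring.
      eapply Rle_lt_trans; [apply Cmod_triangle|]. lra. }
    rewrite (Cplus_comm z0).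
    apply (cauchy_estimate (fun z => phi (k + z) - phi z) (fun z => phi' (k + z) - phi' z));
      [lra| |].
    + intros z hz. specialize (hsub z hz). apply cderiv_minus; [apply cderiv_translate|]; apply hphi; [|lra].
      rewrite (Cplus_comm k). lra.
    + intros z hz. rewrite (Cplus_comm k). apply (holomorphic_lipschitz phi phi' z0); auto; lra.
Qed.

(** * Complex differentiability in two variables *)

Definition shift2 (w : C * C) (h1 h2 : C) : C * C := (fst w + h1, snd w + h2).

Definition is_cdiff (f : C * C -> C) (w : C * C) (A B : C) : Prop :=
  forall eps, (0 < eps)%R -> exists delta, (0 < delta)%R /\
    forall h1 h2, (Cmod h1 < delta)%R -> (Cmod h2 < delta)%R ->
      (Cmod (f (shift2 w h1 h2) - f w - A * h1 - B * h2) <= eps * (Cmod h1 + Cmod h2))%R.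

Definition ball2 (p : C * C) (r : R) (w : C * C) : Prop :=
  (Cmod (fst w - fst p) < r)%R /\ (Cmod (snd w - snd p) < r)%R.

Definition open2 (V : C * C -> Prop) : Prop :=
  forall p, V p -> exists r, (0 < r)%R /\ forall w, ball2 p r w -> V w.

Definition hol (V : C * C -> Prop) (f : C * C -> C) : Prop :=
  forall w, V w -> exists A B, is_cdiff f w A B.

Lemma ball2_center (p : C * C) (r : R) : (0 < r)%R -> ball2 p r p.
Proof.
  intros hr. split.
  - replace (fst p - fst p) with (RtoC 0) by ring. rewrite Cmod_0; exact hr.
  - replace (snd p - snd p) with (RtoC 0) by ring. rewrite Cmod_0; exact hr.
Qed.

Lemma ball2_trans (p q w : C * C) (r s t : R) :
  ball2 p r q -> ball2 q s w -> (r + s <= t)%R -> ball2 p t w.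
Proof.
  intros [h1 h2] [h3 h4] h. split.
  - replace (fst w - fst p) with ((fst w - fst q) + (fst q - fst p)) by ring.
    eapply Rle_lt_trans; [apply Cmod_triangle|lra].
  - replace (snd w - snd p) with ((snd w - snd q) + (snd q - snd p)) by ring.
    eapply Rle_lt_trans; [apply Cmod_triangle|lra].
Qed.

Lemma ball2_sym (p q : C * C) (r : R) : ball2 p r q -> ball2 q r p.
Proof. intros [h1 h2]. split; rewrite Cmod_minus_sym; assumption. Qed.

Lemma ball2_le (p w : C * C) (r s : R) : (r <= s)%R -> ball2 p r w -> ball2 p s w.
Proof. intros h [h1 h2]. split; lra. Qed.

Lemma ball2_open (p : C * C) (r : R) : open2 (ball2 p r).
Proof.
  intros q [h1 h2].
  exists (Rmin (r - Cmod (fst q - fst p)) (r - Cmod (snd q - snd p))).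
  split; [apply Rmin_pos; lra|]. intros w [h3 h4].
  pose proof (Rlt_le_trans _ _ _ h3 (Rmin_l _ _)). pose proof (Rlt_le_trans _ _ _ h4 (Rmin_r _ _)).
  split.
  - replace (fst w - fst p) with ((fst w - fst q) + (fst q - fst p)) by ring.
    eapply Rle_lt_trans; [apply Cmod_triangle|lra].
  - replace (snd w - snd p) with ((snd w - snd q) + (snd q - snd p)) by ring.
    eapply Rle_lt_trans; [apply Cmod_triangle|lra].
Qed.

Lemma shift2_ball (p : C * C) (h1 h2 : C) (r : R) :
  (Cmod h1 < r)%R -> (Cmod h2 < r)%R -> ball2 p r (shift2 p h1 h2).
Proof.
  intros a b. split; simpl.
  - replace (fst p + h1 - fst p) with h1 by ring. exact a.
  - replace (snd p + h2 - snd p) with h2 by ring. exact b.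
Qed.

Lemma shift2_diff (p w : C * C) : shift2 p (fst w - fst p) (snd w - snd p) = w.
Proof. unfold shift2. destruct w; simpl. f_equal; ring. Qed.

Lemma shift2_0 (p : C * C) : shift2 p 0 0 = p.
Proof. unfold shift2. destruct p; simpl. f_equal; ring. Qed.

Lemma cdiff_ext (f g : C * C -> C) (w : C * C) (A B : C) (r : R) : (0 < r)%R ->
  (forall z, ball2 w r z -> f z = g z) -> is_cdiff f w A B -> is_cdiff g w A B.
Proof.
  intros hr E H eps he. destruct (H eps he) as (d & hd & Hd).
  exists (Rmin d r). split; [apply Rmin_pos; assumption|]. intros h1 h2 k1 k2.
  rewrite <- !E.
  - apply Hd; eapply Rlt_le_trans; try eassumption; apply Rmin_l.
  - apply ball2_center, hr.
  - apply shift2_ball; eapply Rlt_le_trans; try eassumption; apply Rmin_r.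
Qed.

Lemma cdiff_ext_on (V : C * C -> Prop) (f g : C * C -> C) (w : C * C) (A B : C) :
  open2 V -> V w -> (forall z, V z -> f z = g z) -> is_cdiff f w A B -> is_cdiff g w A B.
Proof.
  intros hV hw E. destruct (hV w hw) as (r & hr & H).
  apply cdiff_ext with r; auto.
Qed.

Lemma cdiff_eq (f : C * C -> C) (w : C * C) (A B A' B' : C) :
  is_cdiff f w A B -> A = A' -> B = B' -> is_cdiff f w A' B'.
Proof. intros H <- <-. exact H. Qed.

Lemma cdiff_lip (f : C * C -> C) (w : C * C) (A B : C) : is_cdiff f w A B ->
  exists delta, (0 < delta)%R /\ forall h1 h2, (Cmod h1 < delta)%R -> (Cmod h2 < delta)%R ->
    (Cmod (f (shift2 w h1 h2) - f w) <= (Cmod A + Cmod B + 1) * (Cmod h1 + Cmod h2))%R.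
Proof.
  intros H. destruct (H 1%R ltac:(lra)) as (d & hd & Hd). exists d; split; [exact hd|].
  intros h1 h2 k1 k2. specialize (Hd h1 h2 k1 k2).
  replace (f (shift2 w h1 h2) - f w)
    with ((f (shift2 w h1 h2) - f w - A * h1 - B * h2) + (A * h1 + B * h2)) by ring.
  eapply Rle_trans; [apply Cmod_triangle|].
  eapply Rle_trans; [apply Rplus_le_compat_l, Cmod_triangle|]. rewrite !Cmod_mult.
  pose proof (Cmod_ge_0 A). pose proof (Cmod_ge_0 B). pose proof (Cmod_ge_0 h1). pose proof (Cmod_ge_0 h2).
  nra.
Qed.

Lemma cdiff_cont (f : C * C -> C) (w : C * C) (A B : C) : is_cdiff f w A B ->
  forall eps, (0 < eps)%R -> exists delta, (0 < delta)%R /\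
    forall z, ball2 w delta z -> (Cmod (f z - f w) < eps)%R.
Proof.
  intros H eps he. destruct (cdiff_lip f w A B H) as (d & hd & Hd).
  set (K := (Cmod A + Cmod B + 1)%R) in *.
  assert (hK : (0 < K)%R).
  { pose proof (Cmod_ge_0 A). pose proof (Cmod_ge_0 B). unfold K; lra. }
  exists (Rmin d (eps / (2 * K))). split.
  { apply Rmin_pos; [exact hd|]. apply Rdiv_lt_0_compat; lra. }
  intros z [h1 h2].
  specialize (Hd _ _ (Rlt_le_trans _ _ _ h1 (Rmin_l _ _)) (Rlt_le_trans _ _ _ h2 (Rmin_l _ _))).
  rewrite shift2_diff in Hd.
  pose proof (Rlt_le_trans _ _ _ h1 (Rmin_r _ _)) as h3.
  pose proof (Rlt_le_trans _ _ _ h2 (Rmin_r _ _)) as h4.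
  apply Rlt_div_r in h3; [|lra]. apply Rlt_div_r in h4; [|lra]. lra.
Qed.

Lemma cdiff_const (c : C) (w : C * C) : is_cdiff (fun _ => c) w 0 0.
Proof.
  intros eps he. exists 1%R. split; [lra|]. intros h1 h2 _ _.
  replace (c - c - 0 * h1 - 0 * h2) with (RtoC 0) by ring. rewrite Cmod_0.
  pose proof (Cmod_ge_0 h1). pose proof (Cmod_ge_0 h2). nra.
Qed.

Lemma cdiff_fst (w : C * C) : is_cdiff fst w 1 0.
Proof.
  intros eps he. exists 1%R. split; [lra|]. intros h1 h2 _ _. simpl.
  replace (fst w + h1 - fst w - 1 * h1 - 0 * h2) with (RtoC 0) by ring. rewrite Cmod_0.
  pose proof (Cmod_ge_0 h1). pose proof (Cmod_ge_0 h2). nra.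
Qed.

Lemma cdiff_snd (w : C * C) : is_cdiff snd w 0 1.
Proof.
  intros eps he. exists 1%R. split; [lra|]. intros h1 h2 _ _. simpl.
  replace (snd w + h2 - snd w - 0 * h1 - 1 * h2) with (RtoC 0) by ring. rewrite Cmod_0.
  pose proof (Cmod_ge_0 h1). pose proof (Cmod_ge_0 h2). nra.
Qed.

Lemma cdiff_prod (w : C * C) : is_cdiff (fun z => fst z * snd z) w (snd w) (fst w).
Proof.
  intros eps he. exists eps. split; [lra|]. intros h1 h2 k1 k2. simpl.
  replace ((fst w + h1) * (snd w + h2) - fst w * snd w - snd w * h1 - fst w * h2)
    with (h1 * h2) by ring. rewrite Cmod_mult.
  pose proof (Cmod_ge_0 h1). pose proof (Cmod_ge_0 h2). nra.
Qed.

Lemma cdiff_lincomb (c d : C) (w : C * C) : is_cdiff (fun z => c * fst z + d * snd z) w c d.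
Proof.
  intros eps he. exists 1%R. split; [lra|]. intros h1 h2 _ _. simpl.
  replace (c * (fst w + h1) + d * (snd w + h2) - (c * fst w + d * snd w) - c * h1 - d * h2)
    with (RtoC 0) by ring. rewrite Cmod_0.
  pose proof (Cmod_ge_0 h1). pose proof (Cmod_ge_0 h2). nra.
Qed.

(** The sum, product and translation rules and the restriction to lines are all derived from this
    chain rule. *)
Lemma cdiff_comp (f u v : C * C -> C) (w : C * C) (A B a1 a2 b1 b2 : C) :
  is_cdiff f (u w, v w) A B -> is_cdiff u w a1 a2 -> is_cdiff v w b1 b2 ->
  is_cdiff (fun z => f (u z, v z)) w (A * a1 + B * b1) (A * a2 + B * b2).
Proof.
  intros Hf Hu Hv eps he.
  destruct (cdiff_lip u w a1 a2 Hu) as (d1 & hd1 & H1).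
  destruct (cdiff_lip v w b1 b2 Hv) as (d2 & hd2 & H2).
  pose proof (Cmod_ge_0 A) as hA. pose proof (Cmod_ge_0 B) as hB.
  set (K1 := (Cmod a1 + Cmod a2 + 1)%R) in *. set (K2 := (Cmod b1 + Cmod b2 + 1)%R) in *.
  assert (hK1 : (0 < K1)%R).
  { pose proof (Cmod_ge_0 a1). pose proof (Cmod_ge_0 a2). unfold K1; lra. }
  assert (hK2 : (0 < K2)%R).
  { pose proof (Cmod_ge_0 b1). pose proof (Cmod_ge_0 b2). unfold K2; lra. }
  (* [Q] collects what multiplies [e * N] in the end: [K1 + K2] from the remainder of [f], and the
     moduli of [A] and [B] from the remainders of [u] and [v]. The 1 keeps it positive. *)
  set (Q := (1 + (K1 + K2) + Cmod A + Cmod B)%R). assert (hQ : (0 < Q)%R) by (unfold Q; lra).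
  set (e := (eps / Q)%R). assert (hee : (0 < e)%R) by (apply Rdiv_lt_0_compat; lra).
  destruct (Hf e hee) as (d3 & hd3 & H3).
  destruct (Hu e hee) as (d4 & hd4 & H4).
  destruct (Hv e hee) as (d5 & hd5 & H5).
  set (d6 := (d3 / (2 * (K1 + K2)))%R).
  assert (hd6 : (0 < d6)%R) by (apply Rdiv_lt_0_compat; lra).
  exists (Rmin (Rmin (Rmin d1 d2) (Rmin d4 d5)) d6). split; [repeat apply Rmin_pos; assumption|].
  intros h1 h2 k1 k2.
  assert (mm : forall x, (x < Rmin (Rmin (Rmin d1 d2) (Rmin d4 d5)) d6)%R ->
    (x < d1 /\ x < d2 /\ x < d4 /\ x < d5 /\ x < d6)%R).
  { intros x hx. pose proof (Rmin_l (Rmin (Rmin d1 d2) (Rmin d4 d5)) d6).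
    pose proof (Rmin_r (Rmin (Rmin d1 d2) (Rmin d4 d5)) d6).
    pose proof (Rmin_l (Rmin d1 d2) (Rmin d4 d5)). pose proof (Rmin_r (Rmin d1 d2) (Rmin d4 d5)).
    pose proof (Rmin_l d1 d2). pose proof (Rmin_r d1 d2). pose proof (Rmin_l d4 d5). pose proof (Rmin_r d4 d5).
    lra. }
  destruct (mm _ k1) as (m1 & m2 & m4 & m5 & m6). destruct (mm _ k2) as (n1 & n2 & n4 & n5 & n6).
  specialize (H1 h1 h2 m1 n1). specialize (H2 h1 h2 m2 n2).
  specialize (H4 h1 h2 m4 n4). specialize (H5 h1 h2 m5 n5).
  set (N := (Cmod h1 + Cmod h2)%R) in *.
  assert (hN : (N * (K1 + K2) < d3)%R).
  { apply Rlt_div_r; [lra|]. unfold N. replace (d3 / (K1 + K2))%R with (2 * d6)%R by (unfold d6; field; lra). lra. }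
  assert (hN0 : (0 <= N)%R) by (unfold N; pose proof (Cmod_ge_0 h1); pose proof (Cmod_ge_0 h2); lra).
  set (p := u (shift2 w h1 h2) - u w) in *. set (q := v (shift2 w h1 h2) - v w) in *.
  specialize (H3 p q ltac:(nra) ltac:(nra)).
  assert (Es : shift2 (u w, v w) p q = (u (shift2 w h1 h2), v (shift2 w h1 h2))).
  { unfold shift2 at 1; simpl. unfold p, q. f_equal; ring. }
  rewrite Es in H3.
  replace (f (u (shift2 w h1 h2), v (shift2 w h1 h2)) - f (u w, v w)
     - (A * a1 + B * b1) * h1 - (A * a2 + B * b2) * h2)
    with ((f (u (shift2 w h1 h2), v (shift2 w h1 h2)) - f (u w, v w) - A * p - B * q)
      + (A * (p - a1 * h1 - a2 * h2) + B * (q - b1 * h1 - b2 * h2))) by ring.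
  eapply Rle_trans; [apply Cmod_triangle|].
  eapply Rle_trans; [apply Rplus_le_compat_l, Cmod_triangle|]. rewrite !Cmod_mult.
  apply Rle_trans with (e * ((K1 + K2) * N) + (Cmod A * (e * N) + Cmod B * (e * N)))%R.
  { apply Rplus_le_compat.
    - eapply Rle_trans; [exact H3|]. apply Rmult_le_compat_l; lra.
    - apply Rplus_le_compat; apply Rmult_le_compat_l; assumption. }
  replace eps with (e * Q)%R by (unfold e; field; lra). unfold Q.
  assert (0 <= e * N)%R by (apply Rmult_le_pos; lra). lra.
Qed.

Lemma cdiff_plus (f g : C * C -> C) (w : C * C) (A B A' B' : C) :
  is_cdiff f w A B -> is_cdiff g w A' B' -> is_cdiff (fun z => f z + g z) w (A + A') (B + B').
Proof.
  intros Hf Hg. eapply cdiff_eq.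
  - apply cdiff_ext with (f := fun z => (fun x => 1 * fst x + 1 * snd x) (f z, g z)) (r := 1%R); [lra| |].
    + intros z _; simpl; ring.
    + apply (cdiff_comp (fun x => 1 * fst x + 1 * snd x)); [apply cdiff_lincomb|exact Hf|exact Hg].
  - ring.
  - ring.
Qed.

Lemma cdiff_minus (f g : C * C -> C) (w : C * C) (A B A' B' : C) :
  is_cdiff f w A B -> is_cdiff g w A' B' -> is_cdiff (fun z => f z - g z) w (A - A') (B - B').
Proof.
  intros Hf Hg. eapply cdiff_eq.
  - apply cdiff_ext with (f := fun z => (fun x => 1 * fst x + (- (1)) * snd x) (f z, g z)) (r := 1%R); [lra| |].
    + intros z _; simpl; ring.
    + apply (cdiff_comp (fun x => 1 * fst x + (- (1)) * snd x)); [apply cdiff_lincomb|exact Hf|exact Hg].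
  - ring.
  - ring.
Qed.

Lemma cdiff_mult (f g : C * C -> C) (w : C * C) (A B A' B' : C) :
  is_cdiff f w A B -> is_cdiff g w A' B' -> is_cdiff (fun z => f z * g z) w (A * g w + f w * A') (B * g w + f w * B').
Proof.
  intros Hf Hg. eapply cdiff_eq.
  - apply (cdiff_comp (fun x => fst x * snd x)); [apply cdiff_prod|exact Hf|exact Hg].
  - simpl; ring.
  - simpl; ring.
Qed.

Lemma cdiff_scal (c : C) (f : C * C -> C) (w : C * C) (A B : C) :
  is_cdiff f w A B -> is_cdiff (fun z => c * f z) w (c * A) (c * B).
Proof.
  intros Hf. eapply cdiff_eq; [apply (cdiff_mult (fun _ => c)); [apply cdiff_const|exact Hf]| |]; ring.
Qed.

Lemma cdiff_cderiv_comp (g : C -> C) (f : C * C -> C) (w : C * C) (A B D : C) :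
  is_cderiv g (f w) D -> is_cdiff f w A B -> is_cdiff (fun z => g (f z)) w (D * A) (D * B).
Proof.
  intros Hg Hf. eapply cdiff_eq.
  - apply (cdiff_comp (fun x => g (fst x)) f (fun _ => RtoC 0)) with (A := D) (B := RtoC 0);
      [|exact Hf|apply cdiff_const].
    intros eps he. destruct (Hg eps he) as (d & hd & Hd). exists d; split; [exact hd|].
    intros h1 h2 k1 _. simpl. specialize (Hd h1 k1).
    replace (g (f w + h1) - g (f w) - D * h1 - 0 * h2) with (g (f w + h1) - g (f w) - D * h1) by ring.
    pose proof (Cmod_ge_0 h2). nra.
  - ring.
  - ring.
Qed.

Lemma cdiff_translate (f : C * C -> C) (c1 c2 : C) (w : C * C) (A B : C) :
  is_cdiff f (shift2 w c1 c2) A B -> is_cdiff (fun z => f (shift2 z c1 c2)) w A B.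
Proof.
  intros H. eapply cdiff_eq.
  - apply (cdiff_comp f (fun z => fst z + c1) (fun z => snd z + c2)); [exact H| |].
    + apply cdiff_plus; [apply cdiff_fst|apply cdiff_const].
    + apply cdiff_plus; [apply cdiff_snd|apply cdiff_const].
  - ring.
  - ring.
Qed.

Lemma cdiff_line (f : C * C -> C) (p : C * C) (h1 h2 t A B : C) :
  is_cdiff f (shift2 p (t * h1) (t * h2)) A B ->
  is_cderiv (fun s => f (shift2 p (s * h1) (s * h2))) t (A * h1 + B * h2).
Proof.
  intros H.
  assert (X : is_cdiff (fun z => f (fst p + fst z * h1, snd p + fst z * h2)) (t, RtoC 0) (A * h1 + B * h2) 0).
  { eapply cdiff_eq.
    - apply (cdiff_comp f (fun z => fst p + fst z * h1) (fun z => snd p + fst z * h2)); [exact H| |];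
        (apply cdiff_plus; [apply cdiff_const|apply cdiff_mult; [apply cdiff_fst|apply cdiff_const]]).
    - simpl; ring.
    - simpl; ring. }
  intros eps he. destruct (X eps he) as (d & hd & Hd). exists d. split; [exact hd|].
  intros h hh. specialize (Hd h 0 hh). rewrite Cmod_0 in Hd. specialize (Hd hd).
  unfold shift2 in *; simpl in Hd. rewrite Rplus_0_r in Hd.
  replace (f (fst p + (t + h) * h1, snd p + (t + h) * h2) - f (fst p + t * h1, snd p + t * h2) -
    (A * h1 + B * h2) * h - 0 * 0)
   with (f (fst p + (t + h) * h1, snd p + (t + h) * h2) - f (fst p + t * h1, snd p + t * h2) -
    (A * h1 + B * h2) * h) in Hd by ring. exact Hd.
Qed.

(** Identifies the values of the total function [pderiv]; with it the existential in [hol] can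
    always be instantiated by [pderiv]. *)
Lemma cdiff_pderiv (f : C * C -> C) (w : C * C) (A B : C) : is_cdiff f w A B ->
  pderiv 1 f w = A /\ pderiv 2 f w = B.
Proof.
  intros H. split; simpl; apply cderiv_C_derive.
  - assert (X : is_cderiv (fun s => f (shift2 (RtoC 0, snd w) (s * 1) (s * 0))) (fst w) (A * 1 + B * 0)).
    { apply cdiff_line. unfold shift2; simpl. destruct w as [w1 w2]; simpl.
      replace (0 + w1 * 1, w2 + w1 * 0) with (w1, w2) by (f_equal; ring). exact H. }
    replace A with (A * 1 + B * 0) by ring.
    eapply cderiv_ext_loc; [|exact X]. exists 1%R; split; [lra|]. intros z _.
    unfold shift2; simpl. f_equal; f_equal; ring.
  - assert (X : is_cderiv (fun s => f (shift2 (fst w, RtoC 0) (s * 0) (s * 1))) (snd w) (A * 0 + B * 1)).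
    { apply cdiff_line. unfold shift2; simpl. destruct w as [w1 w2]; simpl.
      replace (w1 + w2 * 0, 0 + w2 * 1) with (w1, w2) by (f_equal; ring). exact H. }
    replace B with (A * 0 + B * 1) by ring.
    eapply cderiv_ext_loc; [|exact X]. exists 1%R; split; [lra|]. intros z _.
    unfold shift2; simpl. f_equal; f_equal; ring.
Qed.

Lemma hol_cdiff (V : C * C -> Prop) (f : C * C -> C) (w : C * C) :
  hol V f -> V w -> is_cdiff f w (pderiv 1 f w) (pderiv 2 f w).
Proof.
  intros Hf hw. destruct (Hf w hw) as (A & B & H). destruct (cdiff_pderiv f w A B H) as [-> ->]. exact H.
Qed.

(** * Estimates on polydiscs by restriction to complex lines *)

Lemma inv_INR_small (c eps : R) : (0 <= c)%R -> (0 < eps)%R -> exists N, forall n, (N <= n)%nat ->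
  (c / (INR n + 1) < eps)%R.
Proof.
  intros hc he. destruct (nfloor_ex (c / eps)) as [N [_ hN]].
  { apply Rdiv_le_0_compat; lra. }
  exists N. intros n hn. apply le_INR in hn. pose proof (pos_INR N).
  apply Rlt_div_l; [lra|]. apply Rlt_div_l in hN; [|lra]. nra.
Qed.

(** Letting [m] tend to infinity keeps the error bound [e n]; this rate is what
    [directional_derivative_cdiff] uses. *)
Lemma C_cauchy_limit (u : nat -> C) (e : nat -> R) :
  (forall n m, (Cmod (u n - u m) <= e n + e m)%R) ->
  (forall eps, (0 < eps)%R -> exists N, forall n, (N <= n)%nat -> (e n < eps)%R) ->
  exists l, forall n, (Cmod (u n - l) <= e n)%R.
Proof.
  intros hu he.
  assert (hC : forall p : C -> R, (forall x y, p (x - y) = (p x - p y)%R) ->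
    (forall x, (Rabs (p x) <= Cmod x)%R) -> Cauchy_crit (fun n => p (u n))).
  { intros p p1 p2 eps heps. destruct (he (eps / 2)%R ltac:(lra)) as [N HN].
    exists N. intros n m hn hm. unfold Rdist. rewrite <- p1.
    eapply Rle_lt_trans; [apply p2|]. eapply Rle_lt_trans; [apply hu|].
    specialize (HN n hn) as a. specialize (HN m hm) as b. lra. }
  destruct (Rcomplete.R_complete _ (hC fst ltac:(intros [] []; reflexivity) Rabs_fst_le)) as [l1 h1].
  destruct (Rcomplete.R_complete _ (hC snd ltac:(intros [] []; reflexivity) Rabs_snd_le)) as [l2 h2].
  exists (l1, l2). intros n. apply le_epsilon. intros eps heps.
  destruct (h1 (eps / 3)%R ltac:(lra)) as [N1 H1]. destruct (h2 (eps / 3)%R ltac:(lra)) as [N2 H2].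
  destruct (he (eps / 3)%R ltac:(lra)) as [N3 H3].
  set (m := (N1 + N2 + N3)%nat).
  specialize (H1 m ltac:(lia)). specialize (H2 m ltac:(lia)). specialize (H3 m ltac:(lia)).
  unfold Rdist in H1, H2.
  replace (u n - (l1, l2)) with ((u n - u m) + (u m - (l1, l2))) by ring.
  eapply Rle_trans; [apply Cmod_triangle|]. specialize (hu n m).
  pose proof (Cmod_le_components (u m - (l1, l2))) as X. simpl in X.
  unfold Rminus in H1, H2. lra.
Qed.

Section Polydisc.

Variables (f : C * C -> C) (p : C * C) (r M : R).
Hypothesis hr : (0 < r)%R.
Hypothesis hf : hol (ball2 p r) f.
Hypothesis hM : forall w, ball2 p r w -> (Cmod (f w) <= M)%R.

Lemma polydisc_bound_nonneg : (0 <= M)%R.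
Proof. eapply Rle_trans; [apply Cmod_ge_0|apply (hM p), ball2_center, hr]. Qed.

Lemma line_in_polydisc (eta : R) (h1 h2 t : C) :
  (0 < eta)%R -> (Cmod h1 <= eta)%R -> (Cmod h2 <= eta)%R -> (Cmod (t - 0) < r / eta)%R ->
  ball2 p r (shift2 p (t * h1) (t * h2)).
Proof.
  intros he k1 k2 ht. replace (t - 0) with t in ht by ring. apply Rlt_div_r in ht; [|exact he].
  pose proof (Cmod_ge_0 t). apply shift2_ball; rewrite Cmod_mult; nra.
Qed.

Let dline (h1 h2 t : C) : C :=
  pderiv 1 f (shift2 p (t * h1) (t * h2)) * h1 + pderiv 2 f (shift2 p (t * h1) (t * h2)) * h2.

Lemma shift2_0_mult (h1 h2 : C) : shift2 p (0 * h1) (0 * h2) = p.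
Proof. rewrite !Cmult_0_l. apply shift2_0. Qed.

Lemma shift2_1_mult (h1 h2 : C) : shift2 p (1 * h1) (1 * h2) = shift2 p h1 h2.
Proof. rewrite !Cmult_1_l. reflexivity. Qed.

(** On the line [t -> p + t * h] the polydisc contains the disc of radius [r / eta]. The
    one-variable estimates at 0, with increment 1, then give the three polydisc bounds that
    follow. *)
Lemma polydisc_line (eta : R) (h1 h2 : C) :
  (0 < eta)%R -> (Cmod h1 <= eta)%R -> (Cmod h2 <= eta)%R ->
  forall t, (Cmod (t - 0) < r / eta)%R ->
    is_cderiv (fun t => f (shift2 p (t * h1) (t * h2))) t (dline h1 h2 t) /\
    (Cmod (f (shift2 p (t * h1) (t * h2))) <= M)%R.
Proof.
  intros he k1 k2 t ht. pose proof (line_in_polydisc eta h1 h2 t he k1 k2 ht) as X.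
  split; [|apply hM, X]. apply cdiff_line. exact (hol_cdiff _ f _ hf X).
Qed.

Lemma polydisc_cauchy (eta : R) (h1 h2 : C) :
  (0 < eta)%R -> (Cmod h1 <= eta)%R -> (Cmod h2 <= eta)%R ->
  (Cmod (pderiv 1 f p * h1 + pderiv 2 f p * h2) <= 8 * M * eta / r)%R.
Proof.
  intros he k1 k2. pose proof (polydisc_line eta h1 h2 he k1 k2) as L.
  pose proof (cauchy_estimate _ _ 0 (r / eta) M ltac:(apply Rdiv_lt_0_compat; lra)
    (fun t ht => proj1 (L t ht)) (fun t ht => proj2 (L t ht))) as X.
  unfold dline in X. rewrite shift2_0_mult in X.
  replace (8 * M * eta / r)%R with (8 * M / (r / eta))%R by (field; lra). exact X.
Qed.

Lemma polydisc_lipschitz (eta : R) (h1 h2 : C) :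
  (0 < eta)%R -> (Cmod h1 <= eta)%R -> (Cmod h2 <= eta)%R -> (eta < r / 2)%R ->
  (Cmod (f (shift2 p h1 h2) - f p) <= 32 * M * eta / r)%R.
Proof.
  intros he k1 k2 hs. pose proof (polydisc_line eta h1 h2 he k1 k2) as L.
  assert (hq : (2 < r / eta)%R) by (apply (Rlt_div_r 2); lra).
  pose proof (holomorphic_lipschitz _ _ 0 0 1 (r / eta) M ltac:(apply Rdiv_lt_0_compat; lra)
    (fun t ht => proj1 (L t ht)) (fun t ht => proj2 (L t ht))) as X.
  cbv beta in X. rewrite Cplus_0_l, shift2_0_mult, shift2_1_mult in X.
  replace (0 - 0) with (RtoC 0) in X by ring. replace (1 - 0) with (RtoC 1) in X by ring.
  rewrite Cmod_0, Cmod_1 in X.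
  replace (32 * M * eta / r)%R with (32 * M / (r / eta) * 1)%R by (field; lra). apply X; lra.
Qed.

Lemma polydisc_taylor2 (eta : R) (h1 h2 : C) :
  (0 < eta)%R -> (Cmod h1 <= eta)%R -> (Cmod h2 <= eta)%R -> (eta < r / 4)%R ->
  (Cmod (f (shift2 p h1 h2) - f p - pderiv 1 f p * h1 - pderiv 2 f p * h2)
     <= 1024 * M * (eta / r) ^ 2)%R.
Proof.
  intros he k1 k2 hs. pose proof (polydisc_line eta h1 h2 he k1 k2) as L.
  assert (hq : (4 < r / eta)%R) by (apply (Rlt_div_r 4); lra).
  pose proof (holomorphic_taylor2 _ _ 0 1 (r / eta) M ltac:(apply Rdiv_lt_0_compat; lra)
    (fun t ht => proj1 (L t ht)) (fun t ht => proj2 (L t ht))) as X.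
  cbv beta in X. unfold dline in X. rewrite Cplus_0_l, shift2_0_mult, shift2_1_mult, Cmod_1 in X.
  replace (f (shift2 p h1 h2) - f p - pderiv 1 f p * h1 - pderiv 2 f p * h2)
    with (f (shift2 p h1 h2) - f p - (pderiv 1 f p * h1 + pderiv 2 f p * h2) * 1) by ring.
  replace (eta / r)%R with (1 / (r / eta))%R by (field; lra). apply X; lra.
Qed.

End Polydisc.

(** * Partial derivatives of holomorphic functions are holomorphic *)

Definition diffquot (v1 v2 : C) (e : R) (f : C * C -> C) (w : C * C) : C :=
  / RtoC e * (f (shift2 w (RtoC e * v1) (RtoC e * v2)) - f w).

Lemma cdiff_diffquot (v1 v2 : C) (e : R) (f : C * C -> C) (w : C * C) (V : C * C -> Prop) :
  hol V f -> V w -> V (shift2 w (RtoC e * v1) (RtoC e * v2)) ->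
  is_cdiff (diffquot v1 v2 e f) w (diffquot v1 v2 e (pderiv 1 f) w) (diffquot v1 v2 e (pderiv 2 f) w).
Proof.
  intros hf h1 h2. unfold diffquot. apply cdiff_scal, cdiff_minus; [|exact (hol_cdiff V f w hf h1)].
  apply cdiff_translate. exact (hol_cdiff V f _ hf h2).
Qed.

Section DirectionalDerivative.

Variables (f : C * C -> C) (p : C * C) (r M : R) (v1 v2 : C).
Hypothesis hr : (0 < r)%R.
(** Radius [2 * r] leaves a polydisc of radius [r] around every point of [ball2 p r], which makes
    the bounds below uniform there. *)
Hypothesis hf : hol (ball2 p (2 * r)) f.
Hypothesis hM : forall w, ball2 p (2 * r) w -> (Cmod (f w) <= M)%R.
Hypothesis hv1 : (Cmod v1 <= 1)%R.
Hypothesis hv2 : (Cmod v2 <= 1)%R.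

Let dv (w : C * C) : C := v1 * pderiv 1 f w + v2 * pderiv 2 f w.

Let M_nonneg : (0 <= M)%R.
Proof. apply (polydisc_bound_nonneg f p (2 * r)); [lra|exact hM]. Qed.

Let sub_hol (w : C * C) : ball2 p r w -> hol (ball2 w r) f.
Proof. intros hw z hz. apply hf. apply (ball2_trans p w z r r); [exact hw|exact hz|lra]. Qed.

Let sub_bound (w z : C * C) : ball2 p r w -> ball2 w r z -> (Cmod (f z) <= M)%R.
Proof. intros hw hz. apply hM. apply (ball2_trans p w z r r); [exact hw|exact hz|lra]. Qed.

Let step_le (e : R) (v : C) : (0 < e)%R -> (Cmod v <= 1)%R -> (Cmod (RtoC e * v) <= e)%R.
Proof. intros he hv. rewrite Cmod_mult, Cmod_R, Rabs_pos_eq by lra. nra. Qed.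

Lemma diffquot_close (e : R) (w : C * C) : (0 < e < r / 4)%R -> ball2 p r w ->
  (Cmod (diffquot v1 v2 e f w - dv w) <= 1024 * M * e / (r * r))%R.
Proof.
  intros he hw.
  pose proof (polydisc_taylor2 f w r M hr (sub_hol w hw) (fun z => sub_bound w z hw) e
    (RtoC e * v1) (RtoC e * v2) ltac:(lra) (step_le e v1 ltac:(lra) hv1)
    (step_le e v2 ltac:(lra) hv2) ltac:(lra)) as X.
  assert (hne : RtoC e <> 0) by (intros E; apply RtoC_inj in E; lra).
  unfold diffquot, dv.
  match type of X with (Complex.Cmod ?y <= _)%R => set (Y := y) in * end.
  replace (/ RtoC e * (f (shift2 w (RtoC e * v1) (RtoC e * v2)) - f w) -
    (v1 * pderiv 1 f w + v2 * pderiv 2 f w)) with (/ RtoC e * Y) by (unfold Y; field; exact hne).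
  rewrite Cmod_mult, <- RtoC_inv, Cmod_R, Rabs_pos_eq by (try apply Rlt_le, Rinv_0_lt_compat; lra).
  replace (1024 * M * e / (r * r))%R with (/ e * (1024 * M * (e / r) ^ 2))%R by (field; lra).
  apply Rmult_le_compat_l; [apply Rlt_le, Rinv_0_lt_compat; lra|exact X].
Qed.

Lemma diffquot_bound (e : R) (w : C * C) : (0 < e < r / 4)%R -> ball2 p r w ->
  (Cmod (diffquot v1 v2 e f w) <= 32 * M / r)%R.
Proof.
  intros he hw.
  pose proof (polydisc_lipschitz f w r M hr (sub_hol w hw) (fun z => sub_bound w z hw) e
    (RtoC e * v1) (RtoC e * v2) ltac:(lra) (step_le e v1 ltac:(lra) hv1)
    (step_le e v2 ltac:(lra) hv2) ltac:(lra)) as X.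
  unfold diffquot.
  rewrite Cmod_mult, <- RtoC_inv, Cmod_R, Rabs_pos_eq by (try apply Rlt_le, Rinv_0_lt_compat; lra).
  replace (32 * M / r)%R with (/ e * (32 * M * e / r))%R by (field; lra).
  apply Rmult_le_compat_l; [apply Rlt_le, Rinv_0_lt_compat; lra|exact X].
Qed.

Lemma diffquot_cdiff (e : R) (w : C * C) : (0 < e < r / 4)%R -> ball2 p r w ->
  is_cdiff (diffquot v1 v2 e f) w (diffquot v1 v2 e (pderiv 1 f) w) (diffquot v1 v2 e (pderiv 2 f) w).
Proof.
  intros he hw. apply (cdiff_diffquot _ _ _ _ _ (ball2 p (2 * r)) hf).
  - apply (ball2_le p w r); [lra|exact hw].
  - apply (ball2_trans p w _ r r); [exact hw| |lra].
    pose proof (step_le e v1 ltac:(lra) hv1). pose proof (step_le e v2 ltac:(lra) hv2).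
    apply shift2_ball; lra.
Qed.

Let en (n : nat) : R := (r / 8 / (INR n + 1))%R.

Let en_pos (n : nat) : (0 < en n < r / 4)%R.
Proof.
  pose proof (pos_INR n). unfold en. split; [apply Rdiv_lt_0_compat; lra|].
  apply Rle_lt_trans with (r / 8)%R; [|lra]. apply Rle_div_l; [lra|]. nra.
Qed.

Let K : R := (8 * (1024 * M / (r * r)) / r)%R.

(** Two difference quotients of [f] are uniformly close to [dv], hence to each other; Cauchy's
    estimate for their difference then brings their derivatives at [p] together. *)
Lemma diffquot_pderiv_cauchy (n m : nat) :
  (Cmod (diffquot v1 v2 (en n) (pderiv 1 f) p - diffquot v1 v2 (en m) (pderiv 1 f) p) <= K * en n + K * en m)%R /\
  (Cmod (diffquot v1 v2 (en n) (pderiv 2 f) p - diffquot v1 v2 (en m) (pderiv 2 f) p) <= K * en n + K * en m)%R.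
Proof.
  set (G := fun w => diffquot v1 v2 (en n) f w - diffquot v1 v2 (en m) f w).
  assert (hG : forall w, ball2 p r w -> is_cdiff G w
    (diffquot v1 v2 (en n) (pderiv 1 f) w - diffquot v1 v2 (en m) (pderiv 1 f) w)
    (diffquot v1 v2 (en n) (pderiv 2 f) w - diffquot v1 v2 (en m) (pderiv 2 f) w)).
  { intros w hw. apply cdiff_minus; apply diffquot_cdiff; auto. }
  assert (bG : forall w, ball2 p r w -> (Cmod (G w) <= 1024 * M / (r * r) * (en n + en m))%R).
  { intros w hw. unfold G.
    replace (diffquot v1 v2 (en n) f w - diffquot v1 v2 (en m) f w)
      with ((diffquot v1 v2 (en n) f w - dv w) - (diffquot v1 v2 (en m) f w - dv w)) by ring.
    eapply Rle_trans; [apply Cmod_triangle_minus|].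
    pose proof (diffquot_close (en n) w (en_pos n) hw).
    pose proof (diffquot_close (en m) w (en_pos m) hw). unfold Rdiv in *. lra. }
  assert (cG := polydisc_cauchy G p r _ hr (fun w hw => ex_intro _ _ (ex_intro _ _ (hG w hw))) bG 1).
  destruct (cdiff_pderiv G p _ _ (hG p (ball2_center p r hr))) as [E1 E2]. rewrite E1, E2 in cG.
  replace (K * en n + K * en m)%R with (8 * (1024 * M / (r * r) * (en n + en m)) * 1 / r)%R
    by (unfold K; field; lra).
  split.
  - specialize (cG 1 0 ltac:(lra)). rewrite Cmod_1, Cmod_0 in cG. specialize (cG ltac:(lra) ltac:(lra)).
    rewrite Cmult_1_r, Cmult_0_r, Cplus_0_r in cG. exact cG.
  - specialize (cG 0 1 ltac:(lra)). rewrite Cmod_1, Cmod_0 in cG. specialize (cG ltac:(lra) ltac:(lra)).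
    rewrite Cmult_1_r, Cmult_0_r, Cplus_0_l in cG. exact cG.
Qed.

Let K_nonneg : (0 <= K)%R.
Proof.
  unfold K. apply Rdiv_le_0_compat; [|exact hr]. apply Rmult_le_pos; [lra|].
  apply Rdiv_le_0_compat; [lra|]. nra.
Qed.

Let Ken_small (c : R) : (0 <= c)%R -> forall eps, (0 < eps)%R -> exists N, forall n, (N <= n)%nat -> (c * en n < eps)%R.
Proof.
  intros hc eps he. destruct (inv_INR_small (c * (r / 8)) eps) as [N HN]; [nra|exact he|].
  exists N. intros n hn. unfold en. specialize (HN n hn). unfold Rdiv in *. lra.
Qed.

(** Weierstrass's argument: the second-order Taylor bound for the difference quotients has a
    constant independent of the step, so it passes to the limit as a quadratic remainder for [dv].
    The rate in the second part is kept for the symmetry of mixed derivatives. *)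
Lemma directional_derivative_cdiff :
  exists A B, is_cdiff dv p A B /\
    forall n, (Cmod (diffquot v1 v2 (en n) (pderiv 1 f) p - A) <= K * en n)%R /\
              (Cmod (diffquot v1 v2 (en n) (pderiv 2 f) p - B) <= K * en n)%R.
Proof.
  destruct (C_cauchy_limit _ _ (fun n m => proj1 (diffquot_pderiv_cauchy n m)) (Ken_small K K_nonneg))
    as [A HA].
  destruct (C_cauchy_limit _ _ (fun n m => proj2 (diffquot_pderiv_cauchy n m)) (Ken_small K K_nonneg))
    as [B HB].
  exists A, B. split; [|intros n; split; auto].
  set (Q := (1024 * (32 * M / r) / (r * r))%R).
  assert (hQ : (0 <= Q)%R).
  { unfold Q. apply Rdiv_le_0_compat; [|nra]. apply Rmult_le_pos; [lra|]. apply Rdiv_le_0_compat; lra. }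
  assert (main : forall eta h1 h2, (0 < eta)%R -> (Cmod h1 <= eta)%R -> (Cmod h2 <= eta)%R ->
    (eta < r / 4)%R -> (Cmod (dv (shift2 p h1 h2) - dv p - A * h1 - B * h2) <= Q * (eta * eta))%R).
  { intros eta h1 h2 he k1 k2 hs. apply le_epsilon. intros eps heps.
    (* The cost of replacing a difference quotient by its limit is [c * e]: twice [diffquot_close],
       at [p] and at the shifted point, and twice the rate [K * e] times [eta]. *)
    set (c := (2 * (1024 * M / (r * r)) + 2 * K * eta)%R).
    assert (hc : (0 <= c)%R).
    { assert (0 <= 1024 * M / (r * r))%R by (apply Rdiv_le_0_compat; nra).
      assert (0 <= K * eta)%R by (apply Rmult_le_pos; lra). unfold c; lra. }
    destruct (Ken_small c hc eps heps) as [N HN]. specialize (HN N (le_n _)).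
    pose proof (en_pos N) as hN. set (e := en N) in *.
    assert (hw : ball2 p r (shift2 p h1 h2)) by (apply shift2_ball; lra).
    pose proof (diffquot_close e _ hN hw) as X1.
    pose proof (diffquot_close e _ hN (ball2_center p r hr)) as X2.
    pose proof (HA N) as XA. pose proof (HB N) as XB. fold e in XA, XB.
    pose proof (polydisc_taylor2 (diffquot v1 v2 e f) p r (32 * M / r) hr
      (fun w hw => ex_intro _ _ (ex_intro _ _ (diffquot_cdiff e w hN hw)))
      (fun w hw => diffquot_bound e w hN hw) eta h1 h2 he k1 k2 hs) as X3.
    destruct (cdiff_pderiv _ _ _ _ (diffquot_cdiff e p hN (ball2_center p r hr))) as [E1 E2].
    rewrite E1, E2 in X3.
    set (D := diffquot v1 v2 e f) in *. set (A' := diffquot v1 v2 e (pderiv 1 f) p) in *.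
    set (B' := diffquot v1 v2 e (pderiv 2 f) p) in *. set (w := shift2 p h1 h2) in *.
    replace (dv w - dv p - A * h1 - B * h2) with
      ((D w - D p - A' * h1 - B' * h2) + (((D p - dv p) - (D w - dv w)) + ((A' - A) * h1 + (B' - B) * h2)))
      by ring.
    eapply Rle_trans; [apply Cmod_triangle|].
    eapply Rle_trans; [apply Rplus_le_compat_l, Cmod_triangle|].
    eapply Rle_trans; [apply Rplus_le_compat_l, Rplus_le_compat; [apply Cmod_triangle_minus|apply Cmod_triangle]|].
    rewrite !Cmod_mult.
    assert (Y1 : (Cmod (A' - A) * Cmod h1 <= K * e * eta)%R)
      by (apply Rmult_le_compat; auto using Cmod_ge_0).
    assert (Y2 : (Cmod (B' - B) * Cmod h2 <= K * e * eta)%R)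
      by (apply Rmult_le_compat; auto using Cmod_ge_0).
    replace (1024 * (32 * M / r) * (eta / r) ^ 2)%R with (Q * (eta * eta))%R in X3
      by (unfold Q; field; lra).
    unfold c in HN. unfold Rdiv in *. lra. }
  intros eps he. set (d := Rmin (r / 8) (eps / (2 * (Q + 1)))).
  exists d. split; [apply Rmin_pos; [lra|apply Rdiv_lt_0_compat; lra]|].
  intros h1 h2 k1 k2. set (eta := (Cmod h1 + Cmod h2)%R).
  pose proof (Cmod_ge_0 h1) as p1. pose proof (Cmod_ge_0 h2) as p2.
  pose proof (Rlt_le_trans _ _ _ k1 (Rmin_l _ _)). pose proof (Rlt_le_trans _ _ _ k2 (Rmin_l _ _)).
  pose proof (Rlt_le_trans _ _ _ k1 (Rmin_r _ _)) as q1. pose proof (Rlt_le_trans _ _ _ k2 (Rmin_r _ _)) as q2.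
  apply Rlt_div_r in q1; [|lra]. apply Rlt_div_r in q2; [|lra].
  destruct (Req_dec eta 0) as [E0|E0].
  - assert (e1 : h1 = 0) by (apply Cmod_eq_0; unfold eta in E0; lra).
    assert (e2 : h2 = 0) by (apply Cmod_eq_0; unfold eta in E0; lra). subst h1 h2.
    rewrite shift2_0. replace (dv p - dv p - A * 0 - B * 0) with (RtoC 0) by ring.
    rewrite Cmod_0, E0. lra.
  - eapply Rle_trans; [apply (main eta h1 h2); unfold eta in *; lra|].
    rewrite <- Rmult_assoc. apply Rmult_le_compat_r; [unfold eta; lra|].
    unfold eta in *. nra.
Qed.

End DirectionalDerivative.

Lemma hol_locally_bounded (V : C * C -> Prop) (f : C * C -> C) (p : C * C) :
  open2 V -> hol V f -> V p ->
  exists r M, (0 < r)%R /\ (forall w, ball2 p r w -> V w) /\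
    (forall w, ball2 p r w -> (Cmod (f w) <= M)%R).
Proof.
  intros hV hf hp. destruct (hV p hp) as (r1 & hr1 & H1).
  destruct (cdiff_cont f p _ _ (hol_cdiff V f p hf hp) 1%R ltac:(lra)) as (r2 & hr2 & H2).
  exists (Rmin r1 r2), (1 + Cmod (f p))%R. split; [apply Rmin_pos; assumption|]. split.
  - intros w hw. apply H1, (ball2_le p w (Rmin r1 r2)); [apply Rmin_l|exact hw].
  - intros w hw. specialize (H2 w (ball2_le p w (Rmin r1 r2) r2 (Rmin_r _ _) hw)).
    replace (f w) with ((f w - f p) + f p) by ring.
    eapply Rle_trans; [apply Cmod_triangle|]. lra.
Qed.

Lemma hol_sub (V W : C * C -> Prop) (f : C * C -> C) :
  (forall w, W w -> V w) -> hol V f -> hol W f.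
Proof. intros h hf w hw. apply hf, h, hw. Qed.

Lemma directional_at (V : C * C -> Prop) (f : C * C -> C) (p v : C * C) :
  open2 V -> hol V f -> V p -> (Cmod (fst v) <= 1)%R -> (Cmod (snd v) <= 1)%R ->
  exists A B, is_cdiff (fun w => fst v * pderiv 1 f w + snd v * pderiv 2 f w) p A B /\
    forall eps, (0 < eps)%R -> exists e, (0 < e < eps)%R /\
      (Cmod (diffquot (fst v) (snd v) e (pderiv 1 f) p - A) < eps)%R /\
      (Cmod (diffquot (fst v) (snd v) e (pderiv 2 f) p - B) < eps)%R.
Proof.
  intros hV hf hp h1 h2. destruct (hol_locally_bounded V f p hV hf hp) as (r & M & hr & hB & hM).
  assert (Er : (2 * (r / 2) = r)%R) by lra.
  destruct (directional_derivative_cdiff f p (r / 2) M (fst v) (snd v)) as (A & B & H & HAB);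
    try assumption; try lra.
  - rewrite Er. apply (hol_sub V); assumption.
  - rewrite Er. exact hM.
  - exists A, B. split; [exact H|]. intros eps he.
    match type of HAB with forall n, (_ <= ?K * _)%R /\ _ => set (c := K) in * end.
    (* [Rmax c 1] makes one choice of [N] serve both requirements: step below [eps] and error below
       [eps]. *)
    assert (hc : (0 <= Rmax c 1)%R) by (eapply Rle_trans; [|apply Rmax_r]; lra).
    destruct (inv_INR_small (Rmax c 1 * (r / 2 / 8)) eps) as [N HN]; [nra|exact he|].
    specialize (HN N (le_n _)). destruct (HAB N) as [X1 X2]. pose proof (pos_INR N) as hN.
    set (e := (r / 2 / 8 / (INR N + 1))%R) in *.
    replace (Rmax c 1 * (r / 2 / 8) / (INR N + 1))%R with (Rmax c 1 * e)%R in HN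
      by (unfold e; field; lra).
    assert (e0 : (0 < e)%R) by (unfold e; apply Rdiv_lt_0_compat; lra).
    pose proof (Rmax_l c 1). pose proof (Rmax_r c 1).
    exists e. repeat split; [exact e0|nra| |].
    + eapply Rle_lt_trans; [exact X1|]. nra.
    + eapply Rle_lt_trans; [exact X2|]. nra.
Qed.

Lemma hol_pderiv (V : C * C -> Prop) (f : C * C -> C) : open2 V -> hol V f ->
  hol V (pderiv 1 f) /\ hol V (pderiv 2 f).
Proof.
  intros hV hf. split; intros p hp.
  - destruct (directional_at V f p (RtoC 1, RtoC 0) hV hf hp) as (A & B & H & _);
      simpl; rewrite ?Cmod_1, ?Cmod_0; try lra.
    exists A, B. apply (cdiff_ext _ (pderiv 1 f) p A B 1 ltac:(lra)) in H; [exact H|].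
    intros; simpl fst; simpl snd; ring.
  - destruct (directional_at V f p (RtoC 0, RtoC 1) hV hf hp) as (A & B & H & _);
      simpl; rewrite ?Cmod_1, ?Cmod_0; try lra.
    exists A, B. apply (cdiff_ext _ (pderiv 2 f) p A B 1 ltac:(lra)) in H; [exact H|].
    intros; simpl fst; simpl snd; ring.
Qed.

(** By [directional_at], the left side is a limit of difference quotients of [pderiv 2 f] in the
    first direction. As [pderiv 2 f] is differentiable, that limit is the right side. *)
Lemma pderiv_comm (V : C * C -> Prop) (f : C * C -> C) (p : C * C) :
  open2 V -> hol V f -> V p -> pderiv 2 (pderiv 1 f) p = pderiv 1 (pderiv 2 f) p.
Proof.
  intros hV hf hp.
  destruct (directional_at V f p (RtoC 1, RtoC 0) hV hf hp) as (A & B & H & L);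
    simpl fst in *; simpl snd in *; rewrite ?Cmod_1, ?Cmod_0; try lra.
  apply (cdiff_ext _ (pderiv 1 f) p A B 1 ltac:(lra)) in H; [|intros; ring].
  rewrite (proj2 (cdiff_pderiv _ _ _ _ H)).
  pose proof (hol_cdiff V _ p (proj2 (hol_pderiv V f hV hf)) hp) as H2.
  set (A2 := pderiv 1 (pderiv 2 f) p) in *. set (B2 := pderiv 2 (pderiv 2 f) p) in *.
  assert (Z : B - A2 = 0).
  { apply Cmod_zero_of_small. intros eps he.
    destruct (H2 (eps / 2)%R ltac:(lra)) as (d & hd & Hd).
    destruct (L (Rmin d (eps / 2))) as (e & [e0 he2] & _ & X); [apply Rmin_pos; lra|].
    pose proof (Rmin_l d (eps / 2)). pose proof (Rmin_r d (eps / 2)).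
    specialize (Hd (RtoC e * 1) (RtoC e * 0)).
    rewrite Cmult_1_r, !Cmult_0_r, Cmod_R, Cmod_0, Rabs_pos_eq in Hd by lra.
    specialize (Hd ltac:(lra) ltac:(lra)).
    unfold diffquot in X. rewrite Cmult_1_r, Cmult_0_r in X.
    assert (hne : RtoC e <> 0) by (intros E; apply RtoC_inj in E; lra).
    match type of Hd with (Complex.Cmod ?y <= _)%R => set (Y := y) in * end.
    match type of X with (Complex.Cmod ?y < _)%R => set (T := y) in * end.
    replace (B - A2) with (/ RtoC e * Y - T) by (unfold Y, T; field; exact hne).
    eapply Rle_trans; [apply Cmod_triangle_minus|].
    rewrite Cmod_mult, <- RtoC_inv, Cmod_R, Rabs_pos_eq by (try apply Rlt_le, Rinv_0_lt_compat; lra).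
    assert (/ e * Cmod Y <= eps / 2)%R.
    { apply (Rmult_le_reg_l e); [exact e0|]. rewrite <- Rmult_assoc, Rinv_r, Rmult_1_l by lra. lra. }
    lra. }
  replace B with ((B - A2) + A2) by ring. rewrite Z. ring.
Qed.

Lemma hol_ext (V : C * C -> Prop) (f g : C * C -> C) :
  open2 V -> (forall w, V w -> f w = g w) -> hol V f -> hol V g.
Proof.
  intros hV E hf w hw. destruct (hf w hw) as (A & B & H). exists A, B.
  exact (cdiff_ext_on V f g w A B hV hw E H).
Qed.

Lemma hol_const (V : C * C -> Prop) (c : C) : hol V (fun _ => c).
Proof. intros w _. exists 0, 0. apply cdiff_const. Qed.

Lemma hol_fst (V : C * C -> Prop) : hol V fst.
Proof. intros w _. exists 1, 0. apply cdiff_fst. Qed.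

Lemma hol_snd (V : C * C -> Prop) : hol V snd.
Proof. intros w _. exists 0, 1. apply cdiff_snd. Qed.

Lemma hol_plus (V : C * C -> Prop) (f g : C * C -> C) :
  hol V f -> hol V g -> hol V (fun w => f w + g w).
Proof.
  intros hf hg w hw. destruct (hf w hw) as (A & B & H). destruct (hg w hw) as (A' & B' & H').
  eexists; eexists; apply cdiff_plus; eassumption.
Qed.

Lemma hol_mult (V : C * C -> Prop) (f g : C * C -> C) :
  hol V f -> hol V g -> hol V (fun w => f w * g w).
Proof.
  intros hf hg w hw. destruct (hf w hw) as (A & B & H). destruct (hg w hw) as (A' & B' & H').
  eexists; eexists; apply cdiff_mult; eassumption.
Qed.

Lemma pderiv_ext (V : C * C -> Prop) (f g : C * C -> C) (w : C * C) :
  open2 V -> hol V f -> (forall z, V z -> f z = g z) -> V w ->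
  pderiv 1 f w = pderiv 1 g w /\ pderiv 2 f w = pderiv 2 g w.
Proof.
  intros hV hf E hw. pose proof (hol_cdiff V f w hf hw) as H.
  pose proof (cdiff_ext_on V f g w _ _ hV hw E H) as H'.
  destruct (cdiff_pderiv _ _ _ _ H') as [-> ->]. split; reflexivity.
Qed.

Lemma pderiv_plus (V : C * C -> Prop) (f g : C * C -> C) (w : C * C) :
  hol V f -> hol V g -> V w ->
  pderiv 1 (fun z => f z + g z) w = pderiv 1 f w + pderiv 1 g w /\
  pderiv 2 (fun z => f z + g z) w = pderiv 2 f w + pderiv 2 g w.
Proof.
  intros hf hg hw. apply cdiff_pderiv, cdiff_plus; [exact (hol_cdiff V f w hf hw)|exact (hol_cdiff V g w hg hw)].
Qed.

Lemma pderiv_mult (V : C * C -> Prop) (f g : C * C -> C) (w : C * C) :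
  hol V f -> hol V g -> V w ->
  pderiv 1 (fun z => f z * g z) w = pderiv 1 f w * g w + f w * pderiv 1 g w /\
  pderiv 2 (fun z => f z * g z) w = pderiv 2 f w * g w + f w * pderiv 2 g w.
Proof.
  intros hf hg hw. apply cdiff_pderiv, cdiff_mult; [exact (hol_cdiff V f w hf hw)|exact (hol_cdiff V g w hg hw)].
Qed.

(** * Vanishing to infinite order *)

(** Cauchy's estimate [k] times, each time giving up [delta] of the radius. *)
Lemma derivative_growth (phi : nat -> C -> C) (r M delta : R) :
  (0 < delta)%R ->
  (forall k t, (Cmod t < r)%R -> is_cderiv (phi k) t (phi (S k) t)) ->
  (forall t, (Cmod t < r)%R -> (Cmod (phi 0%nat t) <= M)%R) ->
  forall k t, (Cmod t < r - INR k * delta)%R -> (Cmod (phi k t) <= M * (8 / delta) ^ k)%R.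
Proof.
  intros hd hphi hM. induction k as [|k IH]; intros t ht.
  - simpl in *. rewrite Rmult_1_r. apply hM. lra.
  - rewrite S_INR in ht.
    assert (hz : forall z, (Cmod (z - t) < delta)%R -> (Cmod z < r - INR k * delta)%R).
    { intros z hz. replace z with ((z - t) + t) by ring.
      eapply Rle_lt_trans; [apply Cmod_triangle|]. lra. }
    pose proof (pos_INR k).
    replace (M * (8 / delta) ^ S k)%R with (8 * (M * (8 / delta) ^ k) / delta)%R
      by (simpl; field; lra).
    apply (cauchy_estimate (phi k) (phi (S k))); [exact hd| |].
    + intros z hz'. apply hphi. specialize (hz z hz'). nra.
    + intros z hz'. apply IH, hz, hz'.
Qed.

(** A crude Stirling bound: the induction step is [(1 + 1/n)^n <= exp 1 <= 3]. *)
Lemma pow_self_le_fact (n : nat) : ((INR n) ^ n <= 3 ^ n * INR (fact n))%R.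
Proof.
  induction n as [|n IH]; [simpl; lra|].
  rewrite fact_simpl, mult_INR.
  assert (H : ((INR (S n)) ^ n <= 3 * (INR n) ^ n)%R).
  { destruct n as [|m]; [simpl; lra|].
    assert (hp : (0 < INR (S m))%R) by (apply lt_0_INR; lia).
    replace (INR (S (S m))) with (INR (S m) * (1 + / INR (S m)))%R
      by (rewrite (S_INR (S m)); field; lra).
    rewrite Rpow_mult_distr, Rmult_comm. apply Rmult_le_compat_r; [apply pow_le; lra|].
    apply Rle_trans with (exp (/ INR (S m)) ^ S m)%R.
    { apply pow_incr. split; [|apply exp_ineq1_le]. pose proof (Rinv_0_lt_compat _ hp). lra. }
    replace (exp (/ INR (S m)) ^ S m)%R with (exp 1).
    - apply exp_le_3.
    - rewrite <- Rpower_pow by apply exp_pos. unfold Rpower. rewrite ln_exp. f_equal. field; lra. }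
  simpl pow. pose proof (pos_INR (S n)). 
  apply Rle_trans with (INR (S n) * (3 * (INR n) ^ n))%R; [apply Rmult_le_compat_l; assumption|].
  apply Rle_trans with (INR (S n) * (3 * (3 ^ n * INR (fact n))))%R; [|right; ring].
  apply Rmult_le_compat_l; [assumption|]. lra.
Qed.

(** For every [n], Cauchy's bound for the [n]-th derivative is integrated [n] times from 0, where
    all derivatives vanish. The gain [1 / n!] absorbs the [n^n] of the bound, and for small [t] a
    factor [(/ 2) ^ n] remains. *)
Lemma infinite_order_zero (phi : nat -> C -> C) (r M : R) (t : C) :
  (0 < r)%R ->
  (forall k t, (Cmod t < r)%R -> is_cderiv (phi k) t (phi (S k) t)) ->
  (forall t, (Cmod t < r)%R -> (Cmod (phi 0%nat t) <= M)%R) ->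
  (forall k, phi k 0 = 0) -> (Cmod t <= r / 200)%R -> phi 0%nat t = 0.
Proof.
  intros hr hphi hM h0 ht.
  assert (hM0 : (0 <= M)%R).
  { eapply Rle_trans; [apply Cmod_ge_0|apply (hM 0)]. rewrite Cmod_0; exact hr. }
  assert (main : forall n, (Cmod (phi 0%nat t) <= M * (/2) ^ n)%R).
  { intros [|n']; [simpl; rewrite Rmult_1_r; apply hM; lra|].
    set (n := S n'). assert (hn : (0 < INR n)%R) by (apply lt_0_INR; unfold n; lia).
    (* The bound of [derivative_growth] with [delta = r / (2 n)]: the [n] steps use up half of the
       radius. *)
    set (B := (M * (16 * INR n / r) ^ n)%R).
    assert (hB : (0 <= B)%R).
    { apply Rmult_le_pos; [exact hM0|]. apply pow_le. apply Rdiv_le_0_compat; lra. }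
    assert (X : forall j, (j <= n)%nat -> forall s, (Cmod s < r / 2)%R ->
      (Cmod (phi (n - j)%nat s) <= B * 2 ^ j * Cmod s ^ j / INR (fact j))%R).
    { induction j as [|j IH]; intros hj s hs.
      - rewrite Nat.sub_0_r. simpl. unfold Rdiv. rewrite Rinv_1, !Rmult_1_r. unfold B.
        replace (16 * INR n / r)%R with (8 / (r / (2 * INR n)))%R by (field; lra).
        apply (derivative_growth phi r); [apply Rdiv_lt_0_compat; lra|assumption|assumption|].
        replace (INR n * (r / (2 * INR n)))%R with (r / 2)%R by (field; lra). lra.
      - specialize (IH ltac:(lia)). pose proof (Cmod_ge_0 s) as hs0.
        assert (E : (n - j)%nat = S (n - S j)) by lia. rewrite E in IH.
        pose proof (segment_bound (phi (n - S j)%nat) (phi (S (n - S j))) s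
          (B * 2 ^ j * Cmod s ^ j / INR (fact j)) j) as Y.
        rewrite h0 in Y. replace (phi (n - S j)%nat s - 0) with (phi (n - S j)%nat s) in Y by ring.
        pose proof (INR_fact_lt_0 j) as hf. pose proof (pos_INR j) as hj0.
        replace (B * 2 ^ S j * Cmod s ^ S j / INR (fact (S j)))%R
          with (2 * (B * 2 ^ j * Cmod s ^ j / INR (fact j)) * Cmod s / (INR j + 1))%R.
        2: { rewrite fact_simpl, mult_INR, S_INR. simpl. field; lra. }
        assert (hu : forall u, (0 <= u <= 1)%R -> (Cmod (RtoC u * s) = u * Cmod s)%R).
        { intros u hu. rewrite Cmod_mult, Cmod_R, Rabs_pos_eq by lra. reflexivity. }
        apply Y.
        + intros u hu'. apply hphi. rewrite hu by exact hu'. nra.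
        + intros u hu'. eapply Rle_trans; [apply IH; rewrite hu by exact hu'; nra|].
          rewrite hu by exact hu'. rewrite Rpow_mult_distr. right. field; lra. }
    specialize (X n (le_n _) t ltac:(lra)). rewrite Nat.sub_diag in X.
    eapply Rle_trans; [exact X|]. unfold B.
    pose proof (INR_fact_lt_0 n) as hf. pose proof (Cmod_ge_0 t) as ht0.
    apply Rle_div_l; [exact hf|].
    replace (M * (16 * INR n / r) ^ n * 2 ^ n * Cmod t ^ n)%R
      with (M * (INR n ^ n * (32 * Cmod t / r) ^ n))%R.
    2: { rewrite !Rmult_assoc, <- !Rpow_mult_distr. f_equal. f_equal. field; lra. }
    rewrite Rmult_assoc. apply Rmult_le_compat_l; [exact hM0|].
    (* The radius [r / 200] was chosen for this: it gives [32 * Cmod t / r <= / 6], and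
       [3 ^ n * (/ 6) ^ n = (/ 2) ^ n]. *)
    apply Rle_trans with (3 ^ n * INR (fact n) * (/ 6) ^ n)%R.
    - apply Rmult_le_compat.
      + apply pow_le; lra.
      + apply pow_le. apply Rdiv_le_0_compat; lra.
      + apply pow_self_le_fact.
      + apply pow_incr. split; [apply Rdiv_le_0_compat; lra|]. apply Rle_div_l; lra.
    - right. replace (/2)%R with (3 * / 6)%R by field. rewrite Rpow_mult_distr. ring. }
  apply Cmod_zero_of_small. intros eps he.
  destruct (pow_lt_1_zero (/2) ltac:(rewrite Rabs_pos_eq; lra) (eps / (M + 1))%R) as [N HN].
  { apply Rdiv_lt_0_compat; lra. }
  specialize (HN N (le_n _)).
  assert (hp : (0 < (/2)^N)%R) by (apply pow_lt; lra).
  rewrite Rabs_pos_eq in HN by lra. apply Rlt_div_r in HN; [|lra].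
  eapply Rle_trans; [apply (main N)|]. nra.
Qed.

(** Covers the derivatives of order below [k] in every order of differentiation, so that sums and
    products are handled by plain induction on [k]. *)
Fixpoint flat (k : nat) (f : C * C -> C) (q : C * C) : Prop :=
  match k with
  | O => True
  | S k' => f q = 0 /\ flat k' (pderiv 1 f) q /\ flat k' (pderiv 2 f) q
  end.

Definition vanishes_near (f : C * C -> C) (q : C * C) : Prop :=
  exists delta, (0 < delta)%R /\ forall w, ball2 q delta w -> f w = 0.

Section Flat.

Variable V : C * C -> Prop.
Hypothesis hV : open2 V.
Variable q : C * C.
Hypothesis hq : V q.

Lemma flat_ext (k : nat) : forall f g, hol V f -> (forall w, V w -> f w = g w) ->
  flat k f q -> flat k g q.
Proof.
  induction k as [|k IH]; intros f g hf E H; [exact I|].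
  destruct H as (H0 & H1 & H2). destruct (hol_pderiv V f hV hf) as [hf1 hf2].
  split; [rewrite <- E; assumption|]. split.
  - apply IH with (pderiv 1 f); [assumption| |assumption]. intros w hw. apply (pderiv_ext V); assumption.
  - apply IH with (pderiv 2 f); [assumption| |assumption]. intros w hw. apply (pderiv_ext V); assumption.
Qed.

Lemma flat_pred (k : nat) : forall f, flat (S k) f q -> flat k f q.
Proof.
  induction k as [|k IH]; intros f H; [exact I|].
  destruct H as (H0 & H1 & H2). split; [exact H0|]. split; apply IH; assumption.
Qed.

Lemma flat_plus (k : nat) : forall f g, hol V f -> hol V g ->
  flat k f q -> flat k g q -> flat k (fun w => f w + g w) q.
Proof.
  induction k as [|k IH]; intros f g hf hg Hf Hg; [exact I|].
  destruct Hf as (Hf0 & Hf1 & Hf2). destruct Hg as (Hg0 & Hg1 & Hg2).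
  destruct (hol_pderiv V f hV hf) as [hf1 hf2]. destruct (hol_pderiv V g hV hg) as [hg1 hg2].
  split; [rewrite Hf0, Hg0; ring|]. split.
  - apply flat_ext with (fun w => pderiv 1 f w + pderiv 1 g w); [apply hol_plus; assumption| |auto].
    intros w hw. exact (eq_sym (proj1 (pderiv_plus V f g w hf hg hw))).
  - apply flat_ext with (fun w => pderiv 2 f w + pderiv 2 g w); [apply hol_plus; assumption| |auto].
    intros w hw. exact (eq_sym (proj2 (pderiv_plus V f g w hf hg hw))).
Qed.

Lemma flat_mult (k : nat) : forall g f, hol V g -> hol V f -> flat k f q -> flat k (fun w => g w * f w) q.
Proof.
  induction k as [|k IH]; intros g f hg hf Hf; [exact I|].
  pose proof (flat_pred k f Hf) as Hf'. destruct Hf as (Hf0 & Hf1 & Hf2).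
  destruct (hol_pderiv V f hV hf) as [hf1 hf2]. destruct (hol_pderiv V g hV hg) as [hg1 hg2].
  split; [rewrite Hf0; ring|]. split.
  - apply flat_ext with (fun w => pderiv 1 g w * f w + g w * pderiv 1 f w).
    + apply hol_plus; apply hol_mult; assumption.
    + intros w hw. exact (eq_sym (proj1 (pderiv_mult V g f w hg hf hw))).
    + apply flat_plus; try (apply hol_mult; assumption); apply IH; assumption.
  - apply flat_ext with (fun w => pderiv 2 g w * f w + g w * pderiv 2 f w).
    + apply hol_plus; apply hol_mult; assumption.
    + intros w hw. exact (eq_sym (proj2 (pderiv_mult V g f w hg hf hw))).
    + apply flat_plus; try (apply hol_mult; assumption); apply IH; assumption.
Qed.

Let D (h1 h2 : C) (f : C * C -> C) (w : C * C) : C := h1 * pderiv 1 f w + h2 * pderiv 2 f w.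

(** On the line through [q] and [w] the iterates of the directional derivative [D h1 h2] are the
    successive derivatives, and all vanish at [q]. The radius [r / 200] depends only on the polydisc
    where [f] is bounded; [vanishes_propagates] relies on this uniformity. *)
Lemma flat_zero_ball (f : C * C -> C) (r M : R) :
  (0 < r)%R -> (forall w, ball2 q r w -> V w) -> hol V f ->
  (forall w, ball2 q r w -> (Cmod (f w) <= M)%R) ->
  (forall k, flat k f q) -> forall w, ball2 q (r / 200) w -> f w = 0.
Proof.
  intros hr hsub hf hM hflat w hw.
  set (h1 := fst w - fst q). set (h2 := snd w - snd q).
  set (F := fun k => Nat.iter k (D h1 h2) f).
  assert (hF : forall k, hol V (F k) /\ forall n, flat n (F k) q).
  { induction k as [|k [IH1 IH2]]; [split; assumption|].
    change (F (S k)) with (D h1 h2 (F k)).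
    destruct (hol_pderiv V (F k) hV IH1) as [hf1 hf2]. unfold D. split.
    - apply hol_plus; apply hol_mult; auto using hol_const.
    - intros n. destruct (IH2 (S n)) as (_ & X1 & X2).
      apply flat_plus; try (apply hol_mult; auto using hol_const);
        apply flat_mult with (g := fun _ => _); auto using hol_const. }
  assert (E : w = shift2 q (1 * h1) (1 * h2)).
  { rewrite !Cmult_1_l. symmetry. apply shift2_diff. }
  set (eta := (r / 200)%R).
  destruct hw as [k1 k2]. fold eta h1 in k1. fold eta h2 in k2.
  assert (heta : (0 < eta)%R) by (unfold eta; lra).
  assert (hline : forall t, (Cmod t < 200)%R -> ball2 q r (shift2 q (t * h1) (t * h2))).
  { intros t ht. apply (line_in_polydisc q r eta); try lra.
    replace (t - 0) with t by ring. replace (r / eta)%R with 200%R by (unfold eta; field; lra). exact ht. }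
  rewrite E.
  apply (infinite_order_zero (fun k t => F k (shift2 q (t * h1) (t * h2))) 200 M); [lra| | | |].
  - intros k t ht. specialize (hline t ht). apply hsub in hline. destruct (hF k) as [X _].
    eapply cderiv_eq; [apply cdiff_line; exact (hol_cdiff V (F k) _ X hline)|].
    change (F (S k)) with (D h1 h2 (F k)). unfold D. ring.
  - intros t ht. apply hM, hline, ht.
  - intros k. rewrite shift2_0_mult. destruct (hF k) as [_ X]. apply (X 1%nat).
  - rewrite Cmod_1. lra.
Qed.

Lemma flat_zero (k : nat) : flat k (fun _ => 0) q.
Proof.
  induction k as [|k IH]; [exact I|]. split; [reflexivity|].
  assert (X : forall w, RtoC 0 = pderiv 1 (fun _ => RtoC 0) w /\ RtoC 0 = pderiv 2 (fun _ => RtoC 0) w).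
  { intros w. destruct (cdiff_pderiv (fun _ => RtoC 0) w 0 0 (cdiff_const 0 w)) as [-> ->].
    split; reflexivity. }
  split; apply flat_ext with (fun _ => RtoC 0); try apply hol_const; try exact IH; intros w _.
  - exact (proj1 (X w)).
  - exact (proj2 (X w)).
Qed.

Lemma flat_vanishes_near (f : C * C -> C) : hol V f -> (forall k, flat k f q) -> vanishes_near f q.
Proof.
  intros hf H. destruct (hol_locally_bounded V f q hV hf hq) as (r & M & hr & hB & hM).
  exists (r / 200)%R. split; [lra|]. apply (flat_zero_ball f r M); assumption.
Qed.

End Flat.

Lemma vanishes_near_flat (f : C * C -> C) (q : C * C) (k : nat) : vanishes_near f q -> flat k f q.
Proof.
  intros (d & hd & H).
  apply (flat_ext (ball2 q d) (ball2_open q d) q (ball2_center q d hd) k (fun _ => 0)).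
  - apply hol_const.
  - intros w hw. symmetry. apply H, hw.
  - apply (flat_zero (ball2 q d)); [apply ball2_open|apply ball2_center, hd].
Qed.

(** The points near which [f] vanishes form a relatively closed set: the zeros around a nearby [q]
    reach [p], because the radius in [flat_zero_ball] does not shrink with [q]. *)
Lemma vanishes_propagates (V : C * C -> Prop) (f : C * C -> C) (p : C * C) :
  open2 V -> hol V f -> V p -> exists rho, (0 < rho)%R /\
    forall q, ball2 p rho q -> (vanishes_near f q -> vanishes_near f p).
Proof.
  intros hV hf hp. destruct (hol_locally_bounded V f p hV hf hp) as (r & M & hr & hB & hM).
  (* Two steps of [r / 1000] stay within [(r / 2) / 200], the radius that [flat_zero_ball] gives
     around [q]. *)
  exists (r / 1000)%R. split; [lra|]. intros q hq Hq.
  assert (hsub : forall w, ball2 q (r / 2) w -> ball2 p r w).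
  { intros w hw. apply (ball2_trans p q w (r / 1000) (r / 2)); [exact hq|exact hw|lra]. }
  exists (r / 1000)%R. split; [lra|]. intros w hw.
  apply (flat_zero_ball V hV q (hB q (ball2_le p q (r / 1000) r ltac:(lra) hq)) f (r / 2) M);
    auto; try lra.
  - intros k. apply vanishes_near_flat, Hq.
  - apply (ball2_trans q p w (r / 1000) (r / 1000)); [apply ball2_sym, hq|exact hw|lra].
Qed.

(** * The identity theorem *)

Lemma ball2_of_ball (p w : C * C) (d : posreal) : ball p (d / 2) w -> ball2 p d w.
Proof.
  intros [[H1 H2] [H3 H4]].
  assert (X : forall a b : C, (Rabs (fst a - fst b) < d / 2 -> Rabs (snd a - snd b) < d / 2 ->
    Cmod (a - b) < d)%R).
  { intros a b h1 h2. eapply Rle_lt_trans; [apply Cmod_le_components|].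
    change (Rabs (fst a - fst b) + Rabs (snd a - snd b) < d)%R. lra. }
  split; apply X; assumption.
Qed.

Lemma ball_of_ball2 (p w : C * C) (d : R) : ball2 p d w -> ball p d w.
Proof.
  intros [h1 h2].
  split; split.
  - exact (Rle_lt_trans _ _ _ (Rabs_fst_le (fst w - fst p)) h1).
  - exact (Rle_lt_trans _ _ _ (Rabs_snd_le (fst w - fst p)) h1).
  - exact (Rle_lt_trans _ _ _ (Rabs_fst_le (snd w - snd p)) h2).
  - exact (Rle_lt_trans _ _ _ (Rabs_snd_le (snd w - snd p)) h2).
Qed.

Lemma continuous_ball2 (g : R -> C * C) (t : R) : continuous g t ->
  forall eps, (0 < eps)%R -> exists delta, (0 < delta)%R /\
    forall s, (Rabs (s - t) < delta)%R -> ball2 (g t) eps (g s).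
Proof.
  intros hg eps he. assert (he2 : (0 < eps / 2)%R) by lra.
  destruct (proj1 (filterlim_locally _ _) hg (mkposreal _ he2)) as [d Hd].
  exists d. split; [apply cond_pos|]. intros s hs.
  apply (ball2_of_ball (g t) (g s) (mkposreal eps he)), Hd, hs.
Qed.

(** Bisection of the path, with a degenerate second side. The implication from vanishing near [g a]
    to vanishing near [g b] is transitive. Around any [t] it holds for short intervals: either [f]
    vanishes near [g t], hence near [g b], or by [vanishes_propagates] it does not vanish near
    [g a]. *)
Lemma identity_theorem (V : C * C -> Prop) (f : C * C -> C) (x : C * C) :
  open2 V -> path_connected V -> hol V f -> V x -> vanishes_near f x ->
  forall y, V y -> f y = 0.
Proof.
  intros hV hpc hf hx Hx y hy. destruct (hpc x y hx hy) as (g & hg & g0 & g1 & hgV).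
  assert (Hy : vanishes_near f y).
  { rewrite <- g1. revert Hx. rewrite <- g0.
    apply (bisection (fun a b _ _ => vanishes_near f (g a) -> vanishes_near f (g b)) 0 1 0 0); try lra.
    - intros a b c d _ _ _ _ _ _ q1 q2 _ _ h. apply q2, q1, h.
    - intros t s ht _. destruct (vanishes_propagates V f (g t) hV hf (hgV t ht)) as (rho & hrho & Hrho).
      destruct (continuous_ball2 g t (hg t) rho hrho) as (d1 & hd1 & H1).
      destruct (excluded_middle_informative (vanishes_near f (g t))) as [(e & he & He)|hn].
      + destruct (continuous_ball2 g t (hg t) e he) as (d2 & hd2 & H2).
        exists d2. split; [exact hd2|]. intros a b c d ha hb _ _ hab _ _.
        destruct (ball2_open (g t) e (g b)) as (r & hr & Hr).
        { apply H2. rewrite Rabs_pos_eq; lra. }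
        exists r. split; [exact hr|]. intros w hw. apply He, Hr, hw.
      + exists d1. split; [exact hd1|]. intros a b c d ha hb _ _ hab _ h. exfalso. apply hn.
        apply (Hrho (g a)); [|exact h]. apply H1. rewrite Rabs_left1; lra. }
  destruct Hy as (d & hd & H). apply H, ball2_center, hd.
Qed.

(** * Comparison with openness and Frechet differentiability in the library *)

Lemma open_open2 (U : C * C -> Prop) : open U -> open2 U.
Proof.
  intros hU p hp. destruct (hU p hp) as [d Hd]. exists d. split; [apply cond_pos|].
  intros w hw. apply Hd, ball_of_ball2, hw.
Qed.

Definition CC := prod_NormedModule C_AbsRing C_NormedModule C_NormedModule.

Lemma norm_pair_le (h1 h2 : C) : (norm ((h1, h2) : CC) <= Cmod h1 + Cmod h2)%R.
Proof.
  change (sqrt (Cmod h1 ^ 2 + Cmod h2 ^ 2) <= Cmod h1 + Cmod h2)%R.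
  pose proof (Cmod_ge_0 h1). pose proof (Cmod_ge_0 h2).
  rewrite <- (sqrt_square (Cmod h1 + Cmod h2)) by lra. apply sqrt_le_1_alt. nra.
Qed.

Lemma norm_pair_ge (h1 h2 : C) :
  (Cmod h1 <= norm ((h1, h2) : CC))%R /\ (Cmod h2 <= norm ((h1, h2) : CC))%R.
Proof.
  change (Cmod h1 <= sqrt (Cmod h1 ^ 2 + Cmod h2 ^ 2) /\ Cmod h2 <= sqrt (Cmod h1 ^ 2 + Cmod h2 ^ 2))%R.
  pose proof (Cmod_ge_0 h1). pose proof (Cmod_ge_0 h2). split.
  - rewrite <- (sqrt_square (Cmod h1)) at 1 by lra. apply sqrt_le_1_alt. nra.
  - rewrite <- (sqrt_square (Cmod h2)) at 1 by lra. apply sqrt_le_1_alt. nra.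
Qed.

Lemma holomorphic_on_hol (U : C * C -> Prop) (f : C * C -> C) : holomorphic_on U f -> hol U f.
Proof.
  intros hf w hw. destruct (hf w hw) as [l [[lp ls _] hl]].
  specialize (hl w (fun P H => H)).
  exists (l (RtoC 1, RtoC 0)), (l (RtoC 0, RtoC 1)).
  intros eps he. destruct (hl (mkposreal eps he)) as [d Hd]. exists d. split; [apply cond_pos|].
  intros h1 h2 k1 k2.
  assert (hb : ball w d (shift2 w h1 h2)) by (apply ball_of_ball2, shift2_ball; assumption).
  specialize (Hd (shift2 w h1 h2) hb).
  change (Cmod (f (shift2 w h1 h2) - f w - l (fst w + h1 - fst w, snd w + h2 - snd w)%C)
    <= eps * norm ((fst w + h1 - fst w, snd w + h2 - snd w)%C : CC))%R in Hd.
  replace (fst w + h1 - fst w) with h1 in Hd by ring.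
  replace (snd w + h2 - snd w) with h2 in Hd by ring.
  assert (El : l (h1, h2) = h1 * l (RtoC 1, RtoC 0) + h2 * l (RtoC 0, RtoC 1)).
  { transitivity (l (plus (scal (h1 : C_AbsRing) ((RtoC 1, RtoC 0) : CC)) (scal (h2 : C_AbsRing) ((RtoC 0, RtoC 1) : CC)))).
    - f_equal. change ((h1, h2) = (h1 * 1 + h2 * 0, h1 * 0 + h2 * 1)). f_equal; ring.
    - rewrite lp, !ls. reflexivity. }
  rewrite El in Hd.
  eapply Rle_trans; [|eapply Rle_trans; [exact Hd|apply Rmult_le_compat_l; [simpl; lra|apply norm_pair_le]]].
  right. f_equal.
  change (f (shift2 w h1 h2) - f w - l (RtoC 1, RtoC 0) * h1 - l (RtoC 0, RtoC 1) * h2 =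
    (f (shift2 w h1 h2) - f w) - (h1 * l (RtoC 1, RtoC 0) + h2 * l (RtoC 0, RtoC 1))). ring.
Qed.

Lemma hol_holomorphic_on (U : C * C -> Prop) (f : C * C -> C) : hol U f -> holomorphic_on U f.
Proof.
  intros hf w hw. destruct (hf w hw) as (A & B & H).
  exists (fun h => A * fst h + B * snd h). split.
  - split.
    + intros [x1 x2] [y1 y2]. change (A * (x1 + y1) + B * (x2 + y2) = A * x1 + B * x2 + (A * y1 + B * y2)). ring.
    + intros k [x1 x2]. change (A * (k * x1) + B * (k * x2) = k * (A * x1 + B * x2)). ring.
    + pose proof (Cmod_ge_0 A). pose proof (Cmod_ge_0 B).
      exists (Cmod A + Cmod B + 1)%R. split; [lra|]. intros [x1 x2].
      destruct (norm_pair_ge x1 x2) as [n1 n2].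
      change (Cmod (A * x1 + B * x2) <= (Cmod A + Cmod B + 1) * norm ((x1, x2) : CC))%R.
      eapply Rle_trans; [apply Cmod_triangle|]. rewrite !Cmod_mult.
      set (n := norm ((x1, x2) : CC)) in *. pose proof (Cmod_ge_0 x1).
      assert (Cmod A * Cmod x1 <= Cmod A * n)%R by (apply Rmult_le_compat_l; assumption).
      assert (Cmod B * Cmod x2 <= Cmod B * n)%R by (apply Rmult_le_compat_l; assumption).
      assert (0 <= n)%R by (eapply Rle_trans; [exact H2|exact n1]). lra.
  - intros x hx. apply (is_filter_lim_locally_unique (V := CC)) in hx. subst x.
    intros eps. destruct (H (eps / 2)%R) as (d & hd & Hd); [pose proof (cond_pos eps); lra|].
    assert (hd2 : (0 < d / 2)%R) by lra.
    exists (mkposreal _ hd2). intros y hy.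
    destruct (ball2_of_ball w y (mkposreal d hd) hy) as [y1 y2]. simpl in y1, y2.
    specialize (Hd _ _ y1 y2). rewrite shift2_diff in Hd.
    destruct (norm_pair_ge (fst y - fst w) (snd y - snd w)) as [n1 n2].
    change (Cmod (f y - f w - (A * (fst y - fst w) + B * (snd y - snd w)))
      <= eps * norm ((fst y - fst w, snd y - snd w)%C : CC))%R.
    replace (f y - f w - (A * (fst y - fst w) + B * (snd y - snd w)))
      with (f y - f w - A * (fst y - fst w) - B * (snd y - snd w)) by ring.
    eapply Rle_trans; [exact Hd|]. pose proof (cond_pos eps).
    set (n := norm ((fst y - fst w, snd y - snd w)%C : CC)) in *.
    change (Cmod (fst y - fst w) <= n)%R in n1. change (Cmod (snd y - snd w) <= n)%R in n2.
    apply Rle_trans with (eps / 2 * (n + n))%R; [|right; change (eps / 2 * (n + n) = eps * n)%R; field].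
    apply Rmult_le_compat_l; [lra|]. apply Rplus_le_compat; assumption.
Qed.

(** * Euler derivatives of solutions *)

Lemma cderiv_inv (z : C) : z <> 0 -> is_cderiv (fun w => / w) z (- / (z * z)).
Proof.
  intros hz eps he. pose proof (proj1 (Cmod_gt_0 z) hz) as hm.
  exists (Rmin (Cmod z / 2) (eps * (Cmod z * Cmod z * Cmod z) / 2)). split.
  { assert (0 < Cmod z * Cmod z * Cmod z)%R by (repeat apply Rmult_lt_0_compat; assumption).
    apply Rmin_pos; nra. }
  intros h hh. pose proof (Rlt_le_trans _ _ _ hh (Rmin_l _ _)) as h1.
  pose proof (Rlt_le_trans _ _ _ hh (Rmin_r _ _)) as h2.
  pose proof (Cmod_reverse z h) as h3. pose proof (Cmod_ge_0 h) as h0.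
  assert (hzh : z + h <> 0) by (apply Cmod_gt_0; lra).
  replace (/ (z + h) - / z - - / (z * z) * h) with (h * h * / (z * z * (z + h)))
    by (field; split; assumption).
  rewrite !Cmod_mult, Cmod_inv by (repeat apply Cmult_neq_0; assumption). rewrite !Cmod_mult.
  set (m := Cmod z) in *. set (k := Cmod (z + h)) in *. set (n := Cmod h) in *.
  assert (hmmk : (0 < m * m * k)%R) by (repeat apply Rmult_lt_0_compat; lra).
  replace (n * n * / (m * m * k))%R with ((n * / (m * m * k)) * n)%R by ring.
  apply Rmult_le_compat_r; [exact h0|].
  apply (Rmult_le_reg_r (m * m * k)); [exact hmmk|].
  rewrite Rmult_assoc, Rinv_l, Rmult_1_r by lra.
  apply Rle_trans with (eps * (m * m * (m / 2)))%R; [lra|].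
  apply Rmult_le_compat_l; [lra|]. apply Rmult_le_compat_l; [nra|]. lra.
Qed.

Section Euler.

Variable U : C * C -> Prop.
Hypothesis hU : open2 U.

Lemma hol_theta (f : C * C -> C) : hol U f -> hol U (theta 1 f) /\ hol U (theta 2 f).
Proof.
  intros hf. destruct (hol_pderiv U f hU hf) as [h1 h2].
  split; unfold theta, coord; apply hol_mult; auto using hol_fst, hol_snd.
Qed.

Lemma hol_theta1 (f : C * C -> C) : hol U f -> hol U (theta 1 f).
Proof. apply hol_theta. Qed.

Lemma hol_theta2 (f : C * C -> C) : hol U f -> hol U (theta 2 f).
Proof. apply hol_theta. Qed.

Lemma hol_shift_theta (c : C) (f : C * C -> C) : hol U f ->
  hol U (shift_theta c 1 f) /\ hol U (shift_theta c 2 f).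
Proof.
  intros hf. unfold shift_theta. split; apply hol_plus;
    auto using hol_theta1, hol_theta2, hol_mult, hol_const.
Qed.

Lemma hol_shift_theta1 (c : C) (f : C * C -> C) : hol U f -> hol U (shift_theta c 1 f).
Proof. intros hf. exact (proj1 (hol_shift_theta c f hf)). Qed.

Lemma hol_shift_theta2 (c : C) (f : C * C -> C) : hol U f -> hol U (shift_theta c 2 f).
Proof. intros hf. exact (proj2 (hol_shift_theta c f hf)). Qed.

Lemma hol_shift_theta12 (c : C) (f : C * C -> C) : hol U f -> hol U (shift_theta12 c f).
Proof.
  intros hf. unfold shift_theta12.
  apply hol_plus; [apply hol_plus|]; auto using hol_theta1, hol_theta2, hol_mult, hol_const.
Qed.

Lemma theta_ext (f g : C * C -> C) : hol U f -> (forall w, U w -> f w = g w) ->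
  forall w, U w -> theta 1 f w = theta 1 g w /\ theta 2 f w = theta 2 g w.
Proof.
  intros hf E w hw. destruct (pderiv_ext U f g w hU hf E hw) as [e1 e2].
  unfold theta. rewrite e1, e2. split; reflexivity.
Qed.

Lemma theta_plus (f g : C * C -> C) : hol U f -> hol U g -> forall w, U w ->
  theta 1 (fun z => f z + g z) w = theta 1 f w + theta 1 g w /\
  theta 2 (fun z => f z + g z) w = theta 2 f w + theta 2 g w.
Proof.
  intros hf hg w hw. destruct (pderiv_plus U f g w hf hg hw) as [e1 e2].
  unfold theta. rewrite e1, e2. split; ring.
Qed.

Lemma theta_mult (f g : C * C -> C) : hol U f -> hol U g -> forall w, U w ->
  theta 1 (fun z => f z * g z) w = theta 1 f w * g w + f w * theta 1 g w /\
  theta 2 (fun z => f z * g z) w = theta 2 f w * g w + f w * theta 2 g w.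
Proof.
  intros hf hg w hw. destruct (pderiv_mult U f g w hf hg hw) as [e1 e2].
  unfold theta. rewrite e1, e2. split; ring.
Qed.

Lemma theta_cdiff (f : C * C -> C) (w : C * C) (A B : C) : is_cdiff f w A B ->
  theta 1 f w = fst w * A /\ theta 2 f w = snd w * B.
Proof. intros H. destruct (cdiff_pderiv f w A B H) as [e1 e2]. unfold theta. rewrite e1, e2. split; reflexivity. Qed.

Lemma theta_comm (f : C * C -> C) : hol U f -> forall w, U w ->
  theta 2 (theta 1 f) w = theta 1 (theta 2 f) w.
Proof.
  intros hf w hw. destruct (hol_pderiv U f hU hf) as [h1 h2].
  change (theta 2 (fun z => fst z * pderiv 1 f z) w = theta 1 (fun z => snd z * pderiv 2 f z) w).
  rewrite (proj2 (theta_mult fst (pderiv 1 f) (hol_fst U) h1 w hw)).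
  rewrite (proj1 (theta_mult snd (pderiv 2 f) (hol_snd U) h2 w hw)).
  rewrite (proj2 (theta_cdiff fst w _ _ (cdiff_fst w))), (proj1 (theta_cdiff snd w _ _ (cdiff_snd w))).
  unfold theta; simpl coord. rewrite (pderiv_comm U f w hU hf hw). ring.
Qed.

(** A normal form for words in the two Euler operators, which commute by [theta_comm]. *)
Definition thetas (p q : nat) (f : C * C -> C) : C * C -> C :=
  Nat.iter p (theta 1) (Nat.iter q (theta 2) f).

Lemma hol_iter_theta2 (q : nat) (f : C * C -> C) : hol U f -> hol U (Nat.iter q (theta 2) f).
Proof. intros hf. induction q; [exact hf|]. apply hol_theta2; assumption. Qed.

Lemma hol_thetas (p q : nat) (f : C * C -> C) : hol U f -> hol U (thetas p q f).
Proof.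
  intros hf. unfold thetas. induction p; [apply hol_iter_theta2, hf|]. apply hol_theta1; assumption.
Qed.

Lemma thetas_ext (p q : nat) (f g : C * C -> C) : hol U f -> (forall w, U w -> f w = g w) ->
  forall w, U w -> thetas p q f w = thetas p q g w.
Proof.
  intros hf E.
  assert (E2 : forall w, U w -> Nat.iter q (theta 2) f w = Nat.iter q (theta 2) g w).
  { induction q as [|q IH]; [exact E|]. intros w hw.
    apply theta_ext; [apply hol_iter_theta2, hf|assumption|assumption]. }
  unfold thetas. induction p as [|p IH]; [exact E2|]. intros w hw.
  apply theta_ext; [apply (hol_thetas p q f hf)|assumption|assumption].
Qed.

Lemma thetas_plus (p q : nat) (f g : C * C -> C) : hol U f -> hol U g -> forall w, U w ->
  thetas p q (fun z => f z + g z) w = thetas p q f w + thetas p q g w.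
Proof.
  intros hf hg.
  assert (E2 : forall w, U w -> Nat.iter q (theta 2) (fun z => f z + g z) w
     = Nat.iter q (theta 2) f w + Nat.iter q (theta 2) g w).
  { induction q as [|q IH]; [reflexivity|]. intros w hw. simpl.
    rewrite <- (proj2 (theta_plus _ _ (hol_iter_theta2 q f hf) (hol_iter_theta2 q g hg) w hw)).
    apply theta_ext; [apply hol_iter_theta2, hol_plus; assumption|assumption|assumption]. }
  unfold thetas. induction p as [|p IH]; [exact E2|]. intros w hw. simpl.
  fold (thetas p q f) (thetas p q g).
  rewrite <- (proj1 (theta_plus _ _ (hol_thetas p q f hf) (hol_thetas p q g hg) w hw)).
  apply theta_ext; [apply (hol_thetas p q), hol_plus; assumption|assumption|assumption].
Qed.

Lemma thetas_scal (p q : nat) (c : C) (f : C * C -> C) : hol U f -> forall w, U w ->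
  thetas p q (fun z => c * f z) w = c * thetas p q f w.
Proof.
  intros hf.
  assert (hc : forall g, hol U g -> hol U (fun z => c * g z)).
  { intros g hg. apply hol_mult; [apply hol_const|exact hg]. }
  assert (S : forall g, hol U g -> forall w, U w ->
     theta 1 (fun z => c * g z) w = c * theta 1 g w /\ theta 2 (fun z => c * g z) w = c * theta 2 g w).
  { intros g hg w hw. destruct (theta_cdiff _ w _ _ (cdiff_scal c g w _ _ (hol_cdiff U g w hg hw))) as [-> ->].
    unfold theta; simpl coord. split; ring. }
  assert (E2 : forall w, U w -> Nat.iter q (theta 2) (fun z => c * f z) w
     = c * Nat.iter q (theta 2) f w).
  { induction q as [|q IH]; [reflexivity|]. intros w hw. simpl.
    rewrite <- (proj2 (S _ (hol_iter_theta2 q f hf) w hw)).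
    apply theta_ext; [apply hol_iter_theta2, hc; assumption|assumption|assumption]. }
  unfold thetas. induction p as [|p IH]; [exact E2|]. intros w hw. simpl.
  fold (thetas p q f).
  rewrite <- (proj1 (S _ (hol_thetas p q f hf) w hw)).
  apply theta_ext; [apply (hol_thetas p q), hc; assumption|assumption|assumption].
Qed.

Lemma thetas_theta2 (p q : nat) (f : C * C -> C) (w : C * C) :
  thetas p q (theta 2 f) w = thetas p (S q) f w.
Proof. unfold thetas. rewrite Nat.iter_succ_r. reflexivity. Qed.

Lemma thetas_theta1 (p q : nat) (f : C * C -> C) : hol U f -> forall w, U w ->
  thetas p q (theta 1 f) w = thetas (S p) q f w.
Proof.
  intros hf w hw.
  assert (E : forall w, U w -> Nat.iter q (theta 2) (theta 1 f) w = theta 1 (Nat.iter q (theta 2) f) w).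
  { clear w hw. induction q as [|q IH]; [reflexivity|]. intros w hw. simpl.
    rewrite <- (theta_comm _ (hol_iter_theta2 q f hf) w hw).
    apply theta_ext; [apply hol_iter_theta2, hol_theta1, hf|exact IH|exact hw]. }
  change (thetas p q (theta 1 f) w) with (thetas p 0 (Nat.iter q (theta 2) (theta 1 f)) w).
  rewrite (thetas_ext p 0 _ _ (hol_iter_theta2 q _ (hol_theta1 f hf)) E w hw).
  unfold thetas. simpl. rewrite <- Nat.iter_succ_r. reflexivity.
Qed.

Lemma thetas_shift1 (p q : nat) (c : C) (f : C * C -> C) : hol U f -> forall w, U w ->
  thetas p q (shift_theta c 1 f) w = c * thetas p q f w + thetas (S p) q f w.
Proof.
  intros hf w hw. unfold shift_theta.
  rewrite thetas_plus by auto using hol_mult, hol_const, hol_theta1.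
  rewrite thetas_scal, thetas_theta1 by assumption. reflexivity.
Qed.

Lemma thetas_shift2 (p q : nat) (c : C) (f : C * C -> C) : hol U f -> forall w, U w ->
  thetas p q (shift_theta c 2 f) w = c * thetas p q f w + thetas p (S q) f w.
Proof.
  intros hf w hw. unfold shift_theta.
  rewrite thetas_plus by auto using hol_mult, hol_const, hol_theta2.
  rewrite thetas_scal, thetas_theta2 by assumption. reflexivity.
Qed.

Lemma thetas_shift12 (p q : nat) (c : C) (f : C * C -> C) : hol U f -> forall w, U w ->
  thetas p q (shift_theta12 c f) w = c * thetas p q f w + (thetas (S p) q f w + thetas p (S q) f w).
Proof.
  intros hf w hw. unfold shift_theta12.
  rewrite (thetas_plus p q (fun x => c * f x + theta 1 f x) (theta 2 f)) by auto using hol_plus, hol_mult, hol_const, hol_theta1, hol_theta2.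
  rewrite thetas_plus by auto using hol_mult, hol_const, hol_theta1.
  rewrite thetas_scal, thetas_theta1, thetas_theta2 by assumption. ring.
Qed.

Variable x0 : C * C.
Hypothesis hx0 : U x0.

Definition theta_flat (k : nat) (f : C * C -> C) : Prop :=
  forall p q, (p + q < k)%nat -> thetas p q f x0 = 0.

(** Each first-order operator costs one order of flatness, so three of them fit below order
    [3 + k]. *)
Lemma theta_flat_shift (k : nat) (c : C) (f : C * C -> C) : hol U f -> theta_flat (S k) f ->
  theta_flat k (shift_theta c 1 f) /\ theta_flat k (shift_theta c 2 f) /\ theta_flat k (shift_theta12 c f).
Proof.
  intros hf H. repeat split; intros p q hpq.
  - rewrite thetas_shift1, !H by (assumption || lia). ring.
  - rewrite thetas_shift2, !H by (assumption || lia). ring.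
  - rewrite thetas_shift12, !H by (assumption || lia). ring.
Qed.

(** The constant [c] multiplies a derivative that is zero by flatness; only the principal part of
    the operator survives. *)
Lemma top_shift1 (k : nat) (c : C) (f : C * C -> C) (p q : nat) : hol U f -> theta_flat k f ->
  (p + q < k)%nat -> thetas p q (shift_theta c 1 f) x0 = thetas (S p) q f x0.
Proof. intros hf H hpq. rewrite thetas_shift1, (H p q hpq) by assumption. ring. Qed.

Lemma top_shift2 (k : nat) (c : C) (f : C * C -> C) (p q : nat) : hol U f -> theta_flat k f ->
  (p + q < k)%nat -> thetas p q (shift_theta c 2 f) x0 = thetas p (S q) f x0.
Proof. intros hf H hpq. rewrite thetas_shift2, (H p q hpq) by assumption. ring. Qed.

Lemma top_shift12 (k : nat) (c : C) (f : C * C -> C) (p q : nat) : hol U f -> theta_flat k f ->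
  (p + q < k)%nat -> thetas p q (shift_theta12 c f) x0 = thetas (S p) q f x0 + thetas p (S q) f x0.
Proof. intros hf H hpq. rewrite thetas_shift12, (H p q hpq) by assumption. ring. Qed.

Lemma theta_coord_mult (f : C * C -> C) : hol U f -> forall w, U w ->
  theta 1 (fun z => fst z * f z) w = fst w * shift_theta 1 1 f w /\
  theta 2 (fun z => fst z * f z) w = fst w * theta 2 f w /\
  theta 1 (fun z => snd z * f z) w = snd w * theta 1 f w /\
  theta 2 (fun z => snd z * f z) w = snd w * shift_theta 1 2 f w.
Proof.
  intros hf w hw.
  destruct (theta_mult fst f (hol_fst U) hf w hw) as [-> ->].
  destruct (theta_mult snd f (hol_snd U) hf w hw) as [-> ->].
  destruct (theta_cdiff fst w _ _ (cdiff_fst w)) as [-> ->].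
  destruct (theta_cdiff snd w _ _ (cdiff_snd w)) as [-> ->]. unfold shift_theta.
  repeat split; ring.
Qed.

(** Moving [theta 1] past the factor x_1 turns it into [theta 1 + 1]. The added 1 only yields terms
    of lower order, which flatness removes, so at top order x_1 behaves like a constant. *)
Lemma top_mult_fst (p : nat) : forall k q g, hol U g -> theta_flat k g -> (p + q <= k)%nat ->
  thetas p q (fun z => fst z * g z) x0 = fst x0 * thetas p q g x0.
Proof.
  induction p as [|p IH]; intros k q.
  - intros g hg _ _. clear k. revert g hg. induction q as [|q IH]; intros g hg; [reflexivity|].
    rewrite <- !thetas_theta2. rewrite <- IH by auto using hol_theta2.
    apply thetas_ext; [apply hol_theta2, hol_mult; auto using hol_fst| |exact hx0].
    intros w hw. exact (proj1 (proj2 (theta_coord_mult _ hg w hw))).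
  - intros g hg H hpq. destruct k as [|k]; [lia|].
    rewrite <- thetas_theta1 by (try apply hol_mult; auto using hol_fst).
    rewrite <- (top_shift1 (S k) 1 g p q) by (assumption || lia).
    rewrite <- (IH k) by (auto using hol_shift_theta1 || lia || apply theta_flat_shift; assumption).
    apply thetas_ext; [apply hol_theta1, hol_mult; auto using hol_fst| |exact hx0].
    intros w hw. exact (proj1 (theta_coord_mult _ hg w hw)).
Qed.

Lemma top_mult_snd (q : nat) : forall k p g, hol U g -> theta_flat k g -> (p + q <= k)%nat ->
  thetas p q (fun z => snd z * g z) x0 = snd x0 * thetas p q g x0.
Proof.
  induction q as [|q IH]; intros k p.
  - intros g hg _ _. clear k. revert g hg. induction p as [|p IH]; intros g hg; [reflexivity|].
    rewrite <- !thetas_theta1 by (try apply hol_mult; auto using hol_snd).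
    rewrite <- IH by auto using hol_theta1.
    apply thetas_ext; [apply hol_theta1, hol_mult; auto using hol_snd| |exact hx0].
    intros w hw. exact (proj1 (proj2 (proj2 (theta_coord_mult _ hg w hw)))).
  - intros g hg H hpq. destruct k as [|k]; [lia|].
    rewrite <- thetas_theta2.
    rewrite <- (top_shift2 (S k) 1 g p q) by (assumption || lia).
    rewrite <- (IH k) by (auto using hol_shift_theta2 || lia || apply theta_flat_shift; assumption).
    apply thetas_ext; [apply hol_theta2, hol_mult; auto using hol_snd| |exact hx0].
    intros w hw. exact (proj2 (proj2 (proj2 (theta_coord_mult _ hg w hw)))).
Qed.

(** The operator [(theta_1 + theta_2)^3 theta_1^p theta_2^q], expanded and evaluated at [x0]: the
    principal part of the right sides of the system. *)
Let cubic (p q : nat) (f : C * C -> C) : C :=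
  thetas (3 + p) q f x0 + 3 * thetas (2 + p) (1 + q) f x0 + 3 * thetas (1 + p) (2 + q) f x0
    + thetas p (3 + q) f x0.

(* At the first order [k + 3] at which [f] may fail to be flat, only the principal
   parts of the two equations contribute. *)
Lemma system_top (a : nat -> C) (B : nat -> nat -> C) (f : C * C -> C) (p q k : nat) :
  hol U f -> (forall w, U w -> system_eq a B 1 f w /\ system_eq a B 2 f w) ->
  theta_flat (3 + k) f -> (p + q = k)%nat ->
  thetas (3 + p) q f x0 = fst x0 * cubic p q f /\ thetas p (3 + q) f x0 = snd x0 * cubic p q f.
Proof.
  intros hf hs H hpq.
  set (g1 := shift_theta12 (a 3%nat) f). set (g2 := shift_theta12 (a 2%nat) g1).
  set (g3 := shift_theta12 (a 1%nat) g2).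
  assert (hg1 : hol U g1) by (apply hol_shift_theta12, hf).
  assert (hg2 : hol U g2) by (apply hol_shift_theta12, hg1).
  assert (hg3 : hol U g3) by (apply hol_shift_theta12, hg2).
  assert (G1 : theta_flat (2 + k) g1) by (apply theta_flat_shift; assumption).
  assert (G2 : theta_flat (1 + k) g2) by (apply theta_flat_shift; assumption).
  assert (G3 : theta_flat k g3) by (apply theta_flat_shift; assumption).
  assert (Eg : thetas p q g3 x0 = cubic p q f).
  { unfold g3. rewrite (top_shift12 (1 + k)) by (assumption || lia). unfold g2.
    rewrite !(top_shift12 (2 + k)) by (assumption || lia). unfold g1.
    rewrite !(top_shift12 (3 + k)) by (assumption || lia). unfold cubic. simpl. ring. }
  split.
  - set (f1 := shift_theta (B 1%nat 3%nat - 1) 1 f). set (f2 := shift_theta (B 1%nat 2%nat - 1) 1 f1).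
    set (f3 := shift_theta (B 1%nat 1%nat - 1) 1 f2).
    assert (hf1 : hol U f1) by (apply hol_shift_theta1, hf).
    assert (hf2 : hol U f2) by (apply hol_shift_theta1, hf1).
    assert (hf3 : hol U f3) by (apply hol_shift_theta1, hf2).
    assert (F1 : theta_flat (2 + k) f1) by (apply theta_flat_shift; assumption).
    assert (F2 : theta_flat (1 + k) f2) by (apply theta_flat_shift; assumption).
    rewrite <- Eg, <- (top_mult_fst p k q) by (assumption || lia).
    transitivity (thetas p q f3 x0).
    + unfold f3. rewrite (top_shift1 (1 + k)) by (assumption || lia). unfold f2.
      rewrite (top_shift1 (2 + k)) by (assumption || lia). unfold f1.
      rewrite (top_shift1 (3 + k)) by (assumption || lia). reflexivity.
    + apply thetas_ext; [exact hf3| |exact hx0]. intros w hw. apply (proj1 (hs w hw)).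
  - set (f1 := shift_theta (B 2%nat 3%nat - 1) 2 f). set (f2 := shift_theta (B 2%nat 2%nat - 1) 2 f1).
    set (f3 := shift_theta (B 2%nat 1%nat - 1) 2 f2).
    assert (hf1 : hol U f1) by (apply hol_shift_theta2, hf).
    assert (hf2 : hol U f2) by (apply hol_shift_theta2, hf1).
    assert (hf3 : hol U f3) by (apply hol_shift_theta2, hf2).
    assert (F1 : theta_flat (2 + k) f1) by (apply theta_flat_shift; assumption).
    assert (F2 : theta_flat (1 + k) f2) by (apply theta_flat_shift; assumption).
    rewrite <- Eg, <- (top_mult_snd q k p) by (assumption || lia).
    transitivity (thetas p q f3 x0).
    + unfold f3. rewrite (top_shift2 (1 + k)) by (assumption || lia). unfold f2.
      rewrite (top_shift2 (2 + k)) by (assumption || lia). unfold f1.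
      rewrite (top_shift2 (3 + k)) by (assumption || lia). reflexivity.
    + apply thetas_ext; [exact hf3| |exact hx0]. intros w hw. apply (proj2 (hs w hw)).
Qed.

End Euler.

(** * Solutions are determined by nine Euler derivatives at one point *)

Lemma finite_upper_bound (u : nat -> R) (n : nat) :
  exists M, (0 <= M)%R /\ forall i, (i <= n)%nat -> (u i <= M)%R.
Proof.
  induction n as [|n (M & hM & H)].
  - exists (Rmax 0 (u 0%nat)). split; [apply Rmax_l|]. intros i hi.
    replace i with 0%nat by lia. apply Rmax_r.
  - exists (Rmax M (u (S n))). split; [eapply Rle_trans; [exact hM|apply Rmax_l]|].
    intros i hi. destruct (Nat.eq_dec i (S n)) as [->|hne]; [apply Rmax_r|].
    eapply Rle_trans; [apply H; lia|apply Rmax_l].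
Qed.

(* With the weights [s^p t^q] both equations bound the derivatives of order [N] by
   [(s + t)^3 < 1] times their own weighted maximum. *)
Lemma top_order_contraction (x1 x2 : C) (s t : R) (N : nat) (v : nat -> nat -> C) :
  (0 < s)%R -> (0 < t)%R -> (s + t < 1)%R -> Cmod x1 = (s ^ 3)%R -> Cmod x2 = (t ^ 3)%R ->
  (forall p q, (p + q = N)%nat -> (p < 3)%nat -> (q < 3)%nat -> v p q = 0) ->
  (forall p q, (3 + p + q = N)%nat ->
     let c := v (3 + p)%nat q + 3 * v (2 + p)%nat (1 + q)%nat + 3 * v (1 + p)%nat (2 + q)%nat
              + v p (3 + q)%nat in
     v (3 + p)%nat q = x1 * c /\ v p (3 + q)%nat = x2 * c) ->
  forall p q, (p + q = N)%nat -> v p q = 0.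
Proof.
  intros hs ht hst hx1 hx2 hlow hrec.
  set (W := fun p q => (s ^ p * t ^ q)%R).
  assert (hW : forall p q, (0 < W p q)%R)
    by (intros; apply Rmult_lt_0_compat; apply pow_lt; assumption).
  set (kap := ((s + t) ^ 3)%R).
  assert (hk0 : (0 <= kap)%R) by (apply pow_le; lra).
  assert (hk1 : (kap < 1)%R) by (apply (pow_lt_1_compat (s + t) 3); [lra|lia]).
  destruct (finite_upper_bound (fun p => (Cmod (v p (N - p)%nat) / W p (N - p)%nat)%R) N)
    as (M & hM & HM).
  assert (step : forall M, (0 <= M)%R -> (forall p q, (p + q = N)%nat -> (Cmod (v p q) <= M * W p q)%R) ->
    forall p q, (p + q = N)%nat -> (Cmod (v p q) <= M * kap * W p q)%R).
  { clear M hM HM. intros M hM H.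
    assert (hc : forall p q, (3 + p + q = N)%nat ->
      (Cmod (v (3 + p)%nat q + 3 * v (2 + p)%nat (1 + q)%nat + 3 * v (1 + p)%nat (2 + q)%nat
              + v p (3 + q)%nat) <= M * kap * W p q)%R).
    { intros p q hpq.
      pose proof (H (3 + p)%nat q ltac:(lia)) as e1.
      pose proof (H (2 + p)%nat (1 + q)%nat ltac:(lia)) as e2.
      pose proof (H (1 + p)%nat (2 + q)%nat ltac:(lia)) as e3.
      pose proof (H p (3 + q)%nat ltac:(lia)) as e4.
      eapply Rle_trans; [apply Cmod_triangle|].
      eapply Rle_trans; [apply Rplus_le_compat_r, Cmod_triangle|].
      eapply Rle_trans; [apply Rplus_le_compat_r, Rplus_le_compat_r, Cmod_triangle|].
      rewrite !Cmod_mult, !Cmod_R, (Rabs_pos_eq 3) by lra.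
      (* The coefficients 1, 3, 3, 1 are those of [(s + t)^3], so the four weights add up to
         [kap * W p q]. *)
      replace (M * kap * W p q)%R with (M * W (3 + p)%nat q + 3 * (M * W (2 + p)%nat (1 + q)%nat)
        + 3 * (M * W (1 + p)%nat (2 + q)%nat) + M * W p (3 + q)%nat)%R.
      - lra.
      - unfold W, kap. rewrite !pow_add. ring. }
    intros p q hpq.
    destruct (le_lt_dec 3 p) as [h3|h3].
    - assert (Ep : p = (3 + (p - 3))%nat) by lia. set (p' := (p - 3)%nat) in *.
      rewrite Ep, (proj1 (hrec p' q ltac:(lia))), Cmod_mult, hx1.
      replace (M * kap * W (3 + p')%nat q)%R with (s ^ 3 * (M * kap * W p' q))%R
        by (unfold W; rewrite pow_add; ring).
      apply Rmult_le_compat_l; [apply pow_le; lra|]. apply hc. lia.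
    - destruct (le_lt_dec 3 q) as [h4|h4].
      + assert (Eq : q = (3 + (q - 3))%nat) by lia. set (q' := (q - 3)%nat) in *.
        rewrite Eq, (proj2 (hrec p q' ltac:(lia))), Cmod_mult, hx2.
        replace (M * kap * W p (3 + q')%nat)%R with (t ^ 3 * (M * kap * W p q'))%R
          by (unfold W; rewrite pow_add; ring).
        apply Rmult_le_compat_l; [apply pow_le; lra|]. apply hc. lia.
      + rewrite (hlow p q hpq h3 h4), Cmod_0.
        apply Rmult_le_pos; [apply Rmult_le_pos; assumption|apply Rlt_le, hW]. }
  (* Every pass through the equations improves the bound by [kap]; iteration makes it arbitrarily
     small. *)
  assert (all : forall n p q, (p + q = N)%nat -> (Cmod (v p q) <= M * kap ^ n * W p q)%R).
  { induction n as [|n IH].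
    - intros p q hpq. simpl. rewrite Rmult_1_r. specialize (HM p ltac:(lia)). cbv beta in HM.
      replace (N - p)%nat with q in HM by lia. apply Rle_div_l in HM; [exact HM|apply hW].
    - intros p q hpq. replace (M * kap ^ S n)%R with ((M * kap ^ n) * kap)%R by (simpl; ring).
      apply step; [|exact IH|exact hpq]. apply Rmult_le_pos; [exact hM|apply pow_le; exact hk0]. }
  intros p q hpq. apply Cmod_zero_of_small. intros eps he.
  assert (hQ : (0 <= M * W p q)%R) by (apply Rmult_le_pos; [exact hM|apply Rlt_le, hW]).
  destruct (pow_lt_1_zero kap ltac:(rewrite Rabs_pos_eq; lra) (eps / (M * W p q + 1))%R) as [n Hn].
  { apply Rdiv_lt_0_compat; lra. }
  specialize (Hn n (le_n _)).
  assert (hp : (0 <= kap ^ n)%R) by (apply pow_le; exact hk0).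
  rewrite Rabs_pos_eq in Hn by exact hp. apply Rlt_div_r in Hn; [|lra].
  eapply Rle_trans; [apply (all n p q hpq)|].
  replace (M * kap ^ n * W p q)%R with (kap ^ n * (M * W p q))%R by ring. lra.
Qed.

Lemma cbrt_pow3 (r : R) : (0 < r)%R -> (0 < cbrt r)%R /\ (cbrt r ^ 3 = r)%R.
Proof.
  intros hr. unfold cbrt. destruct (Rlt_dec 0 r) as [_|h]; [|contradiction].
  split; [apply exp_pos|].
  rewrite <- Rpower_pow by apply exp_pos. rewrite Rpower_mult.
  replace (/ 3 * INR 3)%R with 1%R by (simpl; field). apply Rpower_1, hr.
Qed.

Section SolutionSpace.

Variable U : C * C -> Prop.
Hypothesis hU : open2 U.
Hypothesis hpc : path_connected U.
Hypothesis hUD : forall x, U x -> dom_D x /\ dom_X x.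
Variables (a : nat -> C) (B : nat -> nat -> C).

Lemma coords_neq_0 (x : C * C) : U x -> fst x <> 0 /\ snd x <> 0.
Proof.
  intros hx. destruct (hUD x hx) as [_ h]. unfold dom_X in h.
  split; intros E; apply h; rewrite E; ring.
Qed.

(** Off the axes each partial derivative is [/ x_i] times the Euler derivative, so vanishing carries
    over from [thetas] to all partial derivatives. *)
Lemma thetas_zero_flat (x0 : C * C) (hx0 : U x0) (k : nat) : forall f, hol U f ->
  (forall p q, thetas p q f x0 = 0) -> flat k f x0.
Proof.
  induction k as [|k IH]; intros f hf H; [exact I|].
  destruct (hol_theta U hU f hf) as [h1 h2].
  assert (i1 : hol U (fun w => / fst w)).
  { intros w hw. eexists; eexists. apply cdiff_cderiv_comp; [apply cderiv_inv, coords_neq_0, hw|apply cdiff_fst]. }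
  assert (i2 : hol U (fun w => / snd w)).
  { intros w hw. eexists; eexists. apply cdiff_cderiv_comp; [apply cderiv_inv, coords_neq_0, hw|apply cdiff_snd]. }
  split; [apply (H 0%nat 0%nat)|]. split.
  - apply (flat_ext U hU x0 hx0 k (fun w => / fst w * theta 1 f w)); [apply hol_mult; assumption| |].
    + intros w hw. unfold theta; simpl coord. field. apply coords_neq_0, hw.
    + apply (flat_mult U hU x0 hx0); [assumption|assumption|]. apply IH; [exact h1|].
      intros p q. rewrite (thetas_theta1 U hU) by assumption. apply H.
  - apply (flat_ext U hU x0 hx0 k (fun w => / snd w * theta 2 f w)); [apply hol_mult; assumption| |].
    + intros w hw. unfold theta; simpl coord. field. apply coords_neq_0, hw.
    + apply (flat_mult U hU x0 hx0); [assumption|assumption|]. apply IH; [exact h2|].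
      intros p q. rewrite thetas_theta2. apply H.
Qed.

Lemma solution_determined (x0 : C * C) (f : C * C -> C) : U x0 -> is_solution a B U f ->
  (forall p q, (p < 3)%nat -> (q < 3)%nat -> thetas p q f x0 = 0) ->
  forall x, U x -> f x = 0.
Proof.
  intros hx0 [hhol hsys] H. apply holomorphic_on_hol in hhol.
  assert (flatN : forall N, theta_flat x0 N f).
  { induction N as [|N IH]; [intros p q hpq; lia|].
    intros p q hpq. destruct (Nat.eq_dec (p + q) N) as [E|E]; [|apply IH; lia].
    destruct (hUD x0 hx0) as [hD _]. destruct (coords_neq_0 x0 hx0) as [n1 n2].
    destruct (cbrt_pow3 (Cmod (fst x0)) (proj1 (Cmod_gt_0 _) n1)) as [s1 s2].
    destruct (cbrt_pow3 (Cmod (snd x0)) (proj1 (Cmod_gt_0 _) n2)) as [t1 t2].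
    apply (top_order_contraction (fst x0) (snd x0) _ _ N (fun p q => thetas p q f x0) s1 t1 hD
      (eq_sym s2) (eq_sym t2)); [| |exact E].
    - intros; apply H; assumption.
    - intros p' q' hpq' c.
      apply (system_top U hU x0 hx0 a B f p' q' (p' + q')%nat hhol hsys); [|reflexivity].
      replace (3 + (p' + q'))%nat with N by lia. exact IH. }
  apply (identity_theorem U f x0 hU hpc hhol hx0).
  apply (flat_vanishes_near U hU x0 hx0 f hhol). intros k.
  apply thetas_zero_flat; [exact hx0|exact hhol|]. intros p q. apply (flatN (S (p + q))). lia.
Qed.

Lemma shift_theta_ext (c : C) (f g : C * C -> C) : hol U f -> (forall w, U w -> f w = g w) ->
  forall w, U w -> shift_theta c 1 f w = shift_theta c 1 g w /\ shift_theta c 2 f w = shift_theta c 2 g w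
    /\ shift_theta12 c f w = shift_theta12 c g w.
Proof.
  intros hf E w hw. destruct (theta_ext U hU f g hf E w hw) as [e1 e2].
  unfold shift_theta, shift_theta12. rewrite e1, e2, (E w hw). repeat split.
Qed.

Lemma shift_theta_linear (c b : C) (f g : C * C -> C) : hol U f -> hol U g ->
  forall w, U w ->
  shift_theta c 1 (fun z => b * f z + g z) w = b * shift_theta c 1 f w + shift_theta c 1 g w /\
  shift_theta c 2 (fun z => b * f z + g z) w = b * shift_theta c 2 f w + shift_theta c 2 g w /\
  shift_theta12 c (fun z => b * f z + g z) w = b * shift_theta12 c f w + shift_theta12 c g w.
Proof.
  intros hf hg w hw.
  destruct (theta_cdiff (fun z => b * f z + g z) w _ _
    (cdiff_plus _ _ w _ _ _ _ (cdiff_scal b f w _ _ (hol_cdiff U f w hf hw)) (hol_cdiff U g w hg hw))) as [e1 e2].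
  unfold shift_theta, shift_theta12. rewrite e1, e2. unfold theta; simpl coord.
  repeat split; ring.
Qed.

Lemma hol_linear (b : C) (f g : C * C -> C) : hol U f -> hol U g -> hol U (fun z => b * f z + g z).
Proof. intros hf hg. apply hol_plus; [apply hol_mult; [apply hol_const|]|]; assumption. Qed.

Lemma is_solution_linear (b : C) (f g : C * C -> C) :
  is_solution a B U f -> is_solution a B U g -> is_solution a B U (fun z => b * f z + g z).
Proof.
  intros [hf sf] [hg sg]. apply holomorphic_on_hol in hf, hg.
  split; [apply hol_holomorphic_on, hol_linear; assumption|].
  assert (hs1 : forall c f, hol U f -> hol U (shift_theta c 1 f)) by (apply (hol_shift_theta1 U hU)).
  assert (hs2 : forall c f, hol U f -> hol U (shift_theta c 2 f)) by (apply (hol_shift_theta2 U hU)).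
  assert (hs12 : forall c f, hol U f -> hol U (shift_theta12 c f)) by (apply (hol_shift_theta12 U hU)).
  assert (L3 : forall c1 c2 c3 w, U w ->
    shift_theta c1 1 (shift_theta c2 1 (shift_theta c3 1 (fun z => b * f z + g z))) w =
    b * shift_theta c1 1 (shift_theta c2 1 (shift_theta c3 1 f)) w
      + shift_theta c1 1 (shift_theta c2 1 (shift_theta c3 1 g)) w /\
    shift_theta c1 2 (shift_theta c2 2 (shift_theta c3 2 (fun z => b * f z + g z))) w =
    b * shift_theta c1 2 (shift_theta c2 2 (shift_theta c3 2 f)) w
      + shift_theta c1 2 (shift_theta c2 2 (shift_theta c3 2 g)) w /\
    shift_theta12 c1 (shift_theta12 c2 (shift_theta12 c3 (fun z => b * f z + g z))) w =
    b * shift_theta12 c1 (shift_theta12 c2 (shift_theta12 c3 f)) w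
      + shift_theta12 c1 (shift_theta12 c2 (shift_theta12 c3 g)) w).
  { intros c1 c2 c3 w hw. repeat split.
    - rewrite <- (proj1 (shift_theta_linear c1 b _ _ (hs1 c2 _ (hs1 c3 f hf)) (hs1 c2 _ (hs1 c3 g hg)) w hw)).
      apply shift_theta_ext; [auto using hol_linear| |exact hw]. clear w hw. intros w hw.
      rewrite <- (proj1 (shift_theta_linear c2 b _ _ (hs1 c3 f hf) (hs1 c3 g hg) w hw)).
      apply shift_theta_ext; [auto using hol_linear| |exact hw]. clear w hw. intros w hw.
      apply shift_theta_linear; assumption.
    - rewrite <- (proj1 (proj2 (shift_theta_linear c1 b _ _ (hs2 c2 _ (hs2 c3 f hf)) (hs2 c2 _ (hs2 c3 g hg)) w hw))).
      apply shift_theta_ext; [auto using hol_linear| |exact hw]. clear w hw. intros w hw.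
      rewrite <- (proj1 (proj2 (shift_theta_linear c2 b _ _ (hs2 c3 f hf) (hs2 c3 g hg) w hw))).
      apply shift_theta_ext; [auto using hol_linear| |exact hw]. clear w hw. intros w hw.
      apply shift_theta_linear; assumption.
    - rewrite <- (proj2 (proj2 (shift_theta_linear c1 b _ _ (hs12 c2 _ (hs12 c3 f hf)) (hs12 c2 _ (hs12 c3 g hg)) w hw))).
      apply shift_theta_ext; [auto using hol_linear| |exact hw]. clear w hw. intros w hw.
      rewrite <- (proj2 (proj2 (shift_theta_linear c2 b _ _ (hs12 c3 f hf) (hs12 c3 g hg) w hw))).
      apply shift_theta_ext; [auto using hol_linear| |exact hw]. clear w hw. intros w hw.
      apply shift_theta_linear; assumption. }
  intros w hw. destruct (sf w hw) as [f1 f2]. destruct (sg w hw) as [g1 g2]. unfold system_eq in *.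
  split.
  - rewrite (proj1 (L3 _ _ _ w hw)), (proj2 (proj2 (L3 _ _ _ w hw))), f1, g1. ring.
  - rewrite (proj1 (proj2 (L3 _ _ _ w hw))), (proj2 (proj2 (L3 _ _ _ w hw))), f2, g2. ring.
Qed.

End SolutionSpace.

(** * Linear dependence *)

Fixpoint csum (n : nat) (u : nat -> C) : C :=
  match n with
  | O => 0
  | S m => csum m u + u m
  end.

Lemma csum_ext (n : nat) (u v : nat -> C) : (forall i, (i < n)%nat -> u i = v i) -> csum n u = csum n v.
Proof.
  induction n as [|n IH]; intros H; [reflexivity|]. simpl.
  rewrite IH, H; [reflexivity|lia|]. intros; apply H; lia.
Qed.

Lemma csum_linear (n : nat) (b : C) (u v : nat -> C) :
  csum n (fun i => b * u i + v i) = b * csum n u + csum n v.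
Proof. induction n as [|n IH]; simpl; [ring|]. rewrite IH. ring. Qed.

Lemma csum_0 (n : nat) : csum n (fun _ => 0) = 0.
Proof. induction n as [|n IH]; simpl; [reflexivity|]. rewrite IH. ring. Qed.

(** The increasing enumeration of the indices other than the pivot [i0]. *)
Definition skip (i0 i : nat) : nat := if lt_dec i i0 then i else S i.

Lemma csum_skip (i0 n : nat) (u : nat -> C) : (i0 <= n)%nat ->
  csum (S n) u = csum n (fun i => u (skip i0 i)) + u i0.
Proof.
  revert i0. induction n as [|n IH]; intros i0 h.
  - replace i0 with 0%nat by lia. reflexivity.
  - destruct (Nat.eq_dec i0 (S n)) as [->|hne].
    + change (csum (S (S n)) u) with (csum (S n) u + u (S n)). f_equal. apply csum_ext.
      intros i hi. unfold skip. destruct (lt_dec i (S n)); [reflexivity|lia].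
    + change (csum (S (S n)) u) with (csum (S n) u + u (S n)). rewrite (IH i0) by lia.
      simpl. unfold skip at 3. destruct (lt_dec n i0); [lia|]. ring.
Qed.

(** Gaussian elimination for [n + 1] vectors with [n] coordinates: a vector with nonzero last
    coordinate clears that coordinate in the others, to which induction applies. *)
Lemma linear_dependence (n : nat) : forall v : nat -> nat -> C,
  exists c : nat -> C, (exists i, (i <= n)%nat /\ c i <> 0) /\
    forall j, (j < n)%nat -> csum (S n) (fun i => c i * v i j) = 0.
Proof.
  induction n as [|n IH]; intros v.
  - exists (fun _ => RtoC 1). split; [exists 0%nat; split; [lia|apply C1_nz]|]. intros; lia.
  - destruct (excluded_middle_informative (exists i0, (i0 <= S n)%nat /\ v i0 n <> 0))
      as [(i0 & hi0 & hv)|hno].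
    + set (w := fun i j => v (skip i0 i) j - v (skip i0 i) n / v i0 n * v i0 j).
      destruct (IH w) as (c & (i & hi & hci) & Hc).
      (* The total multiple of the pivot vector subtracted from the others; giving the pivot the
         coefficient [- g] restores the relation for [v]. *)
      set (g := csum (S n) (fun i => c i * (v (skip i0 i) n / v i0 n))).
      set (c' := fun k => if Nat.eq_dec k i0 then - g else if lt_dec k i0 then c k else c (k - 1)%nat).
      assert (E : forall i, c' (skip i0 i) = c i).
      { intros k. unfold c', skip. destruct (lt_dec k i0).
        - destruct (Nat.eq_dec k i0); [lia|]. destruct (lt_dec k i0); [reflexivity|lia].
        - destruct (Nat.eq_dec (S k) i0); [lia|]. destruct (lt_dec (S k) i0); [lia|].
          f_equal; lia. }
      assert (E0 : c' i0 = - g) by (unfold c'; destruct (Nat.eq_dec i0 i0); [reflexivity|lia]).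
      exists c'. split.
      * exists (skip i0 i). split; [unfold skip; destruct (lt_dec i i0); lia|]. rewrite E; exact hci.
      * intros j hj. rewrite (csum_skip i0) by lia. rewrite E0.
        assert (X : csum (S n) (fun i => c' (skip i0 i) * v (skip i0 i) j)
          = csum (S n) (fun i => c i * w i j) + v i0 j * g).
        { unfold g. rewrite Cplus_comm, <- csum_linear. apply csum_ext. intros k _. rewrite E.
          unfold w. ring. }
        rewrite X. destruct (Nat.eq_dec j n) as [->|hne].
        -- rewrite (csum_ext _ _ (fun _ => 0)), csum_0; [ring|].
           intros k _. unfold w. field. exact hv.
        -- rewrite Hc by lia. ring.
    + destruct (IH v) as (c & (i & hi & hci) & Hc).
      exists (fun k => if Nat.eq_dec k (S n) then RtoC 0 else c k). split.
      * exists i. split; [lia|]. destruct (Nat.eq_dec i (S n)); [lia|exact hci].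
      * intros j hj. destruct (Nat.eq_dec j n) as [->|hne].
        -- rewrite (csum_ext _ _ (fun _ => 0)); [apply csum_0|].
           intros k hk. destruct (excluded_middle_informative (v k n = 0)) as [->|h]; [ring|].
           exfalso. apply hno. exists k. split; [lia|exact h].
        -- change (csum (S (S n)) ?u) with (csum (S n) u + u (S n)). cbv beta.
           destruct (Nat.eq_dec (S n) (S n)); [|lia].
           rewrite (csum_ext _ _ (fun i => c i * v i j)).
           ++ rewrite Hc by lia. ring.
           ++ intros k hk. destruct (Nat.eq_dec k (S n)); [lia|reflexivity].
Qed.

Lemma is_solution_csum (a : nat -> C) (B : nat -> nat -> C) (U : C * C -> Prop)
  (c : nat -> C) (G : nat -> C * C -> C) (n : nat) :
  open2 U -> (forall i, (i <= n)%nat -> is_solution a B U (G i)) ->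
  is_solution a B U (fun x => csum (S n) (fun i => c i * G i x)).
Proof.
  intros hU.
  assert (ext : forall f g, (forall x, f x = g x) -> is_solution a B U f -> is_solution a B U g).
  { intros f g E. apply functional_extensionality in E. subst g. auto. }
  induction n as [|n IH]; intros H.
  - apply ext with (fun x => (c 0%nat - 1) * G 0%nat x + G 0%nat x); [intros x; simpl; ring|].
    apply is_solution_linear; auto.
  - apply ext with (fun x => c (S n) * G (S n) x + csum (S n) (fun i => c i * G i x)).
    { intros x. change (csum (S (S n)) ?u) with (csum (S n) u + u (S n)). cbv beta. ring. }
    apply is_solution_linear; auto.
Qed.

Lemma nine_solutions_span (a : nat -> C) (B : nat -> nat -> C) (U : C * C -> Prop)
  (x0 : C * C) (G : nat -> C * C -> C) :
  open2 U -> path_connected U -> (forall x, U x -> dom_D x /\ dom_X x) -> U x0 ->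
  (forall i, (i < 9)%nat -> is_solution a B U (G i)) ->
  (forall c : nat -> C, (forall x, U x -> csum 9 (fun i => c i * G i x) = 0) ->
     forall i, (i < 9)%nat -> c i = 0) ->
  forall f, is_solution a B U f ->
  exists c : nat -> C, forall x, U x -> f x = csum 9 (fun i => c i * G i x).
Proof.
  intros hU hpc hUD hx0 hG hind f hf.
  set (H := fun i => if lt_dec i 9 then G i else f).
  (* Ten vectors with nine coordinates: coordinate [j = 3 * p + q] is [theta_1^p theta_2^q] at [x0],
     and vector 9 belongs to [f]. *)
  destruct (linear_dependence 9 (fun i j => thetas (j / 3) (j mod 3) (H i) x0))
    as (c & (i & hi & hci) & Hc).
  assert (hH : forall i, (i <= 9)%nat -> is_solution a B U (H i)).
  { intros k hk. unfold H. destruct (lt_dec k 9); auto. }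
  assert (hHol : forall i, (i <= 9)%nat -> hol U (H i)).
  { intros k hk. apply holomorphic_on_hol, (hH k hk). }
  assert (hsum : forall n p q x, (n <= 10)%nat -> U x ->
    thetas p q (fun x => csum n (fun i => c i * H i x)) x = csum n (fun i => c i * thetas p q (H i) x)
    /\ hol U (fun x => csum n (fun i => c i * H i x))).
  { intros n p q x hn hx. induction n as [|n IH].
    - simpl. split; [|apply hol_const].
      pose proof (thetas_scal U hU p q 0 (fun _ => RtoC 0) (hol_const U 0) x hx) as Z.
      rewrite Cmult_0_l in Z. etransitivity; [|exact Z].
      apply (thetas_ext U hU); [apply hol_const| |exact hx]. intros; simpl; ring.
    - destruct (IH ltac:(lia)) as [e1 e2]. simpl. split.
      + rewrite (thetas_plus U hU p q _ _ e2) by (assumption || (apply hol_mult; [apply hol_const|apply hHol; lia])).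
        rewrite e1, (thetas_scal U hU) by (try assumption; apply hHol; lia). reflexivity.
      + apply hol_plus; [exact e2|]. apply hol_mult; [apply hol_const|apply hHol; lia]. }
  assert (Z : forall x, U x -> csum 10 (fun i => c i * H i x) = 0).
  { apply (solution_determined U hU hpc hUD a B x0); [exact hx0|apply is_solution_csum; assumption|].
    intros p q hp hq. rewrite (proj1 (hsum 10%nat p q x0 (le_n _) hx0)).
    specialize (Hc (3 * p + q)%nat ltac:(lia)).
    replace ((3 * p + q) / 3)%nat with p in Hc.
    2: { apply Nat.div_unique with q; lia. }
    replace ((3 * p + q) mod 3)%nat with q in Hc.
    2: { apply Nat.mod_unique with p; lia. }
    exact Hc. }
  assert (E : forall x, csum 10 (fun i => c i * H i x) = csum 9 (fun i => c i * G i x) + c 9%nat * f x).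
  { intros x. reflexivity. }
  (* Otherwise the relation would involve the nine functions [G i] alone. *)
  assert (h9 : c 9%nat <> 0).
  { intros h9. apply hci. destruct (Nat.eq_dec i 9) as [->|hne]; [exact h9|].
    apply hind; [|lia]. intros x hx. rewrite <- (Z x hx), E, h9. ring. }
  exists (fun i => - c i / c 9%nat). intros x hx. specialize (Z x hx). rewrite E in Z.
  replace (csum 9 (fun i => - c i / c 9%nat * G i x)) with ((- / c 9%nat) * csum 9 (fun i => c i * G i x)).
  - replace (csum 9 (fun i => c i * G i x)) with (- (c 9%nat * f x)).
    + field. exact h9.
    + rewrite <- (Cplus_0_r (- _)), <- Z. ring.
  - rewrite <- (Cplus_0_r (_ * _)), <- (csum_0 9), <- csum_linear. apply csum_ext.
    intros k _. field. exact h9.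
Qed.

(** * Dominated double series *)

Definition Cex (u : nat -> C) : Prop :=
  ex_series (fun n => fst (u n)) /\ ex_series (fun n => snd (u n)).

Lemma geometric_dominated (u : nat -> C) (K rho : R) :
  (0 <= rho < 1)%R -> (forall n, (Cmod (u n) <= K * rho ^ n)%R) ->
  Cex u /\ (Cmod (CSeries u) <= 2 * K / (1 - rho))%R.
Proof.
  intros hr hu.
  assert (hg : is_series (fun n => K * rho ^ n)%R (K * / (1 - rho))%R).
  { apply (is_series_scal_l (K := R_AbsRing) (V := R_NormedModule) K (fun n => rho ^ n)%R).
    apply is_series_geom. rewrite Rabs_pos_eq; lra. }
  assert (X : forall v : nat -> R, (forall n, Rabs (v n) <= Cmod (u n))%R ->
    ex_series v /\ (Rabs (Series v) <= K / (1 - rho))%R).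
  { intros v hv.
    assert (hv' : forall n, (Rabs (v n) <= K * rho ^ n)%R) by (intros n; eapply Rle_trans; [apply hv|apply hu]).
    assert (ha : ex_series (fun n => Rabs (v n))).
    { apply (ex_series_le (K := R_AbsRing) (V := R_CompleteNormedModule) (fun n => Rabs (v n)) (fun n => K * rho ^ n)%R).
      - intros n. change (Rabs (Rabs (v n)) <= K * rho ^ n)%R. rewrite Rabs_Rabsolu. apply hv'.
      - exists (K * / (1 - rho))%R; exact hg. }
    split; [apply ex_series_Rabs, ha|].
    eapply Rle_trans; [apply Series_Rabs, ha|].
    replace (K / (1 - rho))%R with (Series (fun n => K * rho ^ n)%R) by (apply is_series_unique, hg).
    apply Series_le; [|exists (K * / (1 - rho))%R; exact hg].
    intros n. split; [apply Rabs_pos|apply hv']. }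
  destruct (X (fun n => fst (u n)) (fun n => Rabs_fst_le _)) as [e1 b1].
  destruct (X (fun n => snd (u n)) (fun n => Rabs_snd_le _)) as [e2 b2].
  split; [split; assumption|].
  eapply Rle_trans; [apply Cmod_le_components|]. unfold CSeries; simpl. unfold Rdiv in *. lra.
Qed.

Lemma CSeries_ext (u v : nat -> C) : (forall n, u n = v n) -> CSeries u = CSeries v.
Proof.
  intros E. unfold CSeries. apply injective_projections; simpl; apply Series_ext; intros n;
    rewrite E; reflexivity.
Qed.

Lemma Cex_zero : Cex (fun _ => 0) /\ CSeries (fun _ => 0) = 0.
Proof.
  destruct (geometric_dominated (fun _ => 0) 0 0 ltac:(lra)) as [h1 h2].
  { intros n. rewrite Cmod_0. lra. }
  split; [exact h1|]. apply Cmod_eq_0. pose proof (Cmod_ge_0 (CSeries (fun _ => 0))).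
  unfold Rdiv in h2. lra.
Qed.

Lemma CSeries_linear (c : C) (u v : nat -> C) : Cex u -> Cex v ->
  CSeries (fun n => c * u n + v n) = c * CSeries u + CSeries v.
Proof.
  intros [u1 u2] [v1 v2]. destruct c as [x y]. unfold CSeries. apply injective_projections; simpl.
  - rewrite Series_plus, Series_minus, !Series_scal_l; try assumption; try reflexivity;
      try (apply (ex_series_scal (K := R_AbsRing) (V := R_NormedModule)); assumption).
    apply (ex_series_minus (K := R_AbsRing) (V := R_NormedModule));
      apply (ex_series_scal (K := R_AbsRing) (V := R_NormedModule)); assumption.
  - rewrite Series_plus, Series_plus, !Series_scal_l; try assumption; try reflexivity;
      try (apply (ex_series_scal (K := R_AbsRing) (V := R_NormedModule)); assumption).
    apply (ex_series_plus (K := R_AbsRing) (V := R_NormedModule));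
      apply (ex_series_scal (K := R_AbsRing) (V := R_NormedModule)); assumption.
Qed.

Lemma CSeries_incr (u : nat -> C) : Cex u -> CSeries u = u 0%nat + CSeries (fun n => u (S n)).
Proof.
  intros [u1 u2]. unfold CSeries. apply injective_projections; simpl; apply Series_incr_1; assumption.
Qed.

Definition DS (u : nat -> nat -> C) : C := CSeries (fun m => CSeries (fun n => u m n)).

(** Stronger than absolute summability, but easy to preserve: it bounds each row and the sequence of
    row sums by geometric series. *)
Definition dominated (u : nat -> nat -> C) : Prop :=
  exists K rho, (0 <= rho < 1)%R /\ forall m n, (Cmod (u m n) <= K * rho ^ (m + n))%R.

Lemma DS_bound (u : nat -> nat -> C) (K rho : R) : (0 <= rho < 1)%R ->
  (forall m n, (Cmod (u m n) <= K * rho ^ (m + n))%R) ->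
  (forall m, Cex (u m)) /\ Cex (fun m => CSeries (u m)) /\
  (Cmod (DS u) <= 4 * K / ((1 - rho) * (1 - rho)))%R.
Proof.
  intros hr hu.
  assert (row : forall m, Cex (u m) /\ (Cmod (CSeries (u m)) <= 2 * K / (1 - rho) * rho ^ m)%R).
  { intros m. replace (2 * K / (1 - rho) * rho ^ m)%R with (2 * (K * rho ^ m) / (1 - rho))%R by (field; lra).
    apply geometric_dominated; [exact hr|]. intros n. rewrite Rmult_assoc, <- pow_add. apply hu. }
  destruct (geometric_dominated (fun m => CSeries (u m)) _ rho hr (fun m => proj2 (row m))) as [h1 h2].
  split; [intros m; apply row|]. split; [exact h1|].
  replace (4 * K / ((1 - rho) * (1 - rho)))%R with (2 * (2 * K / (1 - rho)) / (1 - rho))%R by (field; lra).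
  exact h2.
Qed.

Lemma DS_ext (u v : nat -> nat -> C) : (forall m n, u m n = v m n) -> DS u = DS v.
Proof. intros E. apply CSeries_ext; intros m. apply CSeries_ext; intros n. apply E. Qed.

Lemma DS_linear (c : C) (u v : nat -> nat -> C) : dominated u -> dominated v ->
  DS (fun m n => c * u m n + v m n) = c * DS u + DS v.
Proof.
  intros (K & r & hr & hu) (K' & r' & hr' & hv).
  destruct (DS_bound u K r hr hu) as (u1 & u2 & _). destruct (DS_bound v K' r' hr' hv) as (v1 & v2 & _).
  unfold DS. etransitivity; [|exact (CSeries_linear c _ _ u2 v2)]. apply CSeries_ext. intros m.
  apply CSeries_linear; auto.
Qed.

Lemma dominated_zero : dominated (fun _ _ => 0).
Proof. exists 0%R, 0%R. split; [lra|]. intros. rewrite Cmod_0. lra. Qed.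

Lemma DS_zero : DS (fun _ _ => 0) = 0.
Proof.
  unfold DS. rewrite (CSeries_ext _ (fun _ => 0)); [apply Cex_zero|]. intros m. apply Cex_zero.
Qed.

Lemma DS_scal (c : C) (u : nat -> nat -> C) : dominated u -> DS (fun m n => c * u m n) = c * DS u.
Proof.
  intros hu. rewrite <- (Cplus_0_r (c * DS u)), <- DS_zero, <- DS_linear by (assumption || apply dominated_zero).
  apply DS_ext. intros; ring.
Qed.

(** Index shift for the factor x_1 in the first equation; the vanishing row is supplied by the
    indicial equation. *)
Lemma DS_shift1 (u : nat -> nat -> C) : dominated u -> (forall n, u 0%nat n = 0) ->
  DS u = DS (fun m n => u (S m) n).
Proof.
  intros (K & r & hr & hu) h0. destruct (DS_bound u K r hr hu) as (_ & u2 & _).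
  unfold DS. etransitivity; [exact (CSeries_incr _ u2)|].
  cbv beta. rewrite (CSeries_ext (u 0%nat) (fun _ => 0)) by exact h0. rewrite (proj2 Cex_zero).
  apply Cplus_0_l.
Qed.

Lemma DS_shift2 (u : nat -> nat -> C) : dominated u -> (forall m, u m 0%nat = 0) ->
  DS u = DS (fun m n => u m (S n)).
Proof.
  intros (K & r & hr & hu) h0. destruct (DS_bound u K r hr hu) as (u1 & _ & _).
  unfold DS. apply CSeries_ext. intros m.
  etransitivity; [exact (CSeries_incr _ (u1 m))|]. rewrite h0. apply Cplus_0_l.
Qed.

Lemma dominated_linear (c : C) (u v : nat -> nat -> C) : dominated u -> dominated v ->
  dominated (fun m n => c * u m n + v m n).
Proof.
  intros (K & r & hr & hu) (K' & r' & hr' & hv).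
  assert (hK : (0 <= K)%R).
  { pose proof (hu 0%nat 0%nat) as X. simpl in X. pose proof (Cmod_ge_0 (u 0%nat 0%nat)). lra. }
  assert (hK' : (0 <= K')%R).
  { pose proof (hv 0%nat 0%nat) as X. simpl in X. pose proof (Cmod_ge_0 (v 0%nat 0%nat)). lra. }
  exists (Cmod c * K + K')%R, (Rmax r r'). split.
  { split; [eapply Rle_trans; [apply hr|apply Rmax_l]|apply Rmax_lub_lt; lra]. }
  intros m n. eapply Rle_trans; [apply Cmod_triangle|]. rewrite Cmod_mult, Rmult_plus_distr_r.
  apply Rplus_le_compat.
  - rewrite Rmult_assoc. apply Rmult_le_compat_l; [apply Cmod_ge_0|].
    eapply Rle_trans; [apply hu|]. apply Rmult_le_compat_l; [exact hK|].
    apply pow_incr. split; [lra|apply Rmax_l].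
  - eapply Rle_trans; [apply hv|]. apply Rmult_le_compat_l; [exact hK'|].
    apply pow_incr. split; [lra|apply Rmax_r].
Qed.

(** * Admissible coefficient families *)

(* The series with coefficients [c] converges geometrically on the polydiscs
   [|x1| <= s^3, |x2| <= t^3] with [s + t < 1], i.e. on the domain [dom_D]. *)
Definition admissible (c : nat -> nat -> C) : Prop :=
  forall s t, (0 < s)%R -> (0 < t)%R -> (s + t < 1)%R ->
    exists K rho, (0 <= rho < 1)%R /\
      forall m n, (Cmod (c m n) * ((s ^ m * t ^ n) ^ 3) <= K * rho ^ (m + n))%R.

(** Bernoulli's inequality [1 + k * eta <= (1 + eta) ^ k] absorbs the linear factor into the ratio
    [rho * (1 + eta)], which is still below 1. *)
Lemma linear_times_geometric (A rho : R) : (0 <= A)%R -> (0 <= rho < 1)%R ->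
  exists K rho', (0 <= K)%R /\ (0 <= rho' < 1)%R /\ forall k, ((A + INR k) * rho ^ k <= K * rho' ^ k)%R.
Proof.
  intros hA hr. set (eta := ((1 - rho) / 2)%R). assert (heta : (0 < eta)%R) by (unfold eta; lra).
  pose proof (Rinv_0_lt_compat _ heta) as hi.
  exists (A + / eta)%R, (rho * (1 + eta))%R. split; [lra|]. split.
  - split; [apply Rmult_le_pos; lra|]. unfold eta. nra.
  - intros k. rewrite Rpow_mult_distr. pose proof (pow_le rho k (proj1 hr)) as hp.
    pose proof (poly k eta heta) as hb. pose proof (pos_INR k) as hk.
    rewrite <- Rmult_assoc, (Rmult_comm (A + / eta)), Rmult_assoc, Rmult_comm.
    apply Rmult_le_compat_l; [exact hp|].
    apply Rle_trans with ((A + / eta) * (1 + INR k * eta))%R.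
    + replace ((A + / eta) * (1 + INR k * eta))%R with (A + INR k + (A * (INR k * eta) + / eta))%R by (field; lra).
      assert (0 <= A * (INR k * eta))%R by (apply Rmult_le_pos; [lra|apply Rmult_le_pos; lra]). lra.
    + apply Rmult_le_compat_l; lra.
Qed.

(** An Euler operator multiplies the coefficients by a polynomial of degree one in the indices, so
    this keeps the family of series stable under all operators of the system. *)
Lemma admissible_mult_linear (c : nat -> nat -> C) (P : nat -> nat -> C) (A : R) : (0 <= A)%R ->
  (forall m n, (Cmod (P m n) <= A + INR (m + n))%R) -> admissible c ->
  admissible (fun m n => P m n * c m n).
Proof.
  intros hA hP hc s t hs ht hst. destruct (hc s t hs ht hst) as (K & rho & hr & H).
  destruct (linear_times_geometric A rho hA hr) as (K' & rho' & hK' & hr' & H').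
  assert (hK : (0 <= K)%R).
  { pose proof (H 0%nat 0%nat) as X. simpl in X. pose proof (Cmod_ge_0 (c 0%nat 0%nat)). lra. }
  exists (K * K')%R, rho'. split; [exact hr'|]. intros m n. rewrite Cmod_mult, Rmult_assoc.
  pose proof (pos_INR (m + n)) as hmn.
  apply Rle_trans with ((A + INR (m + n)) * (K * rho ^ (m + n)))%R.
  - apply Rmult_le_compat; [apply Cmod_ge_0| |apply hP|apply H].
    apply Rmult_le_pos; [apply Cmod_ge_0|]. apply pow_le, Rmult_le_pos; apply pow_le; lra.
  - replace ((A + INR (m + n)) * (K * rho ^ (m + n)))%R with (K * ((A + INR (m + n)) * rho ^ (m + n)))%R by ring.
    rewrite (Rmult_assoc K). apply Rmult_le_compat_l; [exact hK|apply H'].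
Qed.

(** * Exponential series *)

(** The preimage of [dom_D] under the exponential in each coordinate, since the cube root of
    [exp (Re w_i)] is [exp (Re w_i / 3)]. *)
Definition log_dom (w : C * C) : Prop :=
  (exp (fst (fst w) / 3) + exp (fst (snd w) / 3) < 1)%R.

(** With [x_i = Cexp w_i] this is the term [c m n * x_1^(al + m) * x_2^(be + n)], made
    single-valued. *)
Definition Lterm (al be : C) (c : nat -> nat -> C) (w : C * C) (m n : nat) : C :=
  c m n * Cexp ((al + INR m) * fst w + (be + INR n) * snd w).

Definition Lsum (al be : C) (c : nat -> nat -> C) (w : C * C) : C := DS (Lterm al be c w).

Lemma exp_third_pow3 (x : R) (m : nat) : ((exp (x / 3) ^ m) ^ 3 = exp (INR m * x))%R.
Proof.
  rewrite <- pow_mult, <- Rpower_pow by apply exp_pos. unfold Rpower. rewrite ln_exp. f_equal.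
  rewrite mult_INR. simpl. field.
Qed.

Lemma Cmod_Lterm (al be : C) (c : nat -> nat -> C) (w : C * C) (m n : nat) :
  Cmod (Lterm al be c w m n) = (exp (fst (al * fst w + be * snd w)%C) *
    (Cmod (c m n) * ((exp (fst (fst w) / 3) ^ m * exp (fst (snd w) / 3) ^ n) ^ 3)))%R.
Proof.
  unfold Lterm. rewrite Cmod_mult, Cmod_Cexp, Rpow_mult_distr, !exp_third_pow3.
  replace (fst ((al + INR m) * fst w + (be + INR n) * snd w))%C with
    (fst (al * fst w + be * snd w)%C + (INR m * fst (fst w) + INR n * fst (snd w)))%R.
  - rewrite !exp_plus. ring.
  - destruct w as [[w1 w2] [w3 w4]], al, be; simpl. ring.
Qed.

Lemma dominated_Lterm (al be : C) (c : nat -> nat -> C) (w : C * C) :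
  admissible c -> log_dom w -> dominated (Lterm al be c w).
Proof.
  intros hc hw. destruct (hc _ _ (exp_pos _) (exp_pos _) hw) as (K & rho & hr & H).
  exists (exp (fst (al * fst w + be * snd w)%C) * K)%R, rho. split; [exact hr|]. intros m n.
  rewrite Cmod_Lterm, Rmult_assoc. apply Rmult_le_compat_l; [apply Rlt_le, exp_pos|apply H].
Qed.

Lemma index_bound1 (al : C) (m n : nat) : (Cmod (al + INR m) <= Cmod al + INR (m + n))%R.
Proof.
  eapply Rle_trans; [apply Cmod_triangle|]. rewrite Cmod_R, Rabs_pos_eq by apply pos_INR.
  rewrite plus_INR. pose proof (pos_INR n). lra.
Qed.

Lemma index_bound2 (be : C) (m n : nat) : (Cmod (be + INR n) <= Cmod be + INR (m + n))%R.
Proof. rewrite Nat.add_comm. apply index_bound1. Qed.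

Lemma admissible_1 (al : C) (c : nat -> nat -> C) : admissible c ->
  admissible (fun m n => (al + INR m) * c m n).
Proof.
  apply (admissible_mult_linear c (fun m n => al + INR m) (Cmod al) (Cmod_ge_0 _)).
  intros; apply index_bound1.
Qed.

Lemma admissible_2 (be : C) (c : nat -> nat -> C) : admissible c ->
  admissible (fun m n => (be + INR n) * c m n).
Proof.
  apply (admissible_mult_linear c (fun m n => be + INR n) (Cmod be) (Cmod_ge_0 _)).
  intros; apply index_bound2.
Qed.

Lemma admissible_12 (a : C) (c : nat -> nat -> C) : admissible c ->
  admissible (fun m n => (a + INR (m + n)) * c m n).
Proof.
  apply (admissible_mult_linear c (fun m n => a + INR (m + n)) (Cmod a) (Cmod_ge_0 _)).
  intros m n. rewrite <- (Nat.add_0_r (m + n)) at 2. apply index_bound1.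
Qed.

Lemma sq_le_exp (y : R) : (0 <= y)%R -> (y * y <= 4 * exp y)%R.
Proof.
  intros hy. pose proof (exp_ineq1_le (y / 2)) as h.
  replace (exp y) with (exp (y / 2) * exp (y / 2))%R by (rewrite <- exp_plus; f_equal; field). nra.
Qed.

(** Termwise differentiation with an explicit remainder: each term contributes its own value times
    [Cexp u - 1 - u], where [u] is linear in the increment with coefficients growing like [m + n].
    For increments below [d] the geometric decay still dominates, and the remainders sum to a
    multiple of the square of the increment. *)
Lemma Lsum_cdiff (al be : C) (c : nat -> nat -> C) (w : C * C) : admissible c -> log_dom w ->
  is_cdiff (Lsum al be c) w (Lsum al be (fun m n => (al + INR m) * c m n) w)
    (Lsum al be (fun m n => (be + INR n) * c m n) w).
Proof.
  intros hc hw.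
  pose proof (dominated_Lterm al be c w hc hw) as D0.
  pose proof (dominated_Lterm al be _ w (admissible_1 al c hc) hw) as D1.
  pose proof (dominated_Lterm al be _ w (admissible_2 be c hc) hw) as D2.
  pose proof D0 as (K & rho & hr & HK).
  assert (hK : (0 <= K)%R).
  { pose proof (HK 0%nat 0%nat) as X. simpl in X. pose proof (Cmod_ge_0 (Lterm al be c w 0 0)). lra. }
  set (kap := (1 - rho)%R). assert (hkap : (0 < kap)%R) by (unfold kap; lra).
  (* The remainder costs [exp (2 * (A + k) * d)], once for [exp (Cmod u)] and once for
     [y * y <= 4 * exp y]. With this [d] its part depending on [k] is [exp (kap * k / 2)], half of
     the decay [exp (- (kap * k))]; the other half is [r2]. *)
  set (d := (kap / 4)%R). assert (hd0 : (0 < d)%R) by (unfold d; lra).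
  set (A := (Cmod al + Cmod be)%R).
  assert (hA : (0 <= A)%R) by (unfold A; pose proof (Cmod_ge_0 al); pose proof (Cmod_ge_0 be); lra).
  set (r2 := exp (- (kap / 2))).
  assert (hr2 : (0 <= r2 < 1)%R).
  { split; [apply Rlt_le, exp_pos|]. rewrite <- exp_0. apply exp_increasing. lra. }
  set (Q := (8 * K * exp (2 * A * d) / (d * d))%R).
  assert (hQ : (0 <= Q)%R).
  { unfold Q. apply Rdiv_le_0_compat; [|nra]. apply Rmult_le_pos; [lra|apply Rlt_le, exp_pos]. }
  assert (rem : forall h1 h2, (Cmod h1 + Cmod h2 <= d)%R -> forall m n,
    (Cmod (Lterm al be c (shift2 w h1 h2) m n - Lterm al be c w m n
       - h1 * Lterm al be (fun m n => (al + INR m) * c m n) w m n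
       - h2 * Lterm al be (fun m n => (be + INR n) * c m n) w m n)
      <= Q * ((Cmod h1 + Cmod h2) * (Cmod h1 + Cmod h2)) * r2 ^ (m + n))%R).
  { intros h1 h2 hN m n. set (N := (Cmod h1 + Cmod h2)%R) in *.
    pose proof (Cmod_ge_0 h1) as p1. pose proof (Cmod_ge_0 h2) as p2.
    assert (hN0 : (0 <= N)%R) by (unfold N; lra).
    set (u := (al + INR m) * h1 + (be + INR n) * h2).
    replace (Lterm al be c (shift2 w h1 h2) m n - Lterm al be c w m n
       - h1 * Lterm al be (fun m n => (al + INR m) * c m n) w m n
       - h2 * Lterm al be (fun m n => (be + INR n) * c m n) w m n)
      with (Lterm al be c w m n * (Cexp u - 1 - u)).
    2: { unfold Lterm, shift2; simpl fst; simpl snd.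
         replace ((al + INR m) * (fst w + h1) + (be + INR n) * (snd w + h2))
           with (((al + INR m) * fst w + (be + INR n) * snd w) + u) by (unfold u; ring).
         rewrite (Cexp_plus _ u). unfold u. ring. }
    rewrite Cmod_mult.
    set (k := INR (m + n)). assert (hk : (0 <= k)%R) by apply pos_INR.
    assert (hu : (Cmod u <= (A + k) * N)%R).
    { unfold u. eapply Rle_trans; [apply Cmod_triangle|]. rewrite !Cmod_mult.
      pose proof (index_bound1 al m n) as i1. pose proof (index_bound2 be m n) as i2. fold k in i1, i2.
      pose proof (Cmod_ge_0 al). pose proof (Cmod_ge_0 be).
      apply Rle_trans with ((A + k) * Cmod h1 + (A + k) * Cmod h2)%R; [|unfold N; right; ring].
      apply Rplus_le_compat; apply Rmult_le_compat_r; try assumption; unfold A; lra. }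
    assert (Ak : (0 <= A + k)%R) by lra.
    assert (B1 : (Cmod (Lterm al be c w m n) <= K * exp (- (kap * k)))%R).
    { eapply Rle_trans; [apply HK|]. apply Rmult_le_compat_l; [exact hK|].
      replace (exp (- (kap * k))) with (exp (- kap) ^ (m + n))%R.
      - apply pow_incr. split; [lra|]. pose proof (exp_ineq1_le (- kap)). unfold kap in *. lra.
      - rewrite <- Rpower_pow by apply exp_pos. unfold Rpower. rewrite ln_exp. f_equal. fold k. ring. }
    assert (B2 : (Cmod (Cexp u - 1 - u) <= 8 * (N * N) / (d * d) * exp (2 * (A + k) * d))%R).
    { eapply Rle_trans; [apply Cexp_taylor2|]. pose proof (Cmod_ge_0 u) as u0.
      assert (hud : (Cmod u <= (A + k) * d)%R).
      { eapply Rle_trans; [exact hu|]. apply Rmult_le_compat_l; lra. }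
      assert (E1 : (exp (Cmod u) <= exp ((A + k) * d))%R).
      { destruct hud as [h|h]; [apply Rlt_le, exp_increasing, h|rewrite h; lra]. }
      pose proof (sq_le_exp ((A + k) * d) ltac:(apply Rmult_le_pos; lra)) as E2.
      assert (E3 : (Cmod u * Cmod u <= N * N / (d * d) * (4 * exp ((A + k) * d)))%R).
      { apply Rle_trans with (((A + k) * N) * ((A + k) * N))%R.
        { apply Rmult_le_compat; assumption. }
        replace (((A + k) * N) * ((A + k) * N))%R with (N * N / (d * d) * (((A + k) * d) * ((A + k) * d)))%R
          by (field; lra).
        apply Rmult_le_compat_l; [apply Rdiv_le_0_compat; nra|exact E2]. }
      apply Rle_trans with (2 * (N * N / (d * d) * (4 * exp ((A + k) * d))) * exp ((A + k) * d))%R.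
      { apply Rmult_le_compat; [nra|apply Rlt_le, exp_pos| |exact E1]. lra. }
      replace (2 * (A + k) * d)%R with ((A + k) * d + (A + k) * d)%R by ring. rewrite exp_plus.
      right. field. lra. }
    apply Rle_trans with ((K * exp (- (kap * k))) * (8 * (N * N) / (d * d) * exp (2 * (A + k) * d)))%R.
    { apply Rmult_le_compat; auto using Cmod_ge_0. }
    right. replace (r2 ^ (m + n))%R with (exp (- (kap * k)) * exp (2 * k * d))%R.
    - replace (2 * (A + k) * d)%R with (2 * A * d + 2 * k * d)%R by ring. rewrite exp_plus.
      unfold Q. field. lra.
    - unfold r2. rewrite <- (Rpower_pow (m + n)) by apply exp_pos. unfold Rpower. rewrite ln_exp.
      fold k. rewrite <- exp_plus. f_equal. unfold d. field. }
  set (Q2 := (4 * Q / ((1 - r2) * (1 - r2)))%R).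
  assert (hQ2 : (0 <= Q2)%R) by (unfold Q2; apply Rdiv_le_0_compat; [lra|nra]).
  intros eps he. set (del := Rmin (d / 2) (eps / (2 * (Q2 + 1)))).
  exists del. split; [apply Rmin_pos; [lra|apply Rdiv_lt_0_compat; lra]|].
  intros h1 h2 k1 k2.
  pose proof (Rlt_le_trans _ _ _ k1 (Rmin_l _ _)). pose proof (Rlt_le_trans _ _ _ k2 (Rmin_l _ _)).
  pose proof (Rlt_le_trans _ _ _ k1 (Rmin_r _ _)) as q1. pose proof (Rlt_le_trans _ _ _ k2 (Rmin_r _ _)) as q2.
  apply Rlt_div_r in q1; [|lra]. apply Rlt_div_r in q2; [|lra].
  set (N := (Cmod h1 + Cmod h2)%R). assert (hN : (N <= d)%R) by (unfold N; lra).
  assert (hN0 : (0 <= N)%R) by (unfold N; pose proof (Cmod_ge_0 h1); pose proof (Cmod_ge_0 h2); lra).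
  specialize (rem h1 h2 hN). fold N in rem.
  match type of rem with forall m n, (Complex.Cmod (@?y m n) <= _)%R => set (Y := y) in * end.
  destruct (DS_bound Y _ r2 hr2 rem) as (_ & _ & bY).
  assert (DY : dominated Y) by (exists (Q * (N * N))%R, r2; split; assumption).
  assert (E : Lsum al be c (shift2 w h1 h2) = h1 * Lsum al be (fun m n => (al + INR m) * c m n) w
    + (h2 * Lsum al be (fun m n => (be + INR n) * c m n) w + (1 * Lsum al be c w + DS Y))).
  { unfold Lsum.
    rewrite <- (DS_linear 1 _ _ D0 DY).
    rewrite <- (DS_linear h2 _ _ D2 (dominated_linear 1 _ _ D0 DY)).
    rewrite <- (DS_linear h1 _ _ D1 (dominated_linear h2 _ _ D2 (dominated_linear 1 _ _ D0 DY))).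
    apply DS_ext. intros m n. unfold Y. ring. }
  rewrite E.
  match goal with |- (Complex.Cmod ?z <= _)%R => replace z with (DS Y) by ring end.
  eapply Rle_trans; [exact bY|].
  replace (4 * (Q * (N * N)) / ((1 - r2) * (1 - r2)))%R with (Q2 * N * N)%R by (unfold Q2; field; lra).
  apply Rmult_le_compat_r; [exact hN0|]. unfold N. nra.
Qed.

(** * Growth of the hypergeometric coefficients *)

Lemma eventually_geometric (u : nat -> R) (q : R) (N : nat) : (0 < q)%R ->
  (forall n, (N <= n)%nat -> (u (S n) <= q * u n)%R) ->
  exists K, (0 <= K)%R /\ forall n, (u n <= K * q ^ n)%R.
Proof.
  intros hq H. destruct (finite_upper_bound (fun n => (u n / q ^ n)%R) N) as (K & hK & HK).
  assert (B : forall n, (n <= N)%nat -> (u n <= K * q ^ n)%R).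
  { intros n hn. specialize (HK n hn). cbv beta in HK. apply Rle_div_l in HK; [exact HK|apply pow_lt, hq]. }
  exists K. split; [exact hK|]. intros n. destruct (le_lt_dec n N) as [h|h]; [apply B, h|].
  induction n as [|n IH]; [lia|].
  destruct (Nat.eq_dec n N) as [->|hne].
  - eapply Rle_trans; [apply H; lia|]. specialize (B N (le_n _)). simpl. nra.
  - specialize (IH ltac:(lia)). eapply Rle_trans; [apply H; lia|]. simpl. nra.
Qed.

Lemma Cmod_plus_INR_le (a : C) (n : nat) : (Cmod (a + INR n) <= Cmod a + INR n)%R.
Proof.
  eapply Rle_trans; [apply Cmod_triangle|]. rewrite Cmod_R, Rabs_pos_eq by apply pos_INR. lra.
Qed.

Lemma Cmod_plus_INR_ge (a : C) (n : nat) : (INR n - Cmod a <= Cmod (a + INR n))%R.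
Proof.
  pose proof (Cmod_reverse (RtoC (INR n)) a) as X. rewrite Cplus_comm.
  rewrite Cmod_R, Rabs_pos_eq in X by apply pos_INR. exact X.
Qed.

(** The quotient [Cmod (a + n) / (n + 1)] of consecutive values of [Cmod (poch a n) / n!] is
    eventually at most [1 + del]. *)
Lemma poch_upper (a : C) (del : R) : (0 < del)%R ->
  exists K, (0 <= K)%R /\ forall n, (Cmod (poch a n) <= K * (1 + del) ^ n * INR (fact n))%R.
Proof.
  intros hd. pose proof (Cmod_ge_0 a) as ha.
  destruct (nfloor_ex (Cmod a / del)) as [N [_ hN]]; [apply Rdiv_le_0_compat; lra|].
  apply Rlt_div_l in hN; [|exact hd].
  destruct (eventually_geometric (fun n => (Cmod (poch a n) / INR (fact n))%R) (1 + del) N)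
    as (K & hK & HK); [lra| |].
  - intros n hn. apply le_INR in hn. pose proof (INR_fact_lt_0 n) as hf. pose proof (pos_INR n) as hn0.
    rewrite fact_simpl, mult_INR, S_INR. simpl poch. rewrite Cmod_mult.
    replace (Cmod (poch a n) * Cmod (a + INR n) / ((INR n + 1) * INR (fact n)))%R
      with (Cmod (a + INR n) / (INR n + 1) * (Cmod (poch a n) / INR (fact n)))%R by (field; lra).
    apply Rmult_le_compat_r; [apply Rdiv_le_0_compat; [apply Cmod_ge_0|exact hf]|].
    apply Rle_div_l; [lra|]. pose proof (Cmod_plus_INR_le a n). nra.
  - exists K. split; [exact hK|]. intros n. specialize (HK n). cbv beta in HK.
    exact (proj1 (Rle_div_l _ _ _ (INR_fact_lt_0 n)) HK).
Qed.

Lemma poch_neq_0 (b : C) (n : nat) : (forall k, b + INR k <> 0) -> poch b n <> 0.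
Proof.
  intros hb. induction n as [|n IH]; simpl; [apply C1_nz|]. apply Cmult_neq_0; [exact IH|apply hb].
Qed.

Lemma poch_lower (b : C) (del : R) : (0 < del)%R -> (forall n, b + INR n <> 0) ->
  exists K, (0 <= K)%R /\ forall n, (/ Cmod (poch b n) <= K * (1 + del) ^ n / INR (fact n))%R.
Proof.
  intros hd hb. pose proof (Cmod_ge_0 b) as hb0.
  (* The threshold beyond which [n + 1 <= (1 + del) * (n - Cmod b)]. *)
  set (Q := ((1 + (1 + del) * Cmod b) / del)%R).
  assert (hQ : (0 <= Q)%R) by (unfold Q; apply Rdiv_le_0_compat; nra).
  destruct (nfloor_ex Q hQ) as [N [_ hN]].
  destruct (eventually_geometric (fun n => (INR (fact n) / Cmod (poch b n))%R) (1 + del) (S N))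
    as (K & hK & HK); [lra| |].
  - intros n hn. apply le_INR in hn. rewrite S_INR in hn.
    pose proof (INR_fact_lt_0 n) as hf. pose proof (pos_INR n) as hn0.
    rewrite fact_simpl, mult_INR, S_INR. simpl poch. rewrite Cmod_mult.
    pose proof (proj1 (Cmod_gt_0 _) (poch_neq_0 b n hb)) as p1.
    pose proof (proj1 (Cmod_gt_0 _) (hb n)) as p2.
    replace ((INR n + 1) * INR (fact n) / (Cmod (poch b n) * Cmod (b + INR n)))%R
      with ((INR n + 1) / Cmod (b + INR n) * (INR (fact n) / Cmod (poch b n)))%R by (field; lra).
    apply Rmult_le_compat_r; [apply Rdiv_le_0_compat; lra|].
    apply Rle_div_l; [exact p2|]. pose proof (Cmod_plus_INR_ge b n) as g.
    assert (hq : (Q < INR n)%R) by lra. unfold Q in hq. apply Rlt_div_l in hq; [|exact hd]. nra.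
  - exists K. split; [exact hK|]. intros n. specialize (HK n). cbv beta in HK.
    pose proof (INR_fact_lt_0 n) as hf.
    apply (proj1 (Rle_div_r (/ Cmod (poch b n)) (K * (1 + del) ^ n) (INR (fact n)) hf)).
    unfold Rdiv in HK. lra.
Qed.

(** One term of the binomial expansion is at most the whole power. The induction is Pascal's rule
    with denominators cleared. *)
Lemma binomial_term_bound (s t : R) : (0 < s)%R -> (0 < t)%R -> forall N m n, (m + n = N)%nat ->
  (INR (fact (m + n)) * (s ^ m * t ^ n) <= (s + t) ^ (m + n) * (INR (fact m) * INR (fact n)))%R.
Proof.
  intros hs ht. induction N as [|N IH]; intros m n hmn.
  - replace m with 0%nat by lia. replace n with 0%nat by lia. simpl. lra.
  - destruct m as [|m].
    { simpl. pose proof (INR_fact_lt_0 n) as hf.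
      assert (t ^ n <= (s + t) ^ n)%R by (apply pow_incr; lra). nra. }
    destruct n as [|n].
    { rewrite Nat.add_0_r. simpl (t ^ 0)%R. simpl (fact 0). pose proof (INR_fact_lt_0 (S m)) as hf.
      assert (s ^ (S m) <= (s + t) ^ (S m))%R by (apply pow_incr; lra). simpl (INR 1). nra. }
    pose proof (IH m (S n) ltac:(lia)) as H1. pose proof (IH (S m) n ltac:(lia)) as H2.
    replace (S m + n)%nat with (m + S n)%nat in H2 by lia.
    change (S m + S n)%nat with (S (m + S n)). rewrite fact_simpl, mult_INR.
    replace (INR (S (m + S n))) with (INR (S m) + INR (S n))%R
      by (rewrite <- plus_INR; f_equal; lia).
    set (F := INR (fact (m + S n))) in *. set (P := ((s + t) ^ (m + S n))%R) in *.
    change ((s + t) ^ S (m + S n))%R with ((s + t) * P)%R.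
    rewrite (fact_simpl m), (fact_simpl n), !mult_INR in *.
    set (fm := INR (fact m)) in *. set (fn := INR (fact n)) in *.
    pose proof (pos_INR (S m)) as pm. pose proof (pos_INR (S n)) as pn.
    set (a := INR (S m)) in *. set (b := INR (S n)) in *.
    change (s ^ S m)%R with (s * s ^ m)%R in *. change (t ^ S n)%R with (t * t ^ n)%R in *.
    assert (K1 : (a * s * (F * (s ^ m * (t * t ^ n))) <= a * s * (P * (fm * (b * fn))))%R).
    { apply Rmult_le_compat_l; [apply Rmult_le_pos; lra|exact H1]. }
    assert (K2 : (b * t * (F * (s * s ^ m * t ^ n)) <= b * t * (P * (a * fm * fn)))%R).
    { apply Rmult_le_compat_l; [apply Rmult_le_pos; lra|exact H2]. }
    lra.
Qed.

Definition hcoef (a : nat -> C) (B : nat -> nat -> C) (m n : nat) : C :=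
  (poch (a 1%nat) (m + n) * poch (a 2%nat) (m + n) * poch (a 3%nat) (m + n))
  / (poch (B 1%nat 1%nat) m * poch (B 1%nat 2%nat) m * poch (B 1%nat 3%nat) m
     * (poch (B 2%nat 1%nat) n * poch (B 2%nat 2%nat) n * poch (B 2%nat 3%nat) n)).

Lemma prod3_le (x1 x2 x3 y1 y2 y3 : R) : (0 <= x1 <= y1)%R -> (0 <= x2 <= y2)%R -> (0 <= x3 <= y3)%R ->
  (0 <= x1 * x2 * x3 <= y1 * y2 * y3)%R.
Proof.
  intros h1 h2 h3. split; [apply Rmult_le_pos; [apply Rmult_le_pos|]; lra|].
  apply Rmult_le_compat; [apply Rmult_le_pos; lra|lra| |lra]. apply Rmult_le_compat; lra.
Qed.

(** Up to factors [(1 + del)^n] the three numerator symbols are [(m + n)!] and the denominators [m!]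
    and [n!], so the coefficient behaves like the cube of a binomial coefficient. With the weights
    [s^m t^n] the cube is bounded by [(s + t)^(3 * (m + n))], which is where the shape of [dom_D]
    comes from. *)
Lemma hcoef_admissible (a : nat -> C) (B : nat -> nat -> C) :
  (forall i j k, (1 <= i <= 2)%nat -> (1 <= j <= 3)%nat -> B i j + INR k <> 0) ->
  admissible (hcoef a B).
Proof.
  intros hB s t hs ht hst.
  (* Chosen so that [q * q * (s + t) < 1]: one power [q ^ N] arises from the numerators, another
     from [q ^ m * q ^ n] in the denominators. *)
  set (del := ((1 - (s + t)) / 4)%R). assert (hdel : (0 < del)%R) by (unfold del; lra).
  set (q := (1 + del)%R). assert (hq : (0 < q)%R) by (unfold q; lra).
  assert (hqs : (0 <= q * q * (s + t) < 1)%R).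
  { split; [apply Rmult_le_pos; [apply Rmult_le_pos|]; lra|].
    assert (E : (q * q <= 1 + 3 * del)%R) by (unfold q; assert (del <= 1)%R by (unfold del; lra); nra).
    apply Rle_lt_trans with ((1 + 3 * del) * (s + t))%R; [apply Rmult_le_compat_r; lra|].
    unfold del. nra. }
  assert (hU : exists K, (0 <= K)%R /\ forall n,
    (Cmod (poch (a 1%nat) n) * Cmod (poch (a 2%nat) n) * Cmod (poch (a 3%nat) n)
      <= K * (q ^ n * INR (fact n)) ^ 3)%R).
  { destruct (poch_upper (a 1%nat) del hdel) as (K1 & p1 & H1).
    destruct (poch_upper (a 2%nat) del hdel) as (K2 & p2 & H2).
    destruct (poch_upper (a 3%nat) del hdel) as (K3 & p3 & H3).
    exists (K1 * K2 * K3)%R. split; [apply Rmult_le_pos; [apply Rmult_le_pos|]; assumption|]. intros n.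
    eapply Rle_trans; [apply prod3_le; (split; [apply Cmod_ge_0|])|].
    - apply H1.
    - apply H2.
    - apply H3.
    - fold q. right. ring. }
  assert (hL : forall i, (1 <= i <= 2)%nat -> exists K, (0 <= K)%R /\ forall n,
    (/ Cmod (poch (B i 1%nat) n) * / Cmod (poch (B i 2%nat) n) * / Cmod (poch (B i 3%nat) n)
      <= K * (q ^ n / INR (fact n)) ^ 3)%R).
  { intros i hi.
    destruct (poch_lower (B i 1%nat) del hdel) as (K1 & p1 & H1); [intros; apply hB; lia|].
    destruct (poch_lower (B i 2%nat) del hdel) as (K2 & p2 & H2); [intros; apply hB; lia|].
    destruct (poch_lower (B i 3%nat) del hdel) as (K3 & p3 & H3); [intros; apply hB; lia|].
    exists (K1 * K2 * K3)%R. split; [apply Rmult_le_pos; [apply Rmult_le_pos|]; assumption|]. intros n.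
    assert (pos : forall j, (1 <= j <= 3)%nat -> (0 <= / Cmod (poch (B i j) n))%R).
    { intros j hj. apply Rlt_le, Rinv_0_lt_compat, Cmod_gt_0, poch_neq_0. intros; apply hB; lia. }
    eapply Rle_trans; [apply prod3_le; (split; [apply pos; lia|])|].
    - apply H1.
    - apply H2.
    - apply H3.
    - fold q. pose proof (INR_fact_lt_0 n). right. field. lra. }
  destruct hU as (KA & hA & HA). destruct (hL 1%nat ltac:(lia)) as (K1 & h1 & H1).
  destruct (hL 2%nat ltac:(lia)) as (K2 & h2 & H2).
  exists (KA * K1 * K2)%R, ((q * q * (s + t)) ^ 3)%R. split.
  { split; [apply pow_le; lra|]. apply (pow_lt_1_compat (q * q * (s + t)) 3); [lra|lia]. }
  intros m n. set (N := (m + n)%nat) in *.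
  assert (nz1 : forall j, (1 <= j <= 3)%nat -> poch (B 1%nat j) m <> 0).
  { intros j hj. apply poch_neq_0. intros; apply hB; lia. }
  assert (nz2 : forall j, (1 <= j <= 3)%nat -> poch (B 2%nat j) n <> 0).
  { intros j hj. apply poch_neq_0. intros; apply hB; lia. }
  assert (inv_nonneg : forall z : C, z <> 0 -> (0 <= / Cmod z)%R).
  { intros z hz. apply Rlt_le, Rinv_0_lt_compat, Cmod_gt_0, hz. }
  assert (E : Cmod (hcoef a B m n) =
    ((Cmod (poch (a 1%nat) N) * Cmod (poch (a 2%nat) N) * Cmod (poch (a 3%nat) N))
     * (/ Cmod (poch (B 1%nat 1%nat) m) * / Cmod (poch (B 1%nat 2%nat) m) * / Cmod (poch (B 1%nat 3%nat) m))
     * (/ Cmod (poch (B 2%nat 1%nat) n) * / Cmod (poch (B 2%nat 2%nat) n) * / Cmod (poch (B 2%nat 3%nat) n)))%R).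
  { unfold hcoef. rewrite Cmod_div by (repeat apply Cmult_neq_0; (apply nz1 || apply nz2); lia).
    fold N. rewrite !Cmod_mult. field.
    repeat split; apply Rgt_not_eq, Cmod_gt_0; (apply nz1 || apply nz2); lia. }
  rewrite E.
  assert (E2 : (0 <= (Cmod (poch (a 1%nat) N) * Cmod (poch (a 2%nat) N) * Cmod (poch (a 3%nat) N))
     * (/ Cmod (poch (B 1%nat 1%nat) m) * / Cmod (poch (B 1%nat 2%nat) m) * / Cmod (poch (B 1%nat 3%nat) m))
     * (/ Cmod (poch (B 2%nat 1%nat) n) * / Cmod (poch (B 2%nat 2%nat) n) * / Cmod (poch (B 2%nat 3%nat) n))
     <= (KA * (q ^ N * INR (fact N)) ^ 3) * (K1 * (q ^ m / INR (fact m)) ^ 3)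
        * (K2 * (q ^ n / INR (fact n)) ^ 3))%R).
  { apply prod3_le; split; auto;
      repeat apply Rmult_le_pos; try apply Cmod_ge_0; apply inv_nonneg; (apply nz1 || apply nz2); lia. }
  pose proof (INR_fact_lt_0 m) as fm. pose proof (INR_fact_lt_0 n) as fn. pose proof (INR_fact_lt_0 N) as fN.
  assert (hW : (0 <= (s ^ m * t ^ n) ^ 3)%R) by (apply pow_le, Rmult_le_pos; apply pow_le; lra).
  eapply Rle_trans; [apply Rmult_le_compat_r; [exact hW|apply E2]|].
  assert (BB : (INR (fact N) * (s ^ m * t ^ n) / (INR (fact m) * INR (fact n)) <= (s + t) ^ N)%R).
  { apply Rle_div_l; [apply Rmult_lt_0_compat; assumption|].
    apply (binomial_term_bound s t hs ht N); reflexivity. }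
  replace ((KA * (q ^ N * INR (fact N)) ^ 3) * (K1 * (q ^ m / INR (fact m)) ^ 3)
        * (K2 * (q ^ n / INR (fact n)) ^ 3) * (s ^ m * t ^ n) ^ 3)%R
    with (KA * K1 * K2 * ((q ^ N * q ^ N) * (INR (fact N) * (s ^ m * t ^ n) / (INR (fact m) * INR (fact n)))) ^ 3)%R.
  2: { unfold N at 2. rewrite (pow_add q m n). field. lra. }
  apply Rmult_le_compat_l; [apply Rmult_le_pos; [apply Rmult_le_pos|]; assumption|].
  replace (((q * q * (s + t)) ^ 3) ^ N)%R with (((q ^ N * q ^ N) * (s + t) ^ N) ^ 3)%R
    by (rewrite <- !Rpow_mult_distr, <- !pow_mult; f_equal; lia).
  apply pow_incr. split.
  - apply Rmult_le_pos; [apply Rmult_le_pos; apply pow_le; lra|].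
    apply Rdiv_le_0_compat; [|apply Rmult_lt_0_compat; assumption].
    apply Rmult_le_pos; [lra|]. apply Rmult_le_pos; apply pow_le; lra.
  - apply Rmult_le_compat_l; [apply Rmult_le_pos; apply pow_le; lra|exact BB].
Qed.

(** * Branches of the logarithm *)

(** For [Cmod u <= / 12] the Taylor error [6 * Cmod u ^ 2] is at most half of [Cmod u]. The first
    bound shows that 0 is the only small period of [Cexp], the second differentiates logarithms. *)
Lemma Cexp_near_1 (u : C) : (Cmod u <= / 12)%R ->
  (Cmod u <= 2 * Cmod (Cexp u - 1))%R /\
  (Cmod (u - (Cexp u - 1)) <= 24 * (Cmod (Cexp u - 1) * Cmod (Cexp u - 1)))%R.
Proof.
  intros hu. pose proof (Cexp_taylor2 u) as H. pose proof (Cmod_ge_0 u) as u0.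
  pose proof (Cmod_ge_0 (Cexp u - 1)) as r0.
  assert (he : (exp (Cmod u) <= 3)%R).
  { apply Rle_trans with (exp 1); [|apply exp_le_3]. apply Rlt_le, exp_increasing. lra. }
  assert (H6 : (Cmod (u - (Cexp u - 1)) <= 6 * (Cmod u * Cmod u))%R).
  { rewrite Cmod_minus_sym. eapply Rle_trans; [exact H|].
    apply Rle_trans with (2 * (Cmod u * Cmod u) * 3)%R; [|lra].
    apply Rmult_le_compat_l; [nra|exact he]. }
  assert (H2 : (Cmod u <= 2 * Cmod (Cexp u - 1))%R).
  { assert (Cmod u <= Cmod (u - (Cexp u - 1)) + Cmod (Cexp u - 1))%R.
    { replace u with ((u - (Cexp u - 1)) + (Cexp u - 1)) at 1 by ring. apply Cmod_triangle. }
    nra. }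
  split; [exact H2|]. nra.
Qed.

(** Continuity alone makes a logarithm differentiable: it keeps [u = l y - l x] small, and then [u]
    equals [Cexp u - 1 = (f y - f x) / f x] up to a quadratic error. *)
Lemma log_branch_cdiff (l f : C * C -> C) (x : C * C) (A B : C) (V : C * C -> Prop) :
  open2 V -> V x -> (forall y, V y -> Cexp (l y) = f y) ->
  (forall eps, (0 < eps)%R -> exists d, (0 < d)%R /\ forall y, ball2 x d y -> (Cmod (l y - l x) < eps)%R) ->
  is_cdiff f x A B -> is_cdiff l x (A / f x) (B / f x).
Proof.
  intros hV hx hl hc Hf eps he.
  assert (hfx : f x <> 0) by (rewrite <- hl by exact hx; apply Cexp_neq_0).
  set (F := Cmod (f x)). assert (hF : (0 < F)%R) by (apply Cmod_gt_0, hfx).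
  destruct (hV x hx) as (d0 & hd0 & H0).
  destruct (hc (/ 12)%R ltac:(lra)) as (d1 & hd1 & H1).
  destruct (Hf (eps * F / 2)%R) as (d2 & hd2 & H2); [apply Rdiv_lt_0_compat; [apply Rmult_lt_0_compat; assumption|lra]|].
  destruct (cdiff_lip f x A B Hf) as (d3 & hd3 & H3).
  pose proof (Cmod_ge_0 A) as hA. pose proof (Cmod_ge_0 B) as hB.
  set (M := (Cmod A + Cmod B + 1)%R) in *. assert (hM : (0 < M)%R) by (unfold M; lra).
  set (Q := (24 * (M / F * (M / F)))%R).
  assert (hMF : (0 < M / F)%R) by (apply Rdiv_lt_0_compat; lra).
  assert (hQ : (0 < Q)%R) by (unfold Q; nra).
  set (d4 := (eps / (4 * Q))%R). assert (hd4 : (0 < d4)%R) by (apply Rdiv_lt_0_compat; lra).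
  exists (Rmin (Rmin d0 d1) (Rmin (Rmin d2 d3) d4)). split; [repeat apply Rmin_pos; assumption|].
  intros h1 h2 k1 k2.
  pose proof (Rmin_l (Rmin d0 d1) (Rmin (Rmin d2 d3) d4)). pose proof (Rmin_r (Rmin d0 d1) (Rmin (Rmin d2 d3) d4)).
  pose proof (Rmin_l d0 d1). pose proof (Rmin_r d0 d1). pose proof (Rmin_l (Rmin d2 d3) d4).
  pose proof (Rmin_r (Rmin d2 d3) d4). pose proof (Rmin_l d2 d3). pose proof (Rmin_r d2 d3).
  set (y := shift2 x h1 h2).
  assert (hy : V y) by (apply H0, shift2_ball; lra).
  specialize (H1 y ltac:(apply shift2_ball; lra)).
  specialize (H2 h1 h2 ltac:(lra) ltac:(lra)). specialize (H3 h1 h2 ltac:(lra) ltac:(lra)).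
  fold y in H2, H3. set (u := l y - l x) in *.
  assert (Er : Cexp u - 1 = (f y - f x) / f x).
  { unfold u. replace (l y - l x) with (l y + - l x) by ring.
    rewrite Cexp_plus, Cexp_opp, !hl by assumption. field. exact hfx. }
  destruct (Cexp_near_1 u ltac:(lra)) as [_ X]. rewrite Er in X.
  set (N := (Cmod h1 + Cmod h2)%R) in *.
  assert (hN0 : (0 <= N)%R) by (unfold N; pose proof (Cmod_ge_0 h1); pose proof (Cmod_ge_0 h2); lra).
  assert (hr : (Cmod ((f y - f x) / f x) <= M / F * N)%R).
  { rewrite Cmod_div by exact hfx. fold F.
    replace (M / F * N)%R with (M * N / F)%R by (field; lra).
    unfold Rdiv. apply Rmult_le_compat_r; [apply Rlt_le, Rinv_0_lt_compat, hF|exact H3]. }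
  replace (u - A / f x * h1 - B / f x * h2)
    with ((u - (f y - f x) / f x) + (f y - f x - A * h1 - B * h2) / f x) by (field; exact hfx).
  eapply Rle_trans; [apply Cmod_triangle|].
  assert (Y1 : (Cmod ((f y - f x - A * h1 - B * h2) / f x) <= eps / 2 * N)%R).
  { rewrite Cmod_div by exact hfx. fold F. apply Rle_div_l; [exact hF|].
    eapply Rle_trans; [exact H2|]. right. field. }
  assert (Y2 : (Cmod (u - (f y - f x) / f x) <= Q * N * N)%R).
  { eapply Rle_trans; [exact X|].
    replace (Q * N * N)%R with (24 * ((M / F * N) * (M / F * N)))%R by (unfold Q; ring).
    apply Rmult_le_compat_l; [lra|]. apply Rmult_le_compat; auto using Cmod_ge_0. }
  assert (Y3 : (Q * N <= eps / 2)%R).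
  { assert (hN : (N <= 2 * d4)%R) by (unfold N; lra).
    apply Rle_trans with (Q * (2 * d4))%R; [apply Rmult_le_compat_l; lra|].
    unfold d4. right. field. lra. }
  assert (Q * N * N <= eps / 2 * N)%R by (apply Rmult_le_compat_r; assumption).
  lra.
Qed.

Lemma continuous_C2 (l : C * C -> C) (x : C * C) : continuous l x ->
  forall eps, (0 < eps)%R -> exists d, (0 < d)%R /\ forall y, ball2 x d y -> (Cmod (l y - l x) < eps)%R.
Proof.
  intros hl eps he.
  assert (he2 : (0 < eps / 2)%R) by lra.
  destruct (proj1 (filterlim_locally _ _) hl (mkposreal _ he2)) as [d Hd].
  exists d. split; [apply cond_pos|]. intros y hy.
  destruct (Hd y (ball_of_ball2 x y d hy)) as [H1 H2].
  change (Rabs (fst (l y) - fst (l x)) < eps / 2)%R in H1.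
  change (Rabs (snd (l y) - snd (l x)) < eps / 2)%R in H2.
  eapply Rle_lt_trans; [apply Cmod_le_components|].
  change (Rabs (fst (l y) - fst (l x)) + Rabs (snd (l y) - snd (l x)) < eps)%R. lra.
Qed.

(** * Series solutions of the system *)

Section SeriesSolution.

Variable U : C * C -> Prop.
Hypothesis hU : open2 U.
Variables l1 l2 : C * C -> C.
Hypothesis hl1 : forall x, U x -> is_cdiff l1 x (/ fst x) 0.
Hypothesis hl2 : forall x, U x -> is_cdiff l2 x 0 (/ snd x).
Hypothesis he1 : forall x, U x -> Cexp (l1 x) = fst x.
Hypothesis he2 : forall x, U x -> Cexp (l2 x) = snd x.
Hypothesis hdom : forall x, U x -> log_dom (l1 x, l2 x).
Variables al be : C.

Definition Lbranch (c : nat -> nat -> C) (x : C * C) : C := Lsum al be c (l1 x, l2 x).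

Lemma Lbranch_cdiff (c : nat -> nat -> C) (x : C * C) : admissible c -> U x ->
  is_cdiff (Lbranch c) x (Lbranch (fun m n => (al + INR m) * c m n) x / fst x)
    (Lbranch (fun m n => (be + INR n) * c m n) x / snd x).
Proof.
  intros hc hx. eapply cdiff_eq.
  - apply (cdiff_comp (Lsum al be c) l1 l2); [apply Lsum_cdiff; [exact hc|apply hdom, hx]|apply hl1, hx|apply hl2, hx].
  - unfold Lbranch, Cdiv. ring.
  - unfold Lbranch, Cdiv. ring.
Qed.

Lemma Lbranch_hol (c : nat -> nat -> C) : admissible c -> hol U (Lbranch c).
Proof. intros hc x hx. eexists; eexists; apply Lbranch_cdiff; assumption. Qed.

Lemma fst_neq_0 (x : C * C) : U x -> fst x <> 0.
Proof. intros hx. rewrite <- he1 by exact hx. apply Cexp_neq_0. Qed.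

Lemma snd_neq_0 (x : C * C) : U x -> snd x <> 0.
Proof. intros hx. rewrite <- he2 by exact hx. apply Cexp_neq_0. Qed.

Lemma theta_Lbranch (c : nat -> nat -> C) (x : C * C) : admissible c -> U x ->
  theta 1 (Lbranch c) x = Lbranch (fun m n => (al + INR m) * c m n) x /\
  theta 2 (Lbranch c) x = Lbranch (fun m n => (be + INR n) * c m n) x.
Proof.
  intros hc hx. destruct (theta_cdiff _ x _ _ (Lbranch_cdiff c x hc hx)) as [-> ->].
  pose proof (fst_neq_0 x hx). pose proof (snd_neq_0 x hx). split; field; assumption.
Qed.

Lemma Lbranch_linear (b : C) (c d e : nat -> nat -> C) (x : C * C) : admissible c -> admissible d -> U x ->
  (forall m n, e m n = b * c m n + d m n) -> b * Lbranch c x + Lbranch d x = Lbranch e x.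
Proof.
  intros hc hd hx E. unfold Lbranch, Lsum.
  rewrite <- DS_linear by (apply dominated_Lterm; auto).
  apply DS_ext. intros m n. unfold Lterm. rewrite E. ring.
Qed.

Lemma shift_Lbranch1 (b : C) (c : nat -> nat -> C) (x : C * C) : admissible c -> U x ->
  shift_theta b 1 (Lbranch c) x = Lbranch (fun m n => (b + al + INR m) * c m n) x.
Proof.
  intros hc hx. unfold shift_theta. rewrite (proj1 (theta_Lbranch c x hc hx)).
  apply Lbranch_linear; [exact hc|apply admissible_1, hc|exact hx|]. intros; ring.
Qed.

Lemma shift_Lbranch2 (b : C) (c : nat -> nat -> C) (x : C * C) : admissible c -> U x ->
  shift_theta b 2 (Lbranch c) x = Lbranch (fun m n => (b + be + INR n) * c m n) x.
Proof.
  intros hc hx. unfold shift_theta. rewrite (proj2 (theta_Lbranch c x hc hx)).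
  apply Lbranch_linear; [exact hc|apply admissible_2, hc|exact hx|]. intros; ring.
Qed.

Lemma shift_Lbranch12 (b : C) (c : nat -> nat -> C) (x : C * C) : admissible c -> U x ->
  shift_theta12 b (Lbranch c) x = Lbranch (fun m n => (b + al + be + INR (m + n)) * c m n) x.
Proof.
  intros hc hx. unfold shift_theta12. destruct (theta_Lbranch c x hc hx) as [-> ->].
  rewrite (Lbranch_linear b c _ (fun m n => (b + al + INR m) * c m n)); [|exact hc|apply admissible_1, hc|exact hx|intros; ring].
  rewrite <- (Cmult_1_l (Lbranch (fun m n => (b + al + INR m) * c m n) x)).
  apply Lbranch_linear; [apply admissible_1, hc|apply admissible_2, hc|exact hx|].
  intros m n. rewrite plus_INR, RtoC_plus. ring.
Qed.

Variables (a : nat -> C) (B : nat -> nat -> C) (c : nat -> nat -> C).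
Hypothesis hc : admissible c.

(** [P1], [P2] and [Q] are the factors by which the left and right operators of the system act on
    [x_1^(al + m) * x_2^(be + n)]. *)
Let P1 (m : nat) : C := (B 1%nat 1%nat - 1 + al + INR m) * ((B 1%nat 2%nat - 1 + al + INR m) * (B 1%nat 3%nat - 1 + al + INR m)).
Let P2 (n : nat) : C := (B 2%nat 1%nat - 1 + be + INR n) * ((B 2%nat 2%nat - 1 + be + INR n) * (B 2%nat 3%nat - 1 + be + INR n)).
Let Q (k : nat) : C := (a 1%nat + al + be + INR k) * ((a 2%nat + al + be + INR k) * (a 3%nat + al + be + INR k)).

(** The first two hypotheses are the indicial equations for [al] and [be], the others the
    recurrences for the coefficients. *)
Hypothesis hrec1_0 : P1 0 = 0.
Hypothesis hrec2_0 : P2 0 = 0.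
Hypothesis hrec1 : forall m n, P1 (S m) * c (S m) n = Q (m + n) * c m n.
Hypothesis hrec2 : forall m n, P2 (S n) * c m (S n) = Q (m + n) * c m n.

Lemma triple_shift (x : C * C) : U x ->
  shift_theta (B 1%nat 1%nat - 1) 1 (shift_theta (B 1%nat 2%nat - 1) 1 (shift_theta (B 1%nat 3%nat - 1) 1 (Lbranch c))) x
    = Lbranch (fun m n => P1 m * c m n) x /\
  shift_theta (B 2%nat 1%nat - 1) 2 (shift_theta (B 2%nat 2%nat - 1) 2 (shift_theta (B 2%nat 3%nat - 1) 2 (Lbranch c))) x
    = Lbranch (fun m n => P2 n * c m n) x /\
  shift_theta12 (a 1%nat) (shift_theta12 (a 2%nat) (shift_theta12 (a 3%nat) (Lbranch c))) x
    = Lbranch (fun m n => Q (m + n) * c m n) x.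
Proof.
  intros hx.
  assert (hs1 : forall b f, hol U f -> hol U (shift_theta b 1 f)) by (apply (hol_shift_theta1 U hU)).
  assert (hs2 : forall b f, hol U f -> hol U (shift_theta b 2 f)) by (apply (hol_shift_theta2 U hU)).
  assert (hs12 : forall b f, hol U f -> hol U (shift_theta12 b f)) by (apply (hol_shift_theta12 U hU)).
  assert (fin : forall d e, (forall m n, d m n = e m n) -> Lbranch d x = Lbranch e x).
  { intros d e E. unfold Lbranch, Lsum. apply DS_ext. intros m n. unfold Lterm. rewrite E. reflexivity. }
  assert (ad1 : forall b d, admissible d -> admissible (fun m n => (b + al + INR m) * d m n))
    by (intros; apply admissible_1; assumption).
  assert (ad2 : forall b d, admissible d -> admissible (fun m n => (b + be + INR n) * d m n))
    by (intros; apply admissible_2; assumption).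
  assert (ad12 : forall b d, admissible d -> admissible (fun m n => (b + al + be + INR (m + n)) * d m n))
    by (intros; apply admissible_12; assumption).
  pose proof (Lbranch_hol c hc) as hh.
  repeat split.
  - etransitivity; [apply (shift_theta_ext U hU); [auto| |exact hx]|].
    + intros w hw. apply (shift_theta_ext U hU); [auto| |exact hw].
      intros z hz. apply shift_Lbranch1; assumption.
    + etransitivity; [apply (shift_theta_ext U hU); [apply hs1, Lbranch_hol; auto| |exact hx]|].
      * intros w hw. apply shift_Lbranch1; [auto|exact hw].
      * rewrite shift_Lbranch1 by auto. apply fin. intros; unfold P1; ring.
  - etransitivity; [apply (shift_theta_ext U hU); [auto| |exact hx]|].
    + intros w hw. apply (shift_theta_ext U hU); [auto| |exact hw].
      intros z hz. apply shift_Lbranch2; assumption.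
    + etransitivity; [apply (shift_theta_ext U hU); [apply hs2, Lbranch_hol; auto| |exact hx]|].
      * intros w hw. apply shift_Lbranch2; [auto|exact hw].
      * rewrite shift_Lbranch2 by auto. apply fin. intros; unfold P2; ring.
  - etransitivity; [apply (shift_theta_ext U hU); [auto| |exact hx]|].
    + intros w hw. apply (shift_theta_ext U hU); [auto| |exact hw].
      intros z hz. apply shift_Lbranch12; assumption.
    + etransitivity; [apply (shift_theta_ext U hU); [apply hs12, Lbranch_hol; auto| |exact hx]|].
      * intros w hw. apply shift_Lbranch12; [auto|exact hw].
      * rewrite shift_Lbranch12 by auto. apply fin. intros; unfold Q; ring.
Qed.

(** Multiplication by [x_1 = Cexp (l1 x)] raises [m] by one. So both sides of an equation are the
    same series after an index shift, once the first row has vanished by the indicial equation. *)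
Lemma series_solution : is_solution a B U (Lbranch c).
Proof.
  split; [apply hol_holomorphic_on, Lbranch_hol, hc|].
  intros x hx. destruct (triple_shift x hx) as (T1 & T2 & T3). unfold system_eq.
  rewrite T1, T2, T3. simpl coord.
  assert (aP1 : admissible (fun m n => P1 m * c m n)).
  { assert (E : (fun m n => P1 m * c m n) = (fun m n => (B 1%nat 1%nat - 1 + al + INR m) *
      ((B 1%nat 2%nat - 1 + al + INR m) * ((B 1%nat 3%nat - 1 + al + INR m) * c m n)))).
    { do 2 (apply functional_extensionality; intro). unfold P1; ring. }
    rewrite E. repeat apply admissible_1. exact hc. }
  assert (aP2 : admissible (fun m n => P2 n * c m n)).
  { assert (E : (fun m n => P2 n * c m n) = (fun m n => (B 2%nat 1%nat - 1 + be + INR n) *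
      ((B 2%nat 2%nat - 1 + be + INR n) * ((B 2%nat 3%nat - 1 + be + INR n) * c m n)))).
    { do 2 (apply functional_extensionality; intro). unfold P2; ring. }
    rewrite E. repeat apply admissible_2. exact hc. }
  assert (aQ : admissible (fun m n => Q (m + n) * c m n)).
  { assert (E : (fun m n => Q (m + n) * c m n) = (fun m n => (a 1%nat + al + be + INR (m + n)) *
      ((a 2%nat + al + be + INR (m + n)) * ((a 3%nat + al + be + INR (m + n)) * c m n)))).
    { do 2 (apply functional_extensionality; intro). unfold Q; ring. }
    rewrite E. apply admissible_12, admissible_12, admissible_12, hc. }
  pose proof (dominated_Lterm al be _ _ aP1 (hdom x hx)) as D1.
  pose proof (dominated_Lterm al be _ _ aP2 (hdom x hx)) as D2.
  pose proof (dominated_Lterm al be _ _ aQ (hdom x hx)) as DQ.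
  unfold Lbranch, Lsum. split.
  - rewrite <- (he1 x hx), <- (DS_scal _ _ DQ), (DS_shift1 _ D1).
    + apply DS_ext. intros m n. unfold Lterm; simpl fst; simpl snd. rewrite hrec1.
      rewrite S_INR, RtoC_plus.
      replace ((al + (INR m + 1)) * l1 x + (be + INR n) * l2 x)
        with (l1 x + ((al + INR m) * l1 x + (be + INR n) * l2 x)) by ring.
      rewrite Cexp_plus. ring.
    + intros n. unfold Lterm. rewrite hrec1_0. ring.
  - rewrite <- (he2 x hx), <- (DS_scal _ _ DQ), (DS_shift2 _ D2).
    + apply DS_ext. intros m n. unfold Lterm; simpl fst; simpl snd. rewrite hrec2.
      rewrite S_INR, RtoC_plus.
      replace ((al + INR m) * l1 x + (be + (INR n + 1)) * l2 x)
        with (l2 x + ((al + INR m) * l1 x + (be + INR n) * l2 x)) by ring.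
      rewrite Cexp_plus. ring.
    + intros m. unfold Lterm. rewrite hrec2_0. ring.
Qed.

End SeriesSolution.

(** * The shifted parameters *)

(** At [S m] the factors are [b_l + 1 - b_j + m]. The one with [l = j] is [1 + m] and the one with
    [l = 3] is [2 - b_j + m], so the shifted row lists the same numbers with the places [j] and 3
    exchanged. *)
Lemma shifted_row_recurrence (B : nat -> nat -> C) (i j : nat) : B i 3%nat = 1 -> (1 <= j <= 3)%nat ->
  let r := shifted_row B i j in let al := 1 - B i j in
  let P := fun m => (B i 1%nat - 1 + al + INR m) * ((B i 2%nat - 1 + al + INR m) * (B i 3%nat - 1 + al + INR m)) in
  P 0%nat = 0 /\ forall m, P (S m) = (r 1%nat + INR m) * (r 2%nat + INR m) * (r 3%nat + INR m).
Proof.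
  intros h3 hj r al P.
  assert (E : j = 1%nat \/ j = 2%nat \/ j = 3%nat) by lia.
  destruct E as [-> | [-> | ->]]; unfold P, r, al, shifted_row, unit_row; simpl (Nat.eqb _ _); cbv iota;
    (split; [simpl INR; rewrite ?h3; ring|intros m; rewrite S_INR, RtoC_plus, ?h3; ring]).
Qed.

Lemma is_integer_INR (n : nat) : is_integer (INR n).
Proof. exists (Z.of_nat n). rewrite INR_IZR_INZ. reflexivity. Qed.

Lemma is_integer_minus (x y : C) : is_integer x -> is_integer y -> is_integer (x - y).
Proof. intros [m ->] [n ->]. exists (m - n)%Z. rewrite minus_IZR, RtoC_minus. reflexivity. Qed.

Lemma is_integer_eq (x y : C) : is_integer x -> x = y -> is_integer y.
Proof. intros h <-. exact h. Qed.

(** Every entry of the shifted row is 1 or, up to sign and an added integer, one of the three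
    numbers assumed not to be integers. *)
Lemma shifted_row_neq_0 (B : nat -> nat -> C) (i j : nat) : B i 3%nat = 1 -> (1 <= j <= 3)%nat ->
  ~ is_integer (B i 1%nat) -> ~ is_integer (B i 2%nat) -> ~ is_integer (B i 1%nat - B i 2%nat) ->
  forall l k, (1 <= l <= 3)%nat -> shifted_row B i j l + INR k <> 0.
Proof.
  intros h3 hj n1 n2 n12 l k hl E.
  assert (z1 : is_integer 1) by (apply (is_integer_INR 1)).
  assert (z2 : is_integer 2) by (apply (is_integer_INR 2)).
  pose proof (is_integer_INR k) as zk.
  assert (zN : is_integer (- INR k)).
  { apply is_integer_eq with (1 - 1 - INR k); [auto using is_integer_minus|ring]. }
  assert (pk : 1 + INR k <> 0).
  { intros F. apply (f_equal fst) in F. simpl in F. pose proof (pos_INR k). lra. }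
  assert (E' : shifted_row B i j l = - INR k).
  { rewrite <- (Cplus_0_r (shifted_row B i j l)), <- (Cplus_opp_r (INR k)), Cplus_assoc, E. ring. }
  assert (cj : j = 1%nat \/ j = 2%nat \/ j = 3%nat) by lia.
  assert (cl : l = 1%nat \/ l = 2%nat \/ l = 3%nat) by lia.
  unfold shifted_row, unit_row in E'.
  destruct cj as [-> | [-> | ->]]; destruct cl as [-> | [-> | ->]]; simpl (Nat.eqb _ _) in E'; cbv iota in E';
    rewrite ?h3 in E'.
  - apply n1. apply is_integer_eq with (2 - - INR k); [auto using is_integer_minus|]. rewrite <- E'. ring.
  - apply n12. apply is_integer_eq with (1 - - INR k); [auto using is_integer_minus|]. rewrite <- E'. ring.
  - apply pk. replace (INR k : C) with (- - INR k) by ring. rewrite <- E'. ring.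
  - apply n12. apply is_integer_eq with (- INR k - 1); [auto using is_integer_minus|]. rewrite <- E'. ring.
  - apply n2. apply is_integer_eq with (2 - - INR k); [auto using is_integer_minus|]. rewrite <- E'. ring.
  - apply pk. replace (INR k : C) with (- - INR k) by ring. rewrite <- E'. ring.
  - apply n1. apply is_integer_eq with (- INR k); [auto using is_integer_minus|]. rewrite <- E'. ring.
  - apply n2. apply is_integer_eq with (- INR k); [auto using is_integer_minus|]. rewrite <- E'. ring.
  - apply pk. replace (INR k : C) with (- - INR k) by ring. rewrite <- E'. ring.
Qed.

Lemma hcoef_recurrence (a : nat -> C) (B : nat -> nat -> C) (m n : nat) :
  (forall i j k, (1 <= i <= 2)%nat -> (1 <= j <= 3)%nat -> B i j + INR k <> 0) ->
  (B 1%nat 1%nat + INR m) * (B 1%nat 2%nat + INR m) * (B 1%nat 3%nat + INR m) * hcoef a B (S m) n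
    = (a 1%nat + INR (m + n)) * ((a 2%nat + INR (m + n)) * (a 3%nat + INR (m + n))) * hcoef a B m n /\
  (B 2%nat 1%nat + INR n) * (B 2%nat 2%nat + INR n) * (B 2%nat 3%nat + INR n) * hcoef a B m (S n)
    = (a 1%nat + INR (m + n)) * ((a 2%nat + INR (m + n)) * (a 3%nat + INR (m + n))) * hcoef a B m n.
Proof.
  intros hB.
  assert (nz : forall i j k, (1 <= i <= 2)%nat -> (1 <= j <= 3)%nat -> poch (B i j) k <> 0).
  { intros i j k hi hj. apply poch_neq_0. intros; apply hB; assumption. }
  unfold hcoef. split.
  - change (S m + n)%nat with (S (m + n)). simpl poch. field. repeat split; (apply nz || apply hB); lia.
  - rewrite <- plus_n_Sm. simpl poch. field. repeat split; (apply nz || apply hB); lia.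
Qed.

Lemma shifted_a_eq (a : nat -> C) (B : nat -> nat -> C) (j k l : nat) : (1 <= l <= 3)%nat ->
  shifted_a a B j k l = a l + (1 - B 1%nat j) + (1 - B 2%nat k).
Proof.
  intros hl. assert (cl : l = 1%nat \/ l = 2%nat \/ l = 3%nat) by lia.
  unfold shifted_a, unit_row. destruct cl as [-> | [-> | ->]]; simpl (Nat.eqb _ _); cbv iota; ring.
Qed.

Lemma cbrt_exp (x : R) : cbrt (exp x) = exp (x / 3).
Proof.
  unfold cbrt. destruct (Rlt_dec 0 (exp x)) as [_|h]; [|exfalso; apply h, exp_pos].
  unfold Rpower. rewrite ln_exp. f_equal. field.
Qed.

Lemma log_dom_of_dom_D (x : C * C) (u v : C) : Cexp u = fst x -> Cexp v = snd x ->
  dom_D x -> log_dom (u, v).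
Proof.
  intros hu hv h. unfold dom_D in h. rewrite <- hu, <- hv, !Cmod_Cexp, !cbrt_exp in h. exact h.
Qed.

(** * Linear independence *)

(** Averages the tangent inequality of [exp] at the intermediate point. It makes the tube [log_dom]
    convex. *)
Lemma exp_convex (a b t : R) : (0 <= t <= 1)%R ->
  (exp ((1 - t) * a + t * b) <= (1 - t) * exp a + t * exp b)%R.
Proof.
  intros ht. set (c := ((1 - t) * a + t * b)%R).
  assert (T : forall x, (exp c * (1 + (x - c)) <= exp x)%R).
  { intros x. replace (exp x) with (exp c * exp (x - c))%R by (rewrite <- exp_plus; f_equal; ring).
    apply Rmult_le_compat_l; [apply Rlt_le, exp_pos|apply exp_ineq1_le]. }
  pose proof (T a) as Ta. pose proof (T b) as Tb.
  apply Rle_trans with ((1 - t) * (exp c * (1 + (a - c))) + t * (exp c * (1 + (b - c))))%R.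
  - right. unfold c. ring.
  - apply Rplus_le_compat; apply Rmult_le_compat_l; lra.
Qed.

Lemma log_dom_path_connected : path_connected log_dom.
Proof.
  intros x y hx hy.
  set (g := fun t : R => (fst x + RtoC t * (fst y - fst x), snd x + RtoC t * (snd y - snd x))).
  exists g. repeat split.
  - intros t. apply filterlim_locally. intros eps.
    set (N := (Cmod (fst y - fst x) + Cmod (snd y - snd x) + 1)%R).
    pose proof (Cmod_ge_0 (fst y - fst x)). pose proof (Cmod_ge_0 (snd y - snd x)).
    assert (hN : (0 < N)%R) by (unfold N; lra).
    assert (hd : (0 < eps / N)%R) by (apply Rdiv_lt_0_compat; [apply cond_pos|exact hN]).
    exists (mkposreal _ hd). intros s hs. change (Rabs (s - t) < eps / N)%R in hs.
    apply Rlt_div_r in hs; [|exact hN]. pose proof (Rabs_pos (s - t)).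
    apply ball_of_ball2. split; unfold g; simpl fst; simpl snd.
    + replace (fst x + RtoC s * (fst y - fst x) - (fst x + RtoC t * (fst y - fst x)))
        with (RtoC (s - t) * (fst y - fst x)) by (rewrite RtoC_minus; ring).
      rewrite Cmod_mult, Cmod_R. eapply Rle_lt_trans; [|exact hs].
      apply Rmult_le_compat_l; [assumption|unfold N; lra].
    + replace (snd x + RtoC s * (snd y - snd x) - (snd x + RtoC t * (snd y - snd x)))
        with (RtoC (s - t) * (snd y - snd x)) by (rewrite RtoC_minus; ring).
      rewrite Cmod_mult, Cmod_R. eapply Rle_lt_trans; [|exact hs].
      apply Rmult_le_compat_l; [assumption|unfold N; lra].
  - unfold g. destruct x; simpl. f_equal; ring.
  - unfold g. destruct x, y; simpl. f_equal; ring.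
  - intros t ht. unfold log_dom in *. unfold g.
    destruct x as [[x1 x2] [x3 x4]], y as [[y1 y2] [y3 y4]]; simpl in *.
    replace ((x1 + (t * (y1 + - x1) - 0 * (y2 + - x2))) / 3)%R with ((1 - t) * (x1 / 3) + t * (y1 / 3))%R by field.
    replace ((x3 + (t * (y3 + - x3) - 0 * (y4 + - x4))) / 3)%R with ((1 - t) * (x3 / 3) + t * (y3 / 3))%R by field.
    pose proof (exp_convex (x1 / 3) (y1 / 3) t ht). pose proof (exp_convex (x3 / 3) (y3 / 3) t ht).
    destruct (Req_dec t 0) as [->|h0]; [lra|]. nra.
Qed.

Lemma log_dom_open : open2 log_dom.
Proof.
  intros p hp. unfold log_dom in hp.
  set (S := (exp (fst (fst p) / 3) + exp (fst (snd p) / 3))%R) in *.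
  assert (hS : (0 < S)%R) by (unfold S; pose proof (exp_pos (fst (fst p) / 3)); pose proof (exp_pos (fst (snd p) / 3)); lra).
  (* A displacement below [d] multiplies each exponential by less than [exp d = / S], so the sum
     stays below 1. *)
  set (d := (- ln S)%R).
  assert (hd : (0 < d)%R).
  { unfold d. pose proof (ln_increasing S 1 hS hp) as X. rewrite ln_1 in X. lra. }
  exists d. split; [exact hd|]. intros w [h1 h2]. unfold log_dom.
  assert (X : forall a b : C, (Cmod (a - b) < d)%R -> (exp (fst a / 3) < exp (fst b / 3) * exp d)%R).
  { intros a b hab. rewrite <- exp_plus. apply exp_increasing.
    pose proof (Rabs_fst_le (a - b)) as Y. pose proof (Rle_abs (fst (a - b)%C)) as Z.
    change (fst (a - b)%C) with (fst a - fst b)%R in *. lra. }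
  pose proof (X _ _ h1) as X1. pose proof (X _ _ h2) as X2.
  assert (E : (S * exp d = 1)%R).
  { unfold d. rewrite exp_Ropp, exp_ln by exact hS. field. lra. }
  unfold S in E. lra.
Qed.

(** The integer parts of the exponents drop out under periods of [Cexp], so the series is an
    eigenfunction of these translations. This is its monodromy in logarithmic coordinates. *)
Lemma Lsum_translate (al be : C) (c : nat -> nat -> C) (w : C * C) (k1 k2 : C) :
  admissible c -> log_dom w -> Cexp k1 = 1 -> Cexp k2 = 1 ->
  Lsum al be c (shift2 w k1 k2) = Cexp (al * k1 + be * k2) * Lsum al be c w.
Proof.
  intros hc hw e1 e2. unfold Lsum. rewrite <- DS_scal by (apply dominated_Lterm; assumption).
  apply DS_ext. intros m n. unfold Lterm, shift2; simpl fst; simpl snd.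
  replace ((al + INR m) * (fst w + k1) + (be + INR n) * (snd w + k2))
    with (((al + INR m) * fst w + (be + INR n) * snd w) + ((al * k1 + be * k2) + (INR m * k1 + INR n * k2))) by ring.
  rewrite Cexp_plus, (Cexp_plus (al * k1 + be * k2)), (Cexp_plus (INR m * k1)), !Cexp_nat, e1, e2, !Cpow_1_l.
  ring.
Qed.

Definition two_pi_i : C := (0%R, (2 * PI)%R).

Lemma Cexp_two_pi_i : Cexp two_pi_i = 1.
Proof.
  unfold Cexp, two_pi_i; simpl. rewrite exp_0, cos_2PI, sin_2PI.
  apply injective_projections; simpl; ring.
Qed.

Lemma Cexp_two_pi_i_integer (z : C) : Cexp (z * two_pi_i) = 1 -> is_integer z.
Proof.
  destruct z as [x y]. intros E.
  assert (hm : exp (fst ((x, y) * two_pi_i)) = 1%R) by (rewrite <- Cmod_Cexp, E, Cmod_1; reflexivity).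
  pose proof PI_RGT_0 as hpi.
  assert (hy : y = 0%R).
  { rewrite <- exp_0 in hm. apply exp_inv in hm. simpl in hm. nra. }
  subst y. apply (f_equal fst) in E. unfold Cexp in E. simpl in E.
  replace (x * 0 - 0 * (2 * PI))%R with 0%R in E by ring. rewrite exp_0 in E.
  replace (x * (2 * PI) + 0 * 0)%R with (2 * (PI * x))%R in E by ring.
  rewrite cos_2a_sin in E.
  assert (hs : sin (PI * x) = 0%R) by nra.
  destruct (sin_eq_0_0 _ hs) as [k hk]. exists k.
  assert (hx : x = IZR k) by (apply (Rmult_eq_reg_l PI); lra). rewrite hx. reflexivity.
Qed.

Lemma vandermonde3 (q1 q2 q3 s1 s2 s3 : C) : q1 <> q2 -> q1 <> q3 -> q2 <> q3 ->
  s1 + s2 + s3 = 0 -> q1 * s1 + q2 * s2 + q3 * s3 = 0 ->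
  q1 * (q1 * s1) + q2 * (q2 * s2) + q3 * (q3 * s3) = 0 -> s1 = 0 /\ s2 = 0 /\ s3 = 0.
Proof.
  intros h12 h13 h23 e0 e1 e2.
  assert (key : forall a b c x y z, a <> b -> a <> c -> x + y + z = 0 -> a * x + b * y + c * z = 0 ->
    a * (a * x) + b * (b * y) + c * (c * z) = 0 -> x = 0).
  { intros a b c x y z hab hac f0 f1 f2.
    (* The combination of the three relations given by the polynomial [(X - b) * (X - c)], which
       kills the other two terms. *)
    assert (X : (a - b) * (a - c) * x = 0).
    { transitivity ((a * (a * x) + b * (b * y) + c * (c * z)) - (b + c) * (a * x + b * y + c * z)
        + b * c * (x + y + z)); [ring|rewrite f0, f1, f2; ring]. }
    apply NNPP. intros hx. revert X. repeat apply Cmult_neq_0; auto using Cminus_eq_contra. }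
  split; [|split].
  - apply (key q1 q2 q3 s1 s2 s3); auto.
  - apply (key q2 q1 q3 s2 s1 s3); auto.
    + rewrite <- e0; ring.
    + rewrite <- e1; ring.
    + rewrite <- e2; ring.
  - apply (key q3 q1 q2 s3 s1 s2); auto.
    + rewrite <- e0; ring.
    + rewrite <- e1; ring.
    + rewrite <- e2; ring.
Qed.

(** Represents the constant term as a double series, to be subtracted by [DS_linear]. *)
Definition unit00 (m n : nat) : C := match m, n with O, O => 1 | _, _ => 0 end.

Lemma DS_unit00 : dominated unit00 /\ DS unit00 = 1.
Proof.
  assert (hb : forall m n, (Cmod (unit00 m n) <= 1 * 0 ^ (m + n))%R).
  { intros [|m] [|n]; simpl; rewrite ?Cmod_1, ?Cmod_0; lra. }
  destruct (DS_bound unit00 1 0 ltac:(lra) hb) as (r1 & r2 & _).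
  split; [exists 1%R, 0%R; split; [lra|exact hb]|].
  unfold DS. etransitivity; [exact (CSeries_incr _ r2)|]. cbv beta.
  rewrite (CSeries_incr _ (r1 0%nat)).
  change (CSeries (fun n => unit00 0%nat (S n))) with (CSeries (fun _ => RtoC 0)).
  rewrite (CSeries_ext (fun n => CSeries (unit00 (S n))) (fun _ => RtoC 0)) by (intros n; apply Cex_zero).
  rewrite (proj2 Cex_zero). simpl. ring.
Qed.

(* Along [w = (-6 - tau, -6 - tau)] only the constant term survives as [tau] grows. *)
Lemma Lsum_nonzero (al be : C) (c : nat -> nat -> C) : admissible c -> c 0%nat 0%nat = 1 ->
  exists w, log_dom w /\ Lsum al be c w <> 0.
Proof.
  intros hc h00.
  (* From -6 on, both exponentials are at most [exp (- 2) < / 2]. *)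
  assert (hdom : forall tau, (0 <= tau)%R -> log_dom (RtoC (- 6 - tau), RtoC (- 6 - tau))).
  { intros tau ht. unfold log_dom; simpl.
    assert (X : (exp ((- 6 - tau) / 3) <= exp (- (2)))%R).
    { destruct (Req_dec tau 0) as [->|h]; [right; f_equal; field|apply Rlt_le, exp_increasing; lra]. }
    assert (Y : (exp (- (2)) < / 2)%R).
    { rewrite exp_Ropp. pose proof (exp_ineq1_le 2). apply Rinv_lt_contravar; lra. }
    lra. }
  destruct (dominated_Lterm 0 0 c _ hc (hdom 0%R ltac:(lra))) as (K & rho & hr & HK).
  assert (hK : (0 <= K)%R).
  { pose proof (HK 0%nat 0%nat) as X. rewrite Rmult_1_r in X. eapply Rle_trans; [apply Cmod_ge_0|exact X]. }
  (* [T] is the bound of [DS_bound] at [tau = 0], and [tau] is now set to [T] itself. The terms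
     other than the constant one gain at least [exp (- T)], so their sum is at most
     [T * exp (- T) < 1]. *)
  set (T := (4 * K / ((1 - rho) * (1 - rho)))%R).
  assert (hT : (0 <= T)%R) by (unfold T; apply Rdiv_le_0_compat; nra).
  set (w := (RtoC (- 6 - T), RtoC (- 6 - T))).
  assert (hw : log_dom w) by (apply hdom; exact hT).
  exists w. split; [exact hw|].
  set (v := Lterm 0 0 c w).
  assert (Dv : dominated v) by (apply dominated_Lterm; assumption).
  assert (E : Lsum al be c w = Cexp (al * fst w + be * snd w) * DS v).
  { unfold Lsum. rewrite <- DS_scal by exact Dv. apply DS_ext. intros m n. unfold v, Lterm.
    replace ((al + INR m) * fst w + (be + INR n) * snd w)
      with ((al * fst w + be * snd w) + ((0 + INR m) * fst w + (0 + INR n) * snd w)) by ring.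
    rewrite Cexp_plus. ring. }
  rewrite E. apply Cmult_neq_0; [apply Cexp_neq_0|]. intros Z.
  assert (hv : forall m n, (Cmod ((- (1)) * unit00 m n + v m n) <= K * exp (- T) * rho ^ (m + n))%R).
  { intros m n.
    destruct (Nat.eq_dec (m + n) 0) as [e|e].
    - assert (m = 0%nat) by lia. assert (n = 0%nat) by lia. subst m n.
      unfold v, Lterm, unit00. rewrite h00. simpl INR.
      replace ((0 + 0) * fst w + (0 + 0) * snd w) with (RtoC 0) by ring. rewrite Cexp_0.
      replace (- (1) * 1 + 1 * 1) with (RtoC 0) by ring. rewrite Cmod_0.
      apply Rmult_le_pos; [apply Rmult_le_pos; [exact hK|apply Rlt_le, exp_pos]|apply pow_le; lra].
    - replace (- (1) * unit00 m n + v m n) with (v m n) by (destruct m, n; simpl in *; [lia|ring|ring|ring]).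
      replace (v m n) with (RtoC (exp (- T * INR (m + n))) * Lterm 0 0 c (RtoC (- 6 - 0), RtoC (- 6 - 0)) m n).
      + rewrite Cmod_mult, Cmod_R, Rabs_pos_eq by apply Rlt_le, exp_pos.
        replace (K * exp (- T) * rho ^ (m + n))%R with (exp (- T) * (K * rho ^ (m + n)))%R by ring.
        apply Rmult_le_compat; [apply Rlt_le, exp_pos|apply Cmod_ge_0| |apply HK].
        assert (h1 : (1 <= INR (m + n))%R) by (apply (le_INR 1); lia).
        assert (h2 : (- T * INR (m + n) <= - T)%R) by nra.
        destruct h2 as [h2|h2]; [apply Rlt_le, exp_increasing, h2|rewrite h2; lra].
      + unfold v, Lterm, w; simpl fst; simpl snd.
        replace (RtoC (exp (- T * INR (m + n)))) with (Cexp (RtoC (- T * INR (m + n)))).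
        2: { unfold Cexp; simpl. rewrite cos_0, sin_0. apply injective_projections; simpl; ring. }
        replace ((0 + INR m) * RtoC (- 6 - T) + (0 + INR n) * RtoC (- 6 - T))
          with (RtoC (- T * INR (m + n)) + ((0 + INR m) * RtoC (- 6 - 0) + (0 + INR n) * RtoC (- 6 - 0))).
        2: { rewrite plus_INR. rewrite ?RtoC_mult, ?RtoC_plus, ?RtoC_minus, ?RtoC_opp. ring. }
        rewrite (Cexp_plus (RtoC (- T * INR (m + n)))).  ring. }
  destruct DS_unit00 as [D1 E1].
  pose proof (DS_linear (- (1)) unit00 v D1 Dv) as L. rewrite E1, Z in L.
  destruct (DS_bound _ _ rho hr hv) as (_ & _ & bd). rewrite L in bd.
  replace (- (1) * 1 + 0) with (- (1)) in bd by ring. rewrite Cmod_opp, Cmod_1 in bd.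
  replace (4 * (K * exp (- T)) / ((1 - rho) * (1 - rho)))%R with (T * exp (- T))%R in bd
    by (unfold T; field; lra).
  pose proof (exp_ineq1_le T) as X. pose proof (exp_pos T) as Y.
  rewrite exp_Ropp in bd. apply (Rmult_le_compat_r (exp T)) in bd; [|lra].
  rewrite Rmult_assoc, Rinv_l in bd by lra. lra.
Qed.

Definition sum3 (u : nat -> C) : C := u 1%nat + u 2%nat + u 3%nat.

(** The translation of the first coordinate has eigenvalues depending only on [j] and separates the
    rows; that of the second then separates [k]. The point at which the remaining series is nonzero
    may depend on [j] and [k]. *)
Lemma exponential_independence (al be : nat -> C) (cf : nat -> nat -> nat -> nat -> C) (d : nat -> nat -> C) :
  (forall i j, (1 <= i <= 3)%nat -> (1 <= j <= 3)%nat -> i <> j ->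
     ~ is_integer (al i - al j) /\ ~ is_integer (be i - be j)) ->
  (forall j k, (1 <= j <= 3)%nat -> (1 <= k <= 3)%nat -> admissible (cf j k) /\ cf j k 0%nat 0%nat = 1) ->
  (forall w, log_dom w -> sum3 (fun j => sum3 (fun k => d j k * Lsum (al j) (be k) (cf j k) w)) = 0) ->
  forall j k, (1 <= j <= 3)%nat -> (1 <= k <= 3)%nat -> d j k = 0.
Proof.
  intros hdist hcf H.
  set (L := fun j k => Lsum (al j) (be k) (cf j k)).
  set (s1 := fun w => shift2 w two_pi_i 0). set (s2 := fun w => shift2 w 0 two_pi_i).
  assert (hs1 : forall w, log_dom w -> log_dom (s1 w)).
  { intros w hw. unfold log_dom, s1, shift2, two_pi_i in *; simpl. rewrite !Rplus_0_r. exact hw. }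
  assert (hs2 : forall w, log_dom w -> log_dom (s2 w)).
  { intros w hw. unfold log_dom, s2, shift2, two_pi_i in *; simpl. rewrite !Rplus_0_r. exact hw. }
  set (q := fun j => Cexp (al j * two_pi_i)). set (r := fun k => Cexp (be k * two_pi_i)).
  assert (L1 : forall j k w, (1 <= j <= 3)%nat -> (1 <= k <= 3)%nat -> log_dom w -> L j k (s1 w) = q j * L j k w).
  { intros j k w hj hk hw. unfold L, s1, q. rewrite Lsum_translate; [|apply hcf; assumption|exact hw|apply Cexp_two_pi_i|apply Cexp_0].
    f_equal. f_equal. ring. }
  assert (L2 : forall j k w, (1 <= j <= 3)%nat -> (1 <= k <= 3)%nat -> log_dom w -> L j k (s2 w) = r k * L j k w).
  { intros j k w hj hk hw. unfold L, s2, r. rewrite Lsum_translate; [|apply hcf; assumption|exact hw|apply Cexp_0|apply Cexp_two_pi_i].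
    f_equal. f_equal. ring. }
  assert (dq : forall x y, ~ is_integer (x - y) -> Cexp (x * two_pi_i) <> Cexp (y * two_pi_i)).
  { intros x y h E. apply h, Cexp_two_pi_i_integer.
    replace ((x - y) * two_pi_i) with (x * two_pi_i + - (y * two_pi_i)) by ring.
    rewrite Cexp_plus, Cexp_opp, E. field. apply Cexp_neq_0. }
  assert (hq : forall i j, (1 <= i <= 3)%nat -> (1 <= j <= 3)%nat -> i <> j -> q i <> q j /\ r i <> r j).
  { intros i j hi hj hne. destruct (hdist i j hi hj hne). split; apply dq; assumption. }
  assert (sep1 : forall w, log_dom w -> forall j, (1 <= j <= 3)%nat -> sum3 (fun k => d j k * L j k w) = 0).
  { intros w hw.
    pose proof (H w hw) as e0. pose proof (H _ (hs1 w hw)) as e1. pose proof (H _ (hs1 _ (hs1 w hw))) as e2.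
    unfold sum3 in *. fold (L 1%nat 1%nat) (L 1%nat 2%nat) (L 1%nat 3%nat) (L 2%nat 1%nat) (L 2%nat 2%nat)
      (L 2%nat 3%nat) (L 3%nat 1%nat) (L 3%nat 2%nat) (L 3%nat 3%nat) in e0, e1, e2.
    rewrite !L1 in e1 by (lia || auto). rewrite !L1 in e2 by (lia || auto).
    destruct (vandermonde3 (q 1%nat) (q 2%nat) (q 3%nat)
      (d 1%nat 1%nat * L 1%nat 1%nat w + d 1%nat 2%nat * L 1%nat 2%nat w + d 1%nat 3%nat * L 1%nat 3%nat w)
      (d 2%nat 1%nat * L 2%nat 1%nat w + d 2%nat 2%nat * L 2%nat 2%nat w + d 2%nat 3%nat * L 2%nat 3%nat w)
      (d 3%nat 1%nat * L 3%nat 1%nat w + d 3%nat 2%nat * L 3%nat 2%nat w + d 3%nat 3%nat * L 3%nat 3%nat w))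
      as (z1 & z2 & z3); try (apply hq; lia).
    - exact e0.
    - rewrite <- e1. ring.
    - rewrite <- e2. ring.
    - intros j hj. assert (cj : j = 1%nat \/ j = 2%nat \/ j = 3%nat) by lia.
      destruct cj as [-> | [-> | ->]]; assumption. }
  intros j k hj hk. destruct (hcf j k hj hk) as [hc h00].
  destruct (Lsum_nonzero (al j) (be k) (cf j k) hc h00) as (w & hw & hn).
  assert (sep2 : d j k * L j k w = 0).
  { pose proof (sep1 w hw j hj) as e0. pose proof (sep1 _ (hs2 w hw) j hj) as e1.
    pose proof (sep1 _ (hs2 _ (hs2 w hw)) j hj) as e2. unfold sum3 in *.
    rewrite !L2 in e1 by (lia || auto). rewrite !L2 in e2 by (lia || auto).
    destruct (vandermonde3 (r 1%nat) (r 2%nat) (r 3%nat)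
      (d j 1%nat * L j 1%nat w) (d j 2%nat * L j 2%nat w) (d j 3%nat * L j 3%nat w))
      as (z1 & z2 & z3); try (apply hq; lia).
    - exact e0.
    - rewrite <- e1. ring.
    - rewrite <- e2. ring.
    - assert (ck : k = 1%nat \/ k = 2%nat \/ k = 3%nat) by lia.
      destruct ck as [-> | [-> | ->]]; assumption. }
  apply NNPP. intros hd. revert sep2. apply Cmult_neq_0; assumption.
Qed.

(** * The functions F_jk as a fundamental system *)

Lemma is_solution_ext (a : nat -> C) (B : nat -> nat -> C) (U : C * C -> Prop) (f g : C * C -> C) :
  open2 U -> (forall x, U x -> f x = g x) -> is_solution a B U f -> is_solution a B U g.
Proof.
  intros hU E [hf hs]. apply holomorphic_on_hol in hf.
  split; [apply hol_holomorphic_on, (hol_ext U f g hU E hf)|].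
  assert (hs1 : forall b f, hol U f -> hol U (shift_theta b 1 f)) by (apply (hol_shift_theta1 U hU)).
  assert (hs2 : forall b f, hol U f -> hol U (shift_theta b 2 f)) by (apply (hol_shift_theta2 U hU)).
  assert (hs12 : forall b f, hol U f -> hol U (shift_theta12 b f)) by (apply (hol_shift_theta12 U hU)).
  assert (E12 : forall x, U x ->
    shift_theta12 (a 1%nat) (shift_theta12 (a 2%nat) (shift_theta12 (a 3%nat) f)) x =
    shift_theta12 (a 1%nat) (shift_theta12 (a 2%nat) (shift_theta12 (a 3%nat) g)) x).
  { intros x hx. do 3 (apply (shift_theta_ext U hU); [auto| |assumption]; clear x hx; intros x hx).
    apply E, hx. }
  intros x hx. destruct (hs x hx) as [s1 s2]. unfold system_eq in *.
  rewrite <- E12 by exact hx. rewrite <- s1, <- s2. split; symmetry.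
  (* Each round clears [s1] and [s2]; the two trivial facts restore these names so that the next
     round can clear them again. *)
  - do 3 (apply (shift_theta_ext U hU); [auto| |assumption]; clear x hx s1 s2; intros x hx;
      pose proof I as s1; pose proof I as s2). apply E, hx.
  - do 3 (apply (shift_theta_ext U hU); [auto| |assumption]; clear x hx s1 s2; intros x hx;
      pose proof I as s1; pose proof I as s2). apply E, hx.
Qed.

Lemma lin_comb_expand (c : nat -> nat -> C) (G : nat -> nat -> C * C -> C) (x : C * C) :
  lin_comb c G x = csum 9 (fun i => c (1 + i / 3)%nat (1 + i mod 3)%nat * G (1 + i / 3)%nat (1 + i mod 3)%nat x).
Proof.
  assert (E : forall u : nat -> C, sum_n_m u 1 3 = u 1%nat + u 2%nat + u 3%nat).
  { intros u. rewrite !sum_n_Sm, sum_n_m_zero by lia.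
    change (0 + u 1%nat + u 2%nat + u 3%nat = u 1%nat + u 2%nat + u 3%nat). ring. }
  unfold lin_comb. rewrite !E. simpl. ring.
Qed.

Section Branches.

Variables (a : nat -> C) (B : nat -> nat -> C) (U : C * C -> Prop).
Hypothesis hU : open2 U.
Hypothesis hpc : path_connected U.
Hypothesis hUD : forall x, U x -> dom_D x /\ dom_X x.
Hypothesis hB3 : B 1%nat 3%nat = 1 /\ B 2%nat 3%nat = 1.
Hypothesis hB : forall i, (1 <= i <= 2)%nat ->
  ~ is_integer (B i 1%nat) /\ ~ is_integer (B i 2%nat) /\ ~ is_integer (B i 1%nat - B i 2%nat).
(** One logarithm for each index, because [power_branch] allows each power its own. *)
Variables (l1 l2 : nat -> C * C -> C) (p1 p2 : nat -> C * C -> C).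
Hypothesis hc1 : forall j, (1 <= j <= 3)%nat -> forall x, U x -> continuous (l1 j) x.
Hypothesis hc2 : forall k, (1 <= k <= 3)%nat -> forall x, U x -> continuous (l2 k) x.
Hypothesis he1 : forall j, (1 <= j <= 3)%nat -> forall x, U x -> Cexp (l1 j x) = fst x.
Hypothesis he2 : forall k, (1 <= k <= 3)%nat -> forall x, U x -> Cexp (l2 k x) = snd x.
Hypothesis hp1 : forall j, (1 <= j <= 3)%nat -> forall x, U x -> p1 j x = Cexp ((1 - B 1%nat j) * l1 j x).
Hypothesis hp2 : forall k, (1 <= k <= 3)%nat -> forall x, U x -> p2 k x = Cexp ((1 - B 2%nat k) * l2 k x).

Let al (j : nat) : C := 1 - B 1%nat j.
Let be (k : nat) : C := 1 - B 2%nat k.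
Let rowsjk (j k : nat) := rows (shifted_row B 1 j) (shifted_row B 2 k).
Let cf (j k : nat) := hcoef (shifted_a a B j k) (rowsjk j k).

Lemma rowsjk_neq_0 (j k : nat) : (1 <= j <= 3)%nat -> (1 <= k <= 3)%nat ->
  forall i l n, (1 <= i <= 2)%nat -> (1 <= l <= 3)%nat -> rowsjk j k i l + INR n <> 0.
Proof.
  intros hj hk i l n hi hl. assert (ci : i = 1%nat \/ i = 2%nat) by lia.
  destruct ci as [-> | ->]; unfold rowsjk, rows.
  - destruct (hB 1%nat ltac:(lia)) as (h1 & h2 & h3). apply shifted_row_neq_0; tauto.
  - destruct (hB 2%nat ltac:(lia)) as (h1 & h2 & h3). apply shifted_row_neq_0; tauto.
Qed.

Lemma cf_admissible (j k : nat) : (1 <= j <= 3)%nat -> (1 <= k <= 3)%nat ->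
  admissible (cf j k) /\ cf j k 0%nat 0%nat = 1.
Proof.
  intros hj hk. split; [apply hcoef_admissible, rowsjk_neq_0; assumption|].
  unfold cf, hcoef. simpl. field.
Qed.

Lemma log_dom_branch (j k : nat) (x : C * C) : (1 <= j <= 3)%nat -> (1 <= k <= 3)%nat -> U x ->
  log_dom (l1 j x, l2 k x).
Proof.
  intros hj hk hx. apply (log_dom_of_dom_D x); [apply he1|apply he2|apply hUD]; assumption.
Qed.

Lemma Fjk_eq_Lbranch (j k : nat) (x : C * C) : (1 <= j <= 3)%nat -> (1 <= k <= 3)%nat -> U x ->
  Fjk a B p1 p2 j k x = Lbranch (l1 j) (l2 k) (al j) (be k) (cf j k) x.
Proof.
  intros hj hk hx. unfold Fjk, Lbranch, Lsum. rewrite hp1, hp2 by assumption.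
  destruct (cf_admissible j k hj hk) as [hc _].
  rewrite (DS_ext (Lterm (al j) (be k) (cf j k) (l1 j x, l2 k x))
    (fun m n => (Cexp (al j * l1 j x) * Cexp (be k * l2 k x)) * Lterm 0 0 (cf j k) (l1 j x, l2 k x) m n)).
  - rewrite DS_scal by (apply dominated_Lterm; [exact hc|apply log_dom_branch; assumption]).
    f_equal. apply DS_ext. intros m n. unfold Lterm; simpl fst; simpl snd.
    rewrite !Cplus_0_l, Cexp_plus, !Cexp_nat, he1, he2 by assumption. reflexivity.
  - intros m n. unfold Lterm; simpl fst; simpl snd.
    replace ((al j + INR m) * l1 j x + (be k + INR n) * l2 k x)
      with (al j * l1 j x + (be k * l2 k x + ((0 + INR m) * l1 j x + (0 + INR n) * l2 k x))) by ring.
    rewrite (Cexp_plus (al j * l1 j x)), (Cexp_plus (be k * l2 k x)). ring.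
Qed.

Lemma Fjk_solution (j k : nat) : (1 <= j <= 3)%nat -> (1 <= k <= 3)%nat ->
  is_solution a B U (Fjk a B p1 p2 j k).
Proof.
  intros hj hk. apply (is_solution_ext a B U (Lbranch (l1 j) (l2 k) (al j) (be k) (cf j k))); [exact hU| |].
  { intros x hx. symmetry. apply Fjk_eq_Lbranch; assumption. }
  destruct (shifted_row_recurrence B 1 j (proj1 hB3) hj) as [r10 r1].
  destruct (shifted_row_recurrence B 2 k (proj2 hB3) hk) as [r20 r2].
  assert (Ea : forall l, (1 <= l <= 3)%nat -> shifted_a a B j k l = a l + al j + be k)
    by (intros l hl; apply shifted_a_eq, hl).
  apply series_solution; try assumption.
  - intros x hx. eapply cdiff_eq.
    + apply (log_branch_cdiff (l1 j) fst x 1 0 U hU hx); [apply he1, hj|apply continuous_C2, hc1; assumption|apply cdiff_fst].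
    + unfold Cdiv. ring.
    + unfold Cdiv. ring.
  - intros x hx. eapply cdiff_eq.
    + apply (log_branch_cdiff (l2 k) snd x 0 1 U hU hx); [apply he2, hk|apply continuous_C2, hc2; assumption|apply cdiff_snd].
    + unfold Cdiv. ring.
    + unfold Cdiv. ring.
  - apply he1, hj.
  - apply he2, hk.
  - intros x hx. apply log_dom_branch; assumption.
  - apply cf_admissible; assumption.
  - intros m n. unfold al. rewrite r1. unfold cf.
    etransitivity; [exact (proj1 (hcoef_recurrence _ _ m n (rowsjk_neq_0 j k hj hk)))|].
    rewrite !Ea by lia. reflexivity.
  - intros m n. unfold be. rewrite r2. unfold cf.
    etransitivity; [exact (proj2 (hcoef_recurrence _ _ m n (rowsjk_neq_0 j k hj hk)))|].
    rewrite !Ea by lia. reflexivity.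
Qed.

Lemma exponents_distinct (i j : nat) : (1 <= i <= 3)%nat -> (1 <= j <= 3)%nat -> i <> j ->
  ~ is_integer (al i - al j) /\ ~ is_integer (be i - be j).
Proof.
  assert (key : forall B' : nat -> C, ~ is_integer (B' 1%nat) -> ~ is_integer (B' 2%nat) ->
    ~ is_integer (B' 1%nat - B' 2%nat) -> B' 3%nat = 1 ->
    forall i j, (1 <= i <= 3)%nat -> (1 <= j <= 3)%nat -> i <> j -> ~ is_integer ((1 - B' i) - (1 - B' j))).
  { clear i j. intros B' n1 n2 n12 h3.
    assert (z0 : is_integer 0) by (apply (is_integer_INR 0)).
    assert (z1 : is_integer 1) by (apply (is_integer_INR 1)).
    assert (zn : is_integer (0 - 1)) by (apply is_integer_minus; assumption).
    intros i j hi hj hne hz.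
    assert (hz' : is_integer (0 - ((1 - B' i) - (1 - B' j)))) by (apply is_integer_minus; assumption).
    assert (ci : i = 1%nat \/ i = 2%nat \/ i = 3%nat) by lia.
    assert (cj : j = 1%nat \/ j = 2%nat \/ j = 3%nat) by lia.
    destruct ci as [-> | [-> | ->]]; destruct cj as [-> | [-> | ->]]; try lia; rewrite ?h3 in *.
    - apply n12. apply (is_integer_eq _ _ hz'). ring.
    - apply n1. apply (is_integer_eq _ _ (is_integer_minus _ _ hz' zn)). ring.
    - apply n12. apply (is_integer_eq _ _ hz). ring.
    - apply n2. apply (is_integer_eq _ _ (is_integer_minus _ _ hz' zn)). ring.
    - apply n1. apply (is_integer_eq _ _ (is_integer_minus _ _ hz zn)). ring.
    - apply n2. apply (is_integer_eq _ _ (is_integer_minus _ _ hz zn)). ring. }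
  intros hi hj hne. destruct (hB 1%nat ltac:(lia)) as (h1 & h2 & h3).
  destruct (hB 2%nat ltac:(lia)) as (h4 & h5 & h6).
  split; [apply (key (B 1%nat))|apply (key (B 2%nat))]; tauto.
Qed.

Variable x0 : C * C.
Hypothesis hx0 : U x0.

Let expw (w : C * C) : C * C := (Cexp (fst w), Cexp (snd w)).
Let w0 : C * C := (l1 1%nat x0, l2 1%nat x0).

Lemma expw_continuous (eps : R) : (0 < eps)%R ->
  exists d, (0 < d)%R /\ forall w, ball2 w0 d w -> ball2 x0 eps (expw w).
Proof.
  intros he.
  destruct (cderiv_ctn Cexp (fst w0) _ (cderiv_Cexp _) eps he) as (d1 & hd1 & H1).
  destruct (cderiv_ctn Cexp (snd w0) _ (cderiv_Cexp _) eps he) as (d2 & hd2 & H2).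
  exists (Rmin d1 d2). split; [apply Rmin_pos; assumption|]. intros w [h1 h2].
  specialize (H1 _ (Rlt_le_trans _ _ _ h1 (Rmin_l _ _))).
  specialize (H2 _ (Rlt_le_trans _ _ _ h2 (Rmin_r _ _))).
  unfold w0 in H1, H2. simpl in H1, H2. rewrite he1 in H1 by (lia || exact hx0). rewrite he2 in H2 by (lia || exact hx0).
  split; assumption.
Qed.

(** In the tube coordinates near [w0], a logarithm minus the coordinate has an increment [u] with
    [Cexp u = 1]. Continuity keeps [u] below [/ 24 + / 24 = / 12], so it is 0 by [Cexp_near_1]. *)
Lemma log_branches_differ_by_constant (l : C * C -> C) (pr : C * C -> C) :
  (pr = fst \/ pr = snd) ->
  (forall x, U x -> continuous l x) -> (forall x, U x -> Cexp (l x) = pr x) ->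
  exists d, (0 < d)%R /\ forall w, ball2 w0 d w -> U (expw w) /\ l (expw w) = pr w + (l x0 - pr w0).
Proof.
  intros hpr hl hel.
  assert (hpw : forall w, pr (expw w) = Cexp (pr w)) by (intros w; destruct hpr; subst pr; reflexivity).
  assert (hp0 : Cexp (pr w0) = pr x0).
  { destruct hpr; subst pr; unfold w0; simpl; [apply he1|apply he2]; (lia || exact hx0). }
  assert (hpb : forall d w, ball2 w0 d w -> (Cmod (pr w - pr w0) < d)%R).
  { intros d w [h1 h2]. destruct hpr; subst pr; assumption. }
  destruct (hU x0 hx0) as (r & hr & Hr).
  destruct (continuous_C2 l x0 (hl x0 hx0) (/ 24)%R ltac:(lra)) as (r' & hr' & Hr').
  destruct (expw_continuous (Rmin r r')) as (d & hd & Hd); [apply Rmin_pos; assumption|].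
  exists (Rmin d (/ 24)). split; [apply Rmin_pos; lra|]. intros w hw.
  pose proof (Hd w (ball2_le _ _ _ _ (Rmin_l _ _) hw)) as hb.
  assert (hUw : U (expw w)) by (apply Hr, (ball2_le _ _ _ _ (Rmin_l r r') hb)).
  split; [exact hUw|].
  pose proof (Hr' _ (ball2_le _ _ _ _ (Rmin_r r r') hb)) as e1.
  pose proof (hpb _ _ (ball2_le _ _ _ _ (Rmin_r _ _) hw)) as e2.
  set (u := (l (expw w) - l x0) - (pr w - pr w0)).
  assert (hu : (Cmod u <= / 12)%R).
  { unfold u. eapply Rle_trans; [apply Cmod_triangle_minus|]. lra. }
  assert (Eu : Cexp u = 1).
  { unfold u. replace (l (expw w) - l x0 - (pr w - pr w0))
      with ((l (expw w) + - pr w) + (- l x0 + pr w0)) by ring.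
    rewrite !Cexp_plus, !Cexp_opp, hel, hel, hpw, hp0 by assumption.
    assert (pr x0 <> 0) by (rewrite <- hp0; apply Cexp_neq_0).
    pose proof (Cexp_neq_0 (pr w)). field. split; assumption. }
  destruct (Cexp_near_1 u hu) as [X _]. rewrite Eu in X.
  replace (1 - 1) with (RtoC 0) in X by ring. rewrite Cmod_0 in X.
  assert (u0 : u = 0) by (apply Cmod_eq_0; pose proof (Cmod_ge_0 u); lra).
  replace (l (expw w)) with (u + (pr w + (l x0 - pr w0))) by (unfold u; ring). rewrite u0. ring.
Qed.

Lemma three_log_branches_differ_by_constants (l : nat -> C * C -> C) (pr : C * C -> C) :
  (pr = fst \/ pr = snd) ->
  (forall j, (1 <= j <= 3)%nat -> forall x, U x -> continuous (l j) x) ->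
  (forall j, (1 <= j <= 3)%nat -> forall x, U x -> Cexp (l j x) = pr x) ->
  exists d, (0 < d)%R /\ forall w, ball2 w0 d w -> U (expw w) /\
    forall j, (1 <= j <= 3)%nat -> l j (expw w) = pr w + (l j x0 - pr w0).
Proof.
  intros hpr hl hel.
  destruct (log_branches_differ_by_constant (l 1%nat) pr hpr (hl 1%nat ltac:(lia)) (hel 1%nat ltac:(lia))) as (d1 & k1 & H1).
  destruct (log_branches_differ_by_constant (l 2%nat) pr hpr (hl 2%nat ltac:(lia)) (hel 2%nat ltac:(lia))) as (d2 & k2 & H2).
  destruct (log_branches_differ_by_constant (l 3%nat) pr hpr (hl 3%nat ltac:(lia)) (hel 3%nat ltac:(lia))) as (d3 & k3 & H3).
  exists (Rmin d1 (Rmin d2 d3)). split; [repeat apply Rmin_pos; assumption|]. intros w hw.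
  pose proof (Rmin_l d1 (Rmin d2 d3)). pose proof (Rmin_r d1 (Rmin d2 d3)).
  pose proof (Rmin_l d2 d3). pose proof (Rmin_r d2 d3).
  destruct (H1 w (ball2_le _ _ (Rmin d1 (Rmin d2 d3)) d1 ltac:(lra) hw)) as [hUw E1].
  split; [exact hUw|]. intros j hj.
  assert (cj : j = 1%nat \/ j = 2%nat \/ j = 3%nat) by lia.
  destruct cj as [-> | [-> | ->]].
  - exact E1.
  - apply H2, (ball2_le _ _ (Rmin d1 (Rmin d2 d3))); [lra|exact hw].
  - apply H3, (ball2_le _ _ (Rmin d1 (Rmin d2 d3))); [lra|exact hw].
Qed.

(** Near [w0] the relation lifts to one between translated series. The translations are by periods
    of [Cexp], hence amount to nonzero factors, and the lifted relation extends to the whole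
    tube. *)
Lemma Fjk_independent (c : nat -> nat -> C) :
  (forall x, U x -> lin_comb c (Fjk a B p1 p2) x = 0) ->
  forall j k, (1 <= j <= 3)%nat -> (1 <= k <= 3)%nat -> c j k = 0.
Proof.
  intros Hc.
  set (k1 := fun j => l1 j x0 - fst w0). set (k2 := fun k => l2 k x0 - snd w0).
  assert (hk1 : forall j, (1 <= j <= 3)%nat -> Cexp (k1 j) = 1).
  { intros j hj. unfold k1, w0; simpl. replace (l1 j x0 - l1 1%nat x0) with (l1 j x0 + - l1 1%nat x0) by ring.
    rewrite Cexp_plus, Cexp_opp, !he1 by (lia || assumption). field. apply (coords_neq_0 U hUD x0 hx0). }
  assert (hk2 : forall k, (1 <= k <= 3)%nat -> Cexp (k2 k) = 1).
  { intros k hk. unfold k2, w0; simpl. replace (l2 k x0 - l2 1%nat x0) with (l2 k x0 + - l2 1%nat x0) by ring.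
    rewrite Cexp_plus, Cexp_opp, !he2 by (lia || assumption). field. apply (coords_neq_0 U hUD x0 hx0). }
  (* The coefficients of the lifted relation: [c j k] times the eigenvalue from [Lsum_translate]. *)
  set (d := fun j k => c j k * Cexp (al j * k1 j + be k * k2 k)).
  set (G := fun w => csum 9 (fun i => d (1 + i / 3)%nat (1 + i mod 3)%nat *
    Lsum (al (1 + i / 3)%nat) (be (1 + i mod 3)%nat) (cf (1 + i / 3)%nat (1 + i mod 3)%nat) w)).
  assert (idx : forall i, (i < 9)%nat -> (1 <= 1 + i / 3 <= 3)%nat /\ (1 <= 1 + i mod 3 <= 3)%nat).
  { intros i hi. do 9 (destruct i as [|i]; [simpl; lia|]). lia. }
  assert (hG : hol log_dom G).
  { unfold G.
    assert (X : forall n, (n <= 9)%nat -> hol log_dom (fun w => csum n (fun i => d (1 + i / 3)%nat (1 + i mod 3)%nat *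
      Lsum (al (1 + i / 3)%nat) (be (1 + i mod 3)%nat) (cf (1 + i / 3)%nat (1 + i mod 3)%nat) w))).
    { induction n as [|n IH]; intros hn; [exact (hol_const log_dom 0)|]. simpl csum.
      destruct (idx n ltac:(lia)) as [i1 i2].
      apply hol_plus; [apply IH; lia|]. apply hol_mult; [apply hol_const|].
      intros w hw. eexists; eexists. apply Lsum_cdiff; [|exact hw]. apply cf_admissible; assumption. }
    apply X. lia. }
  destruct (three_log_branches_differ_by_constants l1 fst (or_introl eq_refl) hc1 he1) as (r1 & hr1 & H1).
  destruct (three_log_branches_differ_by_constants l2 snd (or_intror eq_refl) hc2 he2) as (r2 & hr2 & H2).
  assert (hw0 : log_dom w0) by (apply log_dom_branch; (lia || exact hx0)).
  destruct (log_dom_open w0 hw0) as (r3 & hr3 & H3).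
  assert (Gnear : vanishes_near G w0).
  { exists (Rmin r1 (Rmin r2 r3)). split; [repeat apply Rmin_pos; assumption|]. intros w hw.
    pose proof (Rmin_l r1 (Rmin r2 r3)). pose proof (Rmin_r r1 (Rmin r2 r3)).
    pose proof (Rmin_l r2 r3). pose proof (Rmin_r r2 r3).
    destruct (H1 w (ball2_le _ _ (Rmin r1 (Rmin r2 r3)) r1 ltac:(lra) hw)) as [hUw E1].
    destruct (H2 w (ball2_le _ _ (Rmin r1 (Rmin r2 r3)) r2 ltac:(lra) hw)) as [_ E2].
    pose proof (H3 w (ball2_le _ _ (Rmin r1 (Rmin r2 r3)) r3 ltac:(lra) hw)) as hwd.
    rewrite <- (Hc _ hUw), lin_comb_expand. unfold G. apply csum_ext. intros i hi.
    destruct (idx i hi) as [i1 i2]. set (j := (1 + i / 3)%nat) in *. set (k := (1 + i mod 3)%nat) in *.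
    rewrite Fjk_eq_Lbranch by assumption. unfold Lbranch. rewrite E1, E2 by assumption.
    fold (k1 j) (k2 k). change (fst w + k1 j, snd w + k2 k) with (shift2 w (k1 j) (k2 k)).
    rewrite Lsum_translate; [|apply cf_admissible; assumption|exact hwd|apply hk1; assumption|apply hk2; assumption].
    unfold d. ring. }
  pose proof (identity_theorem log_dom G w0 log_dom_open log_dom_path_connected hG hw0 Gnear) as GZ.
  assert (D0 : forall j k, (1 <= j <= 3)%nat -> (1 <= k <= 3)%nat -> d j k = 0).
  { apply (exponential_independence al be cf d exponents_distinct cf_admissible).
    intros w hw. transitivity (G w); [|apply GZ, hw]. unfold sum3, G. simpl. ring. }
  intros j k hj hk. pose proof (D0 j k hj hk) as Z. unfold d in Z.
  apply NNPP. intros h. revert Z. apply Cmult_neq_0; [exact h|apply Cexp_neq_0].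
Qed.

Lemma Fjk_span (f : C * C -> C) : is_solution a B U f ->
  exists c : nat -> nat -> C, forall x, U x -> f x = lin_comb c (Fjk a B p1 p2) x.
Proof.
  intros hf.
  assert (idx : forall i, (i < 9)%nat -> (1 <= 1 + i / 3 <= 3)%nat /\ (1 <= 1 + i mod 3 <= 3)%nat /\
    (3 * (1 + i / 3 - 1) + (1 + i mod 3 - 1) = i)%nat).
  { intros i hi. do 9 (destruct i as [|i]; [simpl; lia|]). lia. }
  destruct (nine_solutions_span a B U x0 (fun i => Fjk a B p1 p2 (1 + i / 3)%nat (1 + i mod 3)%nat)
    hU hpc hUD hx0) with (f := f) as [c Hc].
  - intros i hi. destruct (idx i hi) as (i1 & i2 & _). apply Fjk_solution; assumption.
  - intros c Hc i hi. destruct (idx i hi) as (i1 & i2 & i3). rewrite <- i3.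
    apply (Fjk_independent (fun j k => c (3 * (j - 1) + (k - 1))%nat)); [|assumption|assumption].
    intros x hx. rewrite <- (Hc x hx), lin_comb_expand. apply csum_ext. intros i' hi'.
    destruct (idx i' hi') as (_ & _ & E). rewrite E. reflexivity.
  - exact hf.
  - exists (fun j k => c (3 * (j - 1) + (k - 1))%nat). intros x hx. rewrite (Hc x hx), lin_comb_expand.
    apply csum_ext. intros i' hi'. destruct (idx i' hi') as (_ & _ & E). rewrite E. reflexivity.
Qed.

End Branches.

Theorem theorem2p2
  (a1 a2 a3 b1 b2 b3 b4 : C)
  (hb1 : ~ is_integer b1) (hb2 : ~ is_integer b2)
  (hb3 : ~ is_integer b3) (hb4 : ~ is_integer b4)
  (hb12 : ~ is_integer (b1 - b2)) (hb34 : ~ is_integer (b3 - b4))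
  (eps1 eps2 : R) (heps2 : (0 < eps2)%R) (heps12 : (eps2 < eps1)%R)
  (U : C * C -> Prop)
  (hUopen : open U) (hUsc : simply_connected U)
  (hUbase : U (RtoC eps1, RtoC eps2))
  (hUD : forall x, U x -> dom_D x /\ dom_X x)
  (p1 p2 : nat -> C * C -> C)
  (hp1 : forall j, (1 <= j <= 3)%nat ->
     power_branch U 1 (1 - rows (row3 b1 b2 1) (row3 b3 b4 1) 1%nat j) (p1 j))
  (hp2 : forall k, (1 <= k <= 3)%nat ->
     power_branch U 2 (1 - rows (row3 b1 b2 1) (row3 b3 b4 1) 2%nat k) (p2 k)) :
  fundamental_system (row3 a1 a2 a3) (rows (row3 b1 b2 1) (row3 b3 b4 1)) U
    (Fjk (row3 a1 a2 a3) (rows (row3 b1 b2 1) (row3 b3 b4 1)) p1 p2).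
Proof.
  set (a := row3 a1 a2 a3). set (B := rows (row3 b1 b2 1) (row3 b3 b4 1)).
  pose proof (open_open2 U hUopen) as hU. destruct hUsc as [hpc _].
  (* Finite choice of the logarithms behind the three branches; the default case of the match is
     index 3. *)
  assert (pick : forall i s p, (forall j, (1 <= j <= 3)%nat -> power_branch U i (s j) (p j)) ->
    exists l : nat -> C * C -> C, forall j, (1 <= j <= 3)%nat ->
      (forall x, U x -> continuous (l j) x) /\ (forall x, U x -> Cexp (l j x) = coord i x) /\
      (forall x, U x -> p j x = Cexp (s j * l j x))).
  { intros i s p H.
    destruct (H 1%nat ltac:(lia)) as [l1 H1]. destruct (H 2%nat ltac:(lia)) as [l2 H2].
    destruct (H 3%nat ltac:(lia)) as [l3 H3].
    exists (fun j => match j with 1%nat => l1 | 2%nat => l2 | _ => l3 end). intros j hj.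
    assert (cj : j = 1%nat \/ j = 2%nat \/ j = 3%nat) by lia.
    destruct cj as [-> | [-> | ->]]; assumption. }
  destruct (pick 1%nat (fun j => 1 - B 1%nat j) p1 hp1) as [l1 H1].
  destruct (pick 2%nat (fun k => 1 - B 2%nat k) p2 hp2) as [l2 H2].
  assert (hB : forall i, (1 <= i <= 2)%nat ->
    ~ is_integer (B i 1%nat) /\ ~ is_integer (B i 2%nat) /\ ~ is_integer (B i 1%nat - B i 2%nat)).
  { intros i hi. assert (ci : i = 1%nat \/ i = 2%nat) by lia.
    destruct ci as [-> | ->]; unfold B; simpl; auto. }
  assert (hB3 : B 1%nat 3%nat = 1 /\ B 2%nat 3%nat = 1) by (split; reflexivity).
  pose proof (fun j hj => proj1 (H1 j hj)) as hc1. pose proof (fun k hk => proj1 (H2 k hk)) as hc2.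
  pose proof (fun j hj => proj1 (proj2 (H1 j hj))) as he1.
  pose proof (fun k hk => proj1 (proj2 (H2 k hk))) as he2.
  pose proof (fun j hj => proj2 (proj2 (H1 j hj))) as hq1.
  pose proof (fun k hk => proj2 (proj2 (H2 k hk))) as hq2.
  split; [|split].
  - exact (Fjk_solution a B U hU hUD hB3 hB l1 l2 p1 p2 hc1 hc2 he1 he2 hq1 hq2).
  - exact (Fjk_independent a B U hU hUD hB3 hB l1 l2 p1 p2 hc1 hc2 he1 he2 hq1 hq2 _ hUbase).
  - exact (Fjk_span a B U hU hpc hUD hB3 hB l1 l2 p1 p2 hc1 hc2 he1 he2 hq1 hq2 _ hUbase).
Qed.
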